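(* Let $0<\beta<1$, $r=(2-\beta)/\beta$, $q=2-\beta$, and let $p=\frac{2-\beta}{1-\beta}$ be the conjugate exponent of $q$. Let $f^+,f^-\in L^2(\Omega)$ be non-negative with $\int_\Omega f^+\,dx=\int_\Omega f^-\,dx$, and put $f=f^+-f^-$. Let $L^r_+(\Omega)$ be the set of non-negative functions in $L^r(\Omega)$, and let $\mathcal{L}_\beta$ be the functional defined in the context. Then $$\inf_{\mu\in L^r_+(\Omega)}\mathcal{L}_\beta(\mu)=\inf_{v\in [L^q(\Omega)]^d}\left\{\int_\Omega\frac{|v|^q}{q}\,dx\ :\ \nabla\cdot v=f\right\}.$$ Moreover, $\mathcal{L}_\beta$ admits a unique minimizer $\mu_\beta^*\in L^r_+(\Omega)$, given by $\mu^*_\beta=|\nabla u_p|^{p-2}$, where $u_p$ is the weak solution of the $p$-Poisson equation $$-\nabla\cdot\big(|\nabla u_p|^{p-2}\nabla u_p\big)=f$$ with zero Neumann boundary conditions.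
   Context: $\Omega\subset\mathbb{R}^d$ is an open, bounded, connected, convex domain with smooth boundary. The functional is $$\mathcal{L}_\beta(\mu):=\mathcal{E}_f(\mu)+\frac12\int_\Omega\frac{\mu^{\frac{2-\beta}{\beta}}}{\frac{2-\beta}{\beta}}\,dx,\qquad \mathcal{E}_f(\mu):=\frac12\int_\Omega\mu\,|\nabla u_f(\mu)|^2\,dx,$$ where $u_f(\mu)$ is the weak solution of $-\nabla\cdot(\mu\nabla u)=f$ with zero Neumann boundary conditions. For general (possibly degenerate) $\mu\in L^r_+(\Omega)$ the energy is understood through the variational characterization $$\mathcal{E}_f(\mu)=\sup_{\varphi\in W^{1,p}(\Omega)}\left\{\int_\Omega \varphi f\,dx-\int_\Omega\frac{|\nabla\varphi|^2}{2}\,\mu\,dx\right\}\in[0,+\infty].$$ The constraint $\nabla\cdot v=f$ is understood in the weak sense including the zero-flux (Neumann) boundary condition, i.e. $-\int_\Omega v\cdot\nabla\varphi\,dx=\int_\Omega f\varphi\,dx$ for all $\varphi\in W^{1,p}(\Omega)$. The weak solution $u_p\in W^{1,p}(\Omega)$ (unique up to an additive constant) satisfies $\int_\Omega|\nabla u_p|^{p-2}\nabla u_p\cdot\nabla\varphi\,dx=\int_\Omega f\varphi\,dx$ for all $\varphi\in W^{1,p}(\Omega)$. *)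

(* Defs.v *)
From HB Require Import structures.
From mathcomp Require Import all_boot all_order all_algebra.
From mathcomp Require Import all_classical all_reals all_analysis.

Set Implicit Arguments.
Unset Strict Implicit.
Unset Printing Implicit Defensive.

Import Order.TTheory GRing.Theory Num.Theory.
Import numFieldNormedType.Exports.

Local Open Scope classical_set_scope.
Local Open Scope ring_scope.

Definition measure_mx_display : measure_display.
Proof. exact: default_measure_display. Qed.

Section measurable_mx.
Context (R : realType) (m n : nat).

(* The product sigma-algebra, generated by the coordinates; it is the Borel
   sigma-algebra of the finite-dimensional space 'M[R]_(m, n). *)
Definition mx_cylinders : set (set 'M[R]_(m, n)) :=
  [set A | exists i j (B : set R),
     measurable B /\ A = (fun M : 'M[R]_(m, n) => M i j) @^-1` B].

Let mx_measurable := <<s mx_cylinders >>.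

Let mx_set0 : mx_measurable set0.
Proof. exact: sigma_algebra0. Qed.

Let mx_setC A : mx_measurable A -> mx_measurable (~` A).
Proof. exact: sigma_algebraC. Qed.

Let mx_bigcup (F : _^nat) : (forall i, mx_measurable (F i)) ->
  mx_measurable (\bigcup_i (F i)).
Proof. exact: sigma_algebra_bigcup. Qed.

HB.instance Definition _ := @isMeasurable.Build measure_mx_display
  'M[R]_(m, n) mx_measurable mx_set0 mx_setC mx_bigcup.

Lemma measurable_coord i j :
  measurable_fun [set: 'M[R]_(m, n)] (fun M => M i j).
Proof.
move=> _ B mB; rewrite setTI; apply: sub_sigma_algebra.
by exists i, j, B.
Qed.

Lemma measurable_fun_mxP d (T : measurableType d) (f : T -> 'M[R]_(m, n)) :
  (forall i j, measurable_fun [set: T] (fun x => f x i j)) ->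
  measurable_fun [set: T] f.
Proof.
move=> mf; apply: (@measurability _ _ _ _ _ f mx_cylinders) => //.
move=> _ [A [i [j [B [mB ->]]]]] <-.
exact: (mf i j measurableT B mB).
Qed.

End measurable_mx.

Section lebesgue_rV.
Context (R : realType).

Definition rV_cons n (vx : 'rV[R]_n * measurableTypeR R) : 'rV[R]_n.+1 :=
  row_mx (vx.2)%:M vx.1.

Local Open Scope ereal_scope.

(* Lebesgue measure on R^n, restricted to the Borel sets and built as an
   iterated product; lebesgue_rV_box gives the volume of a box. *)
Fixpoint lebesgue_rV n : set 'rV[R]_n -> \bar R :=
  match n with
  | 0%N => \d_(0%R : 'rV[R]_0)
  | n'.+1 => pushforward (@lebesgue_rV n' \x @lebesgue_measure R) (@rV_cons n')
  end.

Let rV_uncons n (v : 'rV[R]_n.+1) : 'rV[R]_n * measurableTypeR R :=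
  (@rsubmx R 1 1 n v, v ord0 ord0).

Let rV_uncons_measurable n : measurable_fun setT (@rV_uncons n).
Proof.
apply: measurable_fun_pair; last exact: measurable_coord.
apply: measurable_fun_mxP => i j.
under eq_fun do rewrite mxE; exact: measurable_coord.
Qed.

Lemma measurable_rV_cons n : measurable_fun setT (@rV_cons n).
Proof.
apply: measurable_fun_mxP => i j; rewrite /rV_cons.
rewrite -(@fintype.splitK 1%N n j); case: (@fintype.split 1%N n j) => k /=.
- under eq_fun do rewrite (@row_mxEl _ _ 1 n) !ord1 mxE eqxx mulr1n.
  exact: measurable_snd.
- under eq_fun do rewrite (@row_mxEr _ _ 1 n).
  apply: (@measurableT_comp _ _ _ _ _ _ (fun v : 'rV[R]_n => v i k)) => //.
  exact: measurable_coord.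
Qed.

Let lebesgue_rV_ex n : exists mu : {measure set 'rV[R]_n -> \bar R},
  mu = @lebesgue_rV n :> (set _ -> _) /\ sigma_finite setT mu.
Proof.
elim: n => [|n [mu [muE musf]]].
  exists (\d_(0%R : 'rV[R]_0)); split=> //.
  by apply: fin_num_fun_sigma_finite; rewrite ?measure0//; exact: fin_num_measure.
pose nu : {measure set ('rV[R]_n * measurableTypeR R)%type -> \bar R} :=
  mu \x @lebesgue_measure R.
exists (@measure_function_pushforward__canonical__measure_function_Measure
  _ _ _ _ _ nu _ (@measurable_rV_cons n)).
split; first by rewrite /= muE.
have consK : cancel (@rV_cons n) (@rV_uncons n).
  move=> [v x]; rewrite /rV_uncons /rV_cons/=; congr (_, _).
    by rewrite row_mxKr.
  have -> : ord0 = @lshift 1 n ord0 by exact/val_inj.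
  by rewrite (@row_mxEl _ _ 1 n) mxE eqxx mulr1n.
have /sigma_finiteP[F [TF ndF Foo]] := musf.
have /sigma_finiteP[G [TG ndG Goo]] := sigma_finiteT (@lebesgue_measure R).
exists (fun k => @rV_uncons n @^-1` (F k `*` G k)).
  rewrite -preimage_bigcup (_ : \bigcup_k _ = setT) ?preimage_setT//.
  rewrite -subTset => -[v x] _.
  have [k _ Fkv] : (\bigcup_k F k) v by rewrite -TF.
  have [l _ Glx] : (\bigcup_k G k) x by rewrite -TG.
  exists (maxn k l) => //; split => /=.
    by move: v Fkv; exact/subsetPset/ndF/leq_maxl.
  by move: x Glx; exact/subsetPset/ndG/leq_maxr.
move=> k; have [mF Fkoo] := Foo k; have [mG Gkoo] := Goo k; split.
  rewrite -[X in measurable X]setTI.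
  by apply: rV_uncons_measurable => //; exact: measurableX.
rewrite /= /pushforward -comp_preimage (_ : _ \o _ = id); last first.
  by apply/funext => vx; exact: consK.
by rewrite preimage_id product_measure1E// lte_mul_pinfty// ge0_fin_numE.
Qed.

Let lebesgue_rV0 n : @lebesgue_rV n set0 = 0.
Proof. by have [mu [<- _]] := lebesgue_rV_ex n. Qed.

Let lebesgue_rV_ge0 n A : 0 <= @lebesgue_rV n A.
Proof. by have [mu [<- _]] := lebesgue_rV_ex n. Qed.

Let lebesgue_rV_sigma_additive n : semi_sigma_additive (@lebesgue_rV n).
Proof.
by have [mu [<- _]] := lebesgue_rV_ex n; exact: measure_semi_sigma_additive.
Qed.

HB.instance Definition _ n := isMeasure.Build _ _ _ (@lebesgue_rV n)
  (lebesgue_rV0 n) (@lebesgue_rV_ge0 n) (@lebesgue_rV_sigma_additive n).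

Let lebesgue_rV_sigma_finite n : sigma_finite setT (@lebesgue_rV n).
Proof. by have [mu [<- ]] := lebesgue_rV_ex n. Qed.

HB.instance Definition _ n := Measure_isSigmaFinite.Build _ _ _
  (@lebesgue_rV n) (@lebesgue_rV_sigma_finite n).

End lebesgue_rV.
Arguments lebesgue_rV {R n}.

Lemma lebesgue_rV_box (R : realType) n (A : 'I_n -> set (measurableTypeR R)) :
  (forall i, measurable (A i)) ->
  (lebesgue_rV [set v : 'rV[R]_n | forall i, A i (v ord0 i)] =
   \prod_(i < n) lebesgue_measure (A i))%E.
Proof.
elim: n A => [|n IH] A mA.
  by rewrite big_ord0 /= diracE mem_set // => -[].
rewrite big_ord_recl /= /pushforward.
pose B := [set v : 'rV[R]_n | forall i, A (lift ord0 i) (v ord0 i)].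
rewrite (_ : _ @^-1` _ = B `*` A ord0); last first.
  have e0 : ord0 = @lshift 1 n ord0 by exact/val_inj.
  have eS i : lift ord0 i = @rshift 1 n i by exact/val_inj.
  apply/seteqP; split => -[v x]; rewrite /B /rV_cons /=.
    move=> H; split.
      by move=> i; have := H (lift ord0 i); rewrite {2}eS (@row_mxEr _ _ 1 n).
    by have := H ord0; rewrite {2}e0 (@row_mxEl _ _ 1 n) mxE eqxx mulr1n.
  move=> [Hv Hx] i; case: (unliftP ord0 i) => [j|] ->.
    by rewrite {2}eS (@row_mxEr _ _ 1 n).
  by rewrite {2}e0 (@row_mxEl _ _ 1 n) mxE eqxx mulr1n.
have mB : measurable B.
  rewrite (_ : B = \bigcap_(i in [set: 'I_n])
      ((fun v : 'rV[R]_n => v ord0 i) @^-1` A (lift ord0 i))); last first.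
    by apply/seteqP; split => v /= H i; [move=> _; exact: H|exact: (H i I)].
  apply: fin_bigcap_measurable => [|i _]; first exact: finite_finset.
  by rewrite -[X in measurable X]setTI; apply: measurable_coord => //; exact: mA.
rewrite product_measure1E// muleC; congr (_ * _)%E.
by apply: (IH (fun i => A (lift ord0 i))) => i; exact: mA.
Qed.

Section sobolev.
Context (R : realType) (d : nat).
Implicit Types (Omega : set 'rV[R]_d) (p : R).

Definition dotrV (x y : 'rV[R]_d) : R := \sum_i x ord0 i * y ord0 i.

(* The library norm `|x| of a row vector is the sup norm. *)
Definition enorm (x : 'rV[R]_d) : R := Num.sqrt (dotrV x x).

(* Members of L^p(Omega) are represented by functions on the whole space whose
   values outside Omega are irrelevant. *)
Definition Lp Omega p : set ('rV[R]_d -> R) :=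
  [set u | (u \_ Omega) \in Lfun lebesgue_rV p%:E].

Definition Lp_vec Omega p : set ('rV[R]_d -> 'rV[R]_d) :=
  [set v | forall i, Lp Omega p (fun x => v x ord0 i)].

Definition ae_nonneg Omega (u : 'rV[R]_d -> R) :=
  {ae lebesgue_rV, forall x, Omega x -> 0 <= u x}.

Definition Lp_plus Omega p : set ('rV[R]_d -> R) :=
  [set u | Lp Omega p u /\ ae_nonneg Omega u].

End sobolev.

Section smooth.
Context (R : realType) (d : nat).

Definition pderive (i : 'I_d) (u : 'rV[R]_d -> R) : 'rV[R]_d -> R :=
  'D_(delta_mx ord0 i) u.

Definition smooth (u : 'rV[R]_d -> R) := forall s : seq 'I_d,
  continuous (foldr pderive u s) /\
  forall x i, derivable (foldr pderive u s) x (delta_mx ord0 i).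

Definition test_function (Omega : set 'rV[R]_d) (psi : 'rV[R]_d -> R) :=
  let supp := closure [set x | psi x != 0] in
  [/\ smooth psi, compact supp & supp `<=` Omega].

Definition weak_gradient (Omega : set 'rV[R]_d) (u : 'rV[R]_d -> R)
    (g : 'rV[R]_d -> 'rV[R]_d) :=
  forall psi, test_function Omega psi -> forall i,
    \int[lebesgue_rV]_(x in Omega) (u x * pderive i psi x) =
    - (\int[lebesgue_rV]_(x in Omega) (g x ord0 i * psi x)).

(* [W1 Omega p phi g] : phi belongs to W^{1,p}(Omega) and g represents its
   (almost everywhere unique) weak gradient. *)
Definition W1 (Omega : set 'rV[R]_d) (p : R) (phi : 'rV[R]_d -> R)
    (g : 'rV[R]_d -> 'rV[R]_d) :=
  [/\ Lp Omega p phi, Lp_vec Omega p g & weak_gradient Omega phi g].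

End smooth.

(* Near each boundary point, Omega is the strict epigraph (b = false) or
   hypograph (b = true) of a smooth function of all coordinates but the i-th. *)
Definition smooth_boundary (R : realType) (d : nat) (Omega : set 'rV[R]_d) :=
  forall x0, (closure Omega `\` Omega°) x0 ->
  exists (e : R) (i : 'I_d) (b : bool) (gamma : 'rV[R]_d.-1 -> R),
    [/\ 0 < e, smooth gamma &
      forall y, ball x0 e y ->
        Omega y <-> (-1) ^+ b * gamma (col' i y) < (-1) ^+ b * y ord0 i].

Definition smooth_convex_domain (R : realType) (d : nat)
    (Omega : set 'rV[R]_d) :=
  [/\ Omega !=set0, open Omega & connected Omega] /\
  [/\ bounded_set Omega, convex_set Omega & smooth_boundary Omega].

Section functional.
Context (R : realType) (d : nat) (Omega : set 'rV[R]_d).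
Implicit Types (f mu : 'rV[R]_d -> R) (p q beta : R).

Local Open Scope ereal_scope.

(* The dual form of 1/2 \int mu |grad u_f(mu)|^2, which also makes sense for
   degenerate mu. For mu in L^r_+(Omega) with 1/r + 2/p = 1 both integrals are
   finite, so the difference below is never of the form +oo - oo. *)
Definition energy p f mu : \bar R :=
  ereal_sup [set e | exists phi g, W1 Omega p phi g /\
    e = (\int[lebesgue_rV]_(x in Omega) (phi x * f x)%:E) -
        (\int[lebesgue_rV]_(x in Omega) (enorm (g x) ^+ 2 / 2 * mu x)%:E)].

Definition Lbeta beta f mu : \bar R :=
  let r := ((2 - beta) / beta)%R in
  energy ((2 - beta) / (1 - beta)) f mu +
  2^-1%:E * \int[lebesgue_rV]_(x in Omega) (mu x `^ r / r)%:E.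

Definition flux_cost q (v : 'rV[R]_d -> 'rV[R]_d) : \bar R :=
  \int[lebesgue_rV]_(x in Omega) (enorm (v x) `^ q / q)%:E.

Local Close Scope ereal_scope.

(* div v = f with zero flux through the boundary, tested against W^{1,p}. *)
Definition div_eq p f (v : 'rV[R]_d -> 'rV[R]_d) :=
  forall phi g, W1 Omega p phi g ->
    - (\int[lebesgue_rV]_(x in Omega) dotrV (v x) (g x)) =
    \int[lebesgue_rV]_(x in Omega) (f x * phi x).

Definition p_poisson p f (u : 'rV[R]_d -> R) (gu : 'rV[R]_d -> 'rV[R]_d) :=
  W1 Omega p u gu /\
  forall phi g, W1 Omega p phi g ->
    \int[lebesgue_rV]_(x in Omega)
      (enorm (gu x) `^ (p - 2) * dotrV (gu x) (g x)) =
    \int[lebesgue_rV]_(x in Omega) (f x * phi x).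

End functional.

Definition minimizer_on (R : realType) (T : Type) (F : T -> \bar R)
    (A : set T) (x : T) :=
  A x /\ forall y, A y -> (F x <= F y)%E.

(* Main.v *)
Require Import Defs.
From mathcomp Require Import all_boot all_order all_algebra.
From mathcomp Require Import all_classical all_reals all_analysis.
From mathcomp Require Import measurable_realfun.
From mathcomp Require Import ring lra.

(** The two infima are both A / q, where A is the integral of |grad u|^p for a
solution u of the p-Poisson equation.

Testing the equation with u itself gives A = int f u. If div v = f, then also
A = - int v . grad u, and Young's inequality with the exponents q and p bounds
this by the cost of v plus A / p; since 1 - 1/p = 1/q, the cost of v is at least
A / q ([flux_cost_ge]). In the same way u is a competitor in the supremum that
defines the energy of mu, so Lbeta at mu is at least
A - int |grad u|^2 mu / 2 + int mu^r / (2 r), and Young's inequality with the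
exponents p/2 and r, which are conjugate, bounds this below by A / q
([Lbeta_ge]). The values are attained. The flux v = - |grad u|^(p-2) grad u is
admissible by the equation and |v|^q = |grad u|^p ([flux_star]). The density
mu = |grad u|^(p-2) satisfies mu^r = |grad u|^p, and its energy is at most A / 2,
because the equation turns int f phi into the integral of mu grad u . grad phi,
which Cauchy-Schwarz dominates ([Lbeta_star]). For a minimiser, Young's
inequality has to be an equality almost everywhere, which forces
mu = |grad u|^(p-2) ([Lbeta_le_ae]); applied to the gradient of another
solution, the same argument identifies its density with the first one.

What remains is the existence of u, by minimisation of
int |grad phi|^p / p - int f phi over W^{1,p}. The Poincare inequality
([poincare]) bounds this functional from below. As p > 2, Clarkson's inequality
([enorm_clarkson]) controls the L^p distance of two gradients by how far the
functions are from being minimisers ([gradient_distance_le]); hence minimising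
sequences of mean zero converge strongly, without any weak compactness argument
([minimiser_exists]). The equation follows by comparison with u + phi / (n + 1)
([minimiser_p_poisson]).

The Poincare inequality rests on the identity
phi (x + h) - phi x = int_0^1 grad phi (x + t h) . h dt, valid for almost every
x in Omega with x + h in Omega, as the segment stays in the convex set Omega
([translation_line_mean]). It is obtained from the definition of weak gradients
by Fubini's theorem, translation invariance and the fundamental theorem of
calculus applied to the test function. The p-th power of the identity is then
integrated over x and over all relevant h. The test functions are products of
one-dimensional profiles exp (- c / t); when c tends to 0 they tend to the
indicators of boxes, and boxes separate integrable functions
([box_integrals_eq0_open]). *)

Set Implicit Arguments.
Unset Strict Implicit.
Unset Printing Implicit Defensive.

Import Order.TTheory GRing.Theory Num.Theory.
Import numFieldNormedType.Exports.

Local Open Scope classical_set_scope.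
Local Open Scope ring_scope.

(** * Power inequalities and the Euclidean norm *)

Section real_inequalities.
Context (R : realType).
Implicit Types a b p q s t : R.

(** Equality in Young's inequality: for positive a and b, with X = ln (a^p) and
Y = ln (b^q), it reads
exp (X / p + Y / q) = exp X / p + exp Y / q, and exp is strictly convex. *)
Lemma young_eq a b p q : 0 <= a -> 0 <= b -> 1 < p -> 1 < q ->
  p^-1 + q^-1 = 1 -> a `^ p / p + b `^ q / q <= a * b -> a `^ p = b `^ q.
Proof.
move=> a0 b0 p1 q1 pq.
have p0 : 0 < p by apply: lt_trans p1.
have q0 : 0 < q by apply: lt_trans q1.
have [->|an0] := eqVneq a 0.
  rewrite mul0r powR0 ?gt_eqF// mul0r add0r => h.
  have : b `^ q / q <= 0 / q by rewrite mul0r.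
  rewrite ler_pM2r ?invr_gt0// => {}h.
  by apply/eqP; rewrite eq_le powR_ge0.
have [->|bn0] := eqVneq b 0.
  rewrite mulr0 powR0 ?gt_eqF// mul0r addr0 => h.
  have : a `^ p / p <= 0 / p by rewrite mul0r.
  rewrite ler_pM2r ?invr_gt0// => {}h.
  by apply/eqP; rewrite eq_le powR_ge0 h.
have a_gt0 : 0 < a by rewrite lt_neqAle eq_sym an0.
have b_gt0 : 0 < b by rewrite lt_neqAle eq_sym bn0.
(* Z below is the barycentre of X and Y, so a b = exp Z; unless X = Z, the tangent
   of exp at Z is strictly below exp at X, and below exp at Y in any case. *)
rewrite /powR (negbTE an0) (negbTE bn0).
set X := p * ln a; set Y := q * ln b => h.
have abE : a * b = expR (X / p + Y / q).
  rewrite expRD /X /Y (mulrC p) (mulrC q) !mulfK ?gt_eqF//.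
  by rewrite !lnK ?posrE.
set Z := X / p + Y / q in abE.
apply/eqP; apply: contraT => XY.
have {}XY : X - Z != 0.
  apply: contraNneq XY => XZ.
  have qE : q^-1 = 1 - p^-1 by rewrite -pq addrC addKr.
  have : q^-1 * (X - Y) = 0 by rewrite -XZ /Z qE; field; rewrite gt_eqF.
  by move/eqP; rewrite mulf_eq0 invr_eq0 gt_eqF//= subr_eq0 => /eqP ->.
have hX : expR Z * (1 + (X - Z)) < expR X.
  have := expR_gt1Dx XY; rewrite -(@ltr_pM2l _ (expR Z)) ?expR_gt0//.
  by rewrite -expRD subrKC.
have hY : expR Z * (1 + (Y - Z)) <= expR Y.
  have := expR_ge1Dx (Y - Z); rewrite -(@ler_pM2l _ (expR Z)) ?expR_gt0//.
  by rewrite -expRD subrKC.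
have : expR Z < expR X / p + expR Y / q.
  have -> : expR Z = expR Z * (1 + (X - Z)) / p + expR Z * (1 + (Y - Z)) / q.
    rewrite [RHS](_ : _ = expR Z * ((p^-1 + q^-1) * (1 - Z) + (X / p + Y / q))).
      by rewrite pq mul1r -/Z subrK mulr1.
    by clearbody Z; field; rewrite !gt_eqF.
  by rewrite ltr_leD// ?ltr_pM2r ?invr_gt0// ler_pM2r ?invr_gt0.
by rewrite -abE ltNge h.
Qed.

(** The tangent line of t^p at s lies below the curve. This is Young's inequality
for t and s^(p-1), and so needs no derivative at 0. *)
Lemma powR_tangent s t p : 0 <= s -> 0 <= t -> 1 < p ->
  p * s `^ (p - 1) * t <= t `^ p + (p - 1) * s `^ p.
Proof.
move=> s0 t0 p1; have p0 : 0 < p by apply: lt_trans p1.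
have q0 : 0 < p / (p - 1) by rewrite divr_gt0// subr_gt0.
have pq : p^-1 + (p / (p - 1))^-1 = 1.
  by rewrite invf_div; field; rewrite gt_eqF.
have := conjugate_powR t0 (powR_ge0 s (p - 1)) p0 q0 pq.
rewrite -powRrM mulrCA divff ?gt_eqF ?subr_gt0// mulr1.
rewrite -(ler_pM2l p0) => /le_trans; rewrite -mulrA (mulrC _ t); apply.
rewrite le_eqVlt; apply/orP; left; apply/eqP; field.
by rewrite !gt_eqF// subr_gt0.
Qed.

Lemma powR_superadd a b s : 0 <= a -> 0 <= b -> 1 <= s ->
  a `^ s + b `^ s <= (a + b) `^ s.
Proof.
move=> a0 b0 s1.
have sp : 0 < s by apply: lt_le_trans s1.
have [->|an0] := eqVneq a 0; first by rewrite powR0 ?gt_eqF// !add0r.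
have ab : 0 < a + b by rewrite ltr_pwDl// lt_neqAle eq_sym an0.
(* The ratio c / (a + b) is in [0, 1], where it dominates its s-th power. *)
have h c : 0 <= c -> c <= a + b -> c `^ s <= c / (a + b) * (a + b) `^ s.
  move=> c0 cab.
  have [->|cn0] := eqVneq c 0; first by rewrite powR0 ?gt_eqF// !mul0r.
  have cE : c = c / (a + b) * (a + b) by rewrite divfK ?gt_eqF.
  rewrite [in leLHS]cE; apply: ge1r_powRZ => //; last exact: ltW.
  apply/andP; split; last by rewrite ler_pdivrMr ?mul1r.
  by rewrite divr_gt0// lt_neqAle eq_sym cn0.
have := lerD (h a a0 _) (h b b0 _); rewrite -!mulrDl divff ?gt_eqF// mul1r.
by apply; rewrite ?lerDl ?lerDr.
Qed.

(** Midpoint convexity: add the tangent inequalities at (a + b) / 2 towards a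
and towards b. *)
Lemma powR_midpoint a b s : 0 <= a -> 0 <= b -> 1 <= s ->
  ((a + b) / 2) `^ s <= (a `^ s + b `^ s) / 2.
Proof.
move=> a0 b0 s1.
have [->|sn1] := eqVneq s 1; first by rewrite !powRr1 ?divr_ge0 ?addr_ge0.
have {}s1 : 1 < s by rewrite lt_neqAle eq_sym sn1.
set m := (a + b) / 2.
have m0 : 0 <= m by rewrite divr_ge0 ?addr_ge0.
have := lerD (powR_tangent m0 a0 s1) (powR_tangent m0 b0 s1).
have -> : s * m `^ (s - 1) * a + s * m `^ (s - 1) * b = 2 * s * m `^ s.
  rewrite -mulrDr -(@mulr_powRB1 _ m s)// ?(lt_trans _ s1)//.
  rewrite (_ : a + b = 2 * m); last by rewrite /m mulrC divfK.
  by ring.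
move=> h; rewrite ler_pdivlMr//; lra.
Qed.

Lemma powRD_le a b s : 0 <= a -> 0 <= b -> 0 <= s ->
  (a + b) `^ s <= 2 `^ s * (a `^ s + b `^ s).
Proof.
move=> a0 b0 s0.
wlog ab : a b a0 b0 / a <= b.
  move=> H; have [ab|/ltW ba] := leP a b; first exact: H.
  by rewrite addrC [X in _ * X]addrC; apply: H.
apply: (@le_trans _ _ ((2 * b) `^ s)).
  apply: ge0_ler_powR => //; rewrite ?nnegrE ?addr_ge0 ?mulr_ge0//.
  by rewrite mulr_natl mulr2n lerD2r.
by rewrite powRM// ler_wpM2l ?powR_ge0// lerDr powR_ge0.
Qed.

End real_inequalities.

Section euclidean.
Context (R : realType) (d : nat).
Implicit Types x y z : 'rV[R]_d.

Lemma dotrVC x y : dotrV x y = dotrV y x.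
Proof. by apply: eq_bigr => i _; rewrite mulrC. Qed.

Lemma dotrVDl x y z : dotrV (x + y) z = dotrV x z + dotrV y z.
Proof. by rewrite -big_split; apply: eq_bigr => i _; rewrite mxE mulrDl. Qed.

Lemma dotrVDr x y z : dotrV z (x + y) = dotrV z x + dotrV z y.
Proof. by rewrite dotrVC dotrVDl !(dotrVC z). Qed.

Lemma dotrVZl (k : R) x y : dotrV (k *: x) y = k * dotrV x y.
Proof. by rewrite mulr_sumr; apply: eq_bigr => i _; rewrite mxE mulrA. Qed.

Lemma dotrVZr (k : R) x y : dotrV y (k *: x) = k * dotrV y x.
Proof. by rewrite dotrVC dotrVZl dotrVC. Qed.

Lemma dotrVNl x y : dotrV (- x) y = - dotrV x y.
Proof. by rewrite -scaleN1r dotrVZl mulN1r. Qed.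

Lemma dotrVNr x y : dotrV y (- x) = - dotrV y x.
Proof. by rewrite dotrVC dotrVNl dotrVC. Qed.

Lemma dotrV_ge0 x : 0 <= dotrV x x.
Proof. by apply: sumr_ge0 => i _; rewrite -expr2 sqr_ge0. Qed.

Lemma enorm_ge0 x : 0 <= enorm x.
Proof. exact: sqrtr_ge0. Qed.

Lemma enorm_sqr x : enorm x ^+ 2 = dotrV x x.
Proof. by rewrite sqr_sqrtr// dotrV_ge0. Qed.

Lemma enormZ (k : R) x : enorm (k *: x) = `|k| * enorm x.
Proof.
by rewrite /enorm dotrVZl dotrVZr mulrA -expr2 sqrtrM ?sqr_ge0// sqrtr_sqr.
Qed.

Lemma enormN x : enorm (- x) = enorm x.
Proof. by rewrite /enorm dotrVNl dotrVNr opprK. Qed.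

Lemma coord_le_enorm x i : `|x ord0 i| <= enorm x.
Proof.
rewrite -(@ler_pXn2r _ 2)// ?nnegrE ?enorm_ge0// enorm_sqr real_normK ?num_real//.
rewrite /dotrV (bigD1 i)//= -expr2 lerDl.
by apply: sumr_ge0 => j _; rewrite -expr2 sqr_ge0.
Qed.

Lemma enorm_le_sum x : enorm x <= \sum_i `|x ord0 i|.
Proof.
rewrite -(@ler_pXn2r _ 2)// ?nnegrE ?enorm_ge0 ?sumr_ge0// enorm_sqr.
rewrite expr2 mulr_suml; apply: ler_sum => i _.
rewrite -[leLHS]ger0_norm -?expr2 ?sqr_ge0// expr2 normrM ler_wpM2l//.
by rewrite (bigD1 i)//= lerDl sumr_ge0.
Qed.

Lemma dotrV_le_enorm x y : `|dotrV x y| <= enorm x * enorm y.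
Proof.
rewrite -(@ler_pXn2r _ 2)// ?nnegrE ?mulr_ge0 ?enorm_ge0//.
rewrite exprMn !enorm_sqr real_normK ?num_real//.
have [y0|yn0] := eqVneq (dotrV y y) 0.
  have {}y0 : enorm y = 0 by rewrite /enorm y0 sqrtr0.
  rewrite /dotrV big1 ?expr0n/= ?mulr_ge0 ?dotrV_ge0// => i _.
  have := coord_le_enorm y i; rewrite y0 normr_le0 => /eqP ->.
  by rewrite mulr0.
have yy : 0 < dotrV y y by rewrite lt_neqAle eq_sym yn0 dotrV_ge0.
(* This vector is y.y times the component of x orthogonal to y. *)
have := dotrV_ge0 (dotrV y y *: x - dotrV x y *: y).
rewrite dotrVDl !dotrVDr !dotrVNl !dotrVNr !dotrVZl !dotrVZr (dotrVC y x).
move=> h; rewrite -subr_ge0 -(pmulr_rge0 _ yy).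
by apply: le_trans h _; rewrite le_eqVlt; apply/orP; left; apply/eqP; ring.
Qed.

Lemma enormD x y : enorm (x + y) <= enorm x + enorm y.
Proof.
rewrite -(@ler_pXn2r _ 2)// ?nnegrE ?addr_ge0 ?enorm_ge0//.
rewrite sqrrD !enorm_sqr dotrVDl !dotrVDr (dotrVC y x).
have := dotrV_le_enorm x y; have := ler_norm (dotrV x y); lra.
Qed.

(** Convexity of |.|^p in gradient form: |x|^(p-2) x is the gradient of |x|^p / p.
It serves both for the lower semicontinuity of the functional and for its
Euler-Lagrange equation. *)
Lemma enorm_tangent x y (p : R) : 1 < p ->
  p * (enorm x `^ (p - 2) * dotrV x y) <=
  enorm y `^ p + (p - 1) * enorm x `^ p.
Proof.
move=> p1; apply: le_trans (powR_tangent (enorm_ge0 x) (enorm_ge0 y) p1).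
rewrite -mulrA ler_pM2l ?(lt_trans _ p1)//.
have [x0|xn0] := eqVneq (enorm x) 0.
  rewrite x0; have : dotrV x y <= 0.
    apply: le_trans (ler_norm _) _.
    by apply: le_trans (dotrV_le_enorm _ _) _; rewrite x0 mul0r.
  move=> h; apply: (@le_trans _ _ 0).
    by rewrite mulr_ge0_le0// powR_ge0.
  by rewrite mulr_ge0 ?powR_ge0 ?enorm_ge0.
have -> : enorm x `^ (p - 1) = enorm x `^ (p - 2) * enorm x.
  rewrite (_ : p - 1 = (p - 2) + 1); last by ring.
  by rewrite powRD ?xn0 ?implybT// powRr1 ?enorm_ge0.
rewrite -mulrA ler_wpM2l ?powR_ge0//.
exact: le_trans (ler_norm _) (dotrV_le_enorm _ _).
Qed.

(** Clarkson's inequality. The s-th powers with s = p / 2 >= 1 are superadditive, so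
the left side is at most the s-th power of |(x+y)/2|^2 + |(x-y)/2|^2, which is
the mean of |x|^2 and |y|^2 by the parallelogram law; convexity ends the proof. *)
Lemma enorm_clarkson x y (p : R) : 2 <= p ->
  enorm (2^-1 *: (x + y)) `^ p + enorm (2^-1 *: (x - y)) `^ p <=
  (enorm x `^ p + enorm y `^ p) / 2.
Proof.
move=> p2.
have sp : 1 <= p / 2 by rewrite ler_pdivlMr// mul1r.
have e z : enorm z `^ p = dotrV z z `^ (p / 2).
  by rewrite -enorm_sqr -powR_mulrn ?enorm_ge0// -powRrM mulrC divfK.
rewrite !e; apply: le_trans (powR_superadd (dotrV_ge0 _) (dotrV_ge0 _) sp) _.
apply: le_trans (powR_midpoint (dotrV_ge0 _) (dotrV_ge0 _) sp).
rewrite le_eqVlt; apply/orP; left; apply/eqP; congr (_ `^ _).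
rewrite !dotrVZl !dotrVZr !dotrVDl !dotrVDr !dotrVNl !dotrVNr.
by field.
Qed.

End euclidean.

(** * Integrals of p-th powers *)

Section Lp_functions.
Context d (T : measurableType d) (R : realType).
Variables (mu : {measure set T -> \bar R}) (D : set T).
Hypothesis mD : measurable D.
Implicit Types (f g : T -> R) (p q : R).

(** The integrals below are real-valued, so integrability is carried along
explicitly; this form of membership in L^p(D) is the usual way to obtain it. *)
Definition pint p f := measurable_fun D f /\
  mu.-integrable D (EFin \o (fun x => `|f x| `^ p)).

Lemma measurable_abs_powR p f : measurable_fun D f ->
  measurable_fun D (fun x => `|f x| `^ p).
Proof.
move=> mf; apply: (measurableT_comp (measurable_powR p)).
exact: measurableT_comp.
Qed.

Lemma integrable_le f g : measurable_fun D f ->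
  mu.-integrable D (EFin \o g) -> (forall x, D x -> `|f x| <= g x) ->
  mu.-integrable D (EFin \o f).
Proof.
move=> mf ig fg; apply: (le_integrable mD) ig; first exact/measurable_EFinP.
by move=> x Dx /=; rewrite lee_fin (le_trans (fg x Dx))// ler_norm.
Qed.

Lemma RintegrableD f g : mu.-integrable D (EFin \o f) ->
  mu.-integrable D (EFin \o g) -> mu.-integrable D (EFin \o (fun x => f x + g x)).
Proof. by move=> i1 i2; have := integrableD mD i1 i2. Qed.

Lemma RintegrableZl (k : R) f : mu.-integrable D (EFin \o f) ->
  mu.-integrable D (EFin \o (fun x => k * f x)).
Proof. by move=> i1; have := integrableZl mD k i1. Qed.

Lemma RintegrableB f g : mu.-integrable D (EFin \o f) ->
  mu.-integrable D (EFin \o g) -> mu.-integrable D (EFin \o (fun x => f x - g x)).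
Proof. by move=> i1 i2; have := integrableB mD i1 i2. Qed.

Lemma integrable_measurable f : mu.-integrable D (EFin \o f) ->
  measurable_fun D f.
Proof. by move=> /integrableP[/measurable_EFinP]. Qed.

Lemma EFin_Rintegral f : mu.-integrable D (EFin \o f) ->
  (\int[mu]_(x in D) f x)%:E = (\int[mu]_(x in D) (f x)%:E)%E.
Proof. by move=> i; rewrite /Rintegral fineK//; exact: integrable_fin_num. Qed.

Lemma Rintegral_sum n (f : 'I_n -> T -> R) :
  (forall i, mu.-integrable D (EFin \o f i)) ->
  \int[mu]_(x in D) (\sum_i f i x) = \sum_i \int[mu]_(x in D) f i x.
Proof.
elim: n f => [f _|n IH f i].
  under eq_Rintegral do rewrite big_ord0.
  by rewrite Rintegral_cst// mul0r big_ord0.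
under eq_Rintegral do rewrite big_ord_recr.
rewrite RintegralD//; first by rewrite big_ord_recr/= IH.
have h := @integrable_sum _ _ _ mu D mD _ (index_enum 'I_n) xpredT
  (fun k => EFin \o f (widen_ord (leqnSn n) k)) (fun k _ => i _).
by apply: eq_integrable h => //= x _; rewrite sumEFin.
Qed.

Lemma pint_le p f g : 0 <= p -> measurable_fun D f -> pint p g ->
  (forall x, D x -> `|f x| <= `|g x|) -> pint p f.
Proof.
move=> p0 mf [mg ig] fg; split => //.
apply: integrable_le ig _; first exact: measurable_abs_powR.
by move=> x Dx; rewrite ger0_norm ?powR_ge0// ge0_ler_powR ?nnegrE// fg.
Qed.

Lemma pint_abs p f : pint p f -> pint p (fun x => `|f x|).
Proof.
move=> [mf i]; split; first exact: measurableT_comp.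
by apply: eq_integrable i => //= x _; rewrite normr_id.
Qed.

Lemma pintD p f g : 0 <= p -> pint p f -> pint p g ->
  pint p (fun x => f x + g x).
Proof.
move=> p0 [mf i] [mg j]; have m := measurable_funD mf mg; split => //.
apply: integrable_le (RintegrableZl (2 `^ p) (RintegrableD i j)) _.
  exact: measurable_abs_powR.
move=> x Dx; rewrite ger0_norm ?powR_ge0//.
by apply: le_trans (powRD_le _ _ p0) => //; apply: ge0_ler_powR;
  rewrite ?nnegrE ?addr_ge0// ler_normD.
Qed.

Lemma pintZ p (k : R) f : pint p f -> pint p (fun x => k * f x).
Proof.
move=> [mf i]; split; first exact: measurable_funM.
apply: eq_integrable (RintegrableZl (`|k| `^ p) i) => //= x _.
by rewrite normrM powRM.
Qed.

Lemma pintB p f g : 0 <= p -> pint p f -> pint p g ->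
  pint p (fun x => f x - g x).
Proof.
move=> p0 i j; have := pintD p0 i (pintZ (-1) j).
by under eq_fun do rewrite mulN1r.
Qed.

Lemma pint_sum p n (f : 'I_n -> T -> R) : 0 < p ->
  (forall i, pint p (f i)) -> pint p (fun x => \sum_i f i x).
Proof.
move=> p0; elim: n f => [f _|n IH f h].
  under eq_fun do rewrite big_ord0.
  split => //; apply: eq_integrable (integrable0 _ _) => //= x _.
  by rewrite normr0 powR0 ?gt_eqF.
by under eq_fun do rewrite big_ord_recr; apply: pintD => //; [exact: ltW|exact: IH].
Qed.

Lemma integrable_conj_mul p q f g : 0 < p -> 0 < q -> p^-1 + q^-1 = 1 ->
  pint p f -> pint q g -> mu.-integrable D (EFin \o (fun x => f x * g x)).
Proof.
move=> p0 q0 pq [mf i] [mg j].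
apply: integrable_le (RintegrableD (RintegrableZl p^-1 i) (RintegrableZl q^-1 j)) _.
  exact: measurable_funM.
move=> x Dx; rewrite normrM (mulrC p^-1) (mulrC q^-1).
exact: conjugate_powR.
Qed.

Lemma finite_integrable_cst (k : R) : (mu D < +oo)%E ->
  mu.-integrable D (EFin \o (fun=> k)).
Proof.
move=> fD; apply: measurable_bounded_integrable => //.
exists `|k|; split; first exact: num_real.
by move=> M kM x _ /=; apply: ltW.
Qed.

Lemma pint_bounded p (M : R) f : (mu D < +oo)%E -> 0 <= p ->
  measurable_fun D f -> (forall x, D x -> `|f x| <= M) -> pint p f.
Proof.
move=> fD p0 mf fM; split => //.
apply: integrable_le (finite_integrable_cst (M `^ p) fD) _.
  exact: measurable_abs_powR.
move=> x Dx; rewrite ger0_norm ?powR_ge0// ge0_ler_powR ?nnegrE ?fM//.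
exact: le_trans (fM x Dx).
Qed.

Lemma pint_sub p q f : (mu D < +oo)%E -> 0 <= q -> q <= p ->
  pint p f -> pint q f.
Proof.
move=> fD q0 qp [mf i]; split => //.
apply: integrable_le (RintegrableD (finite_integrable_cst 1 fD) i) _.
  exact: measurable_abs_powR.
move=> x Dx; rewrite ger0_norm ?powR_ge0//.
have [f1|/ltW f1] := leP `|f x| 1.
  apply: (@le_trans _ _ 1); last by rewrite lerDl powR_ge0.
  by have := @ge0_ler_powR _ q q0 `|f x| 1; rewrite !nnegrE powR1; apply.
by apply: le_trans (ler_powR f1 qp) _; rewrite lerDr.
Qed.

Lemma pint_integrable p f : (mu D < +oo)%E -> 1 <= p -> pint p f ->
  mu.-integrable D (EFin \o f).
Proof.
move=> fD p1 h; have [mf i] := pint_sub fD ler01 p1 h.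
by apply: integrable_le i _ => // x Dx; rewrite powRr1.
Qed.

(** The p-th power of the L^p norm, which is additive in the integrand; only a few
estimates need the root. *)
Definition pnormX p f := \int[mu]_(x in D) `|f x| `^ p.

Lemma pnormX_ge0 p f : 0 <= pnormX p f.
Proof. by apply: Rintegral_ge0 => x Dx; exact: powR_ge0. Qed.

Lemma Lnorm_pnormX p f : 0 < p -> pint p f ->
  ('N[mu]_p%:E[EFin \o (f \_ D)] = (pnormX p f `^ p^-1)%:E)%E.
Proof.
move=> p0 [mf i]; rewrite unlock.
have -> : (\int[mu]_x (`|(EFin \o (f \_ D)) x| `^ p) = (pnormX p f)%:E)%E.
  rewrite /pnormX (EFin_Rintegral i) [RHS]integral_mkcond.
  apply: eq_integral => x _; rewrite /= !patchE; case: ifPn => // _.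
  by rewrite normr0 powR0 ?gt_eqF.
by [].
Qed.

(** Transfer of Hoelder's inequality for extended real-valued functions on the whole
space: f and g are extended by 0 outside D. *)
Lemma hoelder_Rintegral p q f g : 0 < p -> 0 < q -> p^-1 + q^-1 = 1 ->
  pint p f -> pint q g ->
  `|\int[mu]_(x in D) (f x * g x)| <= pnormX p f `^ p^-1 * pnormX q g `^ q^-1.
Proof.
move=> p0 q0 pq fp gq.
have ifg := integrable_conj_mul p0 q0 pq fp gq.
have mf := (measurable_restrictT f mD).1 fp.1.
have mg := (measurable_restrictT g mD).1 gq.1.
have h := hoelder mu mf mg p0 q0 pq.
have ef := Lnorm_pnormX p0 fp.
have eg := Lnorm_pnormX q0 gq.
rewrite ef eg Lnorm1 in h.
rewrite -lee_fin (EFin_normr_Rintegral mD ifg).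
apply: le_trans (le_abse_integral _ mD (measurable_int _ ifg)) _.
apply: le_trans h.
rewrite le_eqVlt; apply/orP; left; apply/eqP.
rewrite integral_mkcond; apply: eq_integral => x _; rewrite /= !patchE.
by case: ifPn => //= _; rewrite mulr0 normr0.
Qed.

(** Jensen's inequality for t^p, obtained from Hoelder's inequality against the
constant 1. *)
Lemma Rintegral_powR_le p f : (mu D < +oo)%E -> 1 < p -> pint p f ->
  `|\int[mu]_(x in D) f x| `^ p <= fine (mu D) `^ (p - 1) * pnormX p f.
Proof.
move=> fD p1 fp.
have p0 : 0 < p by apply: lt_trans p1.
have q0 : 0 < p / (p - 1) by rewrite divr_gt0// subr_gt0.
have pq : p^-1 + (p / (p - 1))^-1 = 1.
  by rewrite invf_div; field; rewrite gt_eqF.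
have g1 : pint (p / (p - 1)) (fun=> 1).
  by apply: (@pint_bounded _ 1) => //; [exact: ltW|move=> x _; rewrite normr1].
have := hoelder_Rintegral p0 q0 pq fp g1.
have -> : pnormX (p / (p - 1)) (fun=> 1) = fine (mu D).
  rewrite /pnormX; under eq_Rintegral do rewrite normr1 powR1.
  by rewrite Rintegral_cst// mul1r.
under eq_Rintegral do rewrite mulr1.
have m0 : 0 <= fine (mu D) by rewrite fine_ge0.
move: (pnormX_ge0 p f) m0; move: (pnormX p f) (fine (mu D)) => A M A0 M0.
move: (\int[mu]_(x in D) f x) => I.
move=> /(ge0_ler_powR (ltW p0)); rewrite !nnegrE => /(_ _ _)/le_trans.
apply => //; first by rewrite mulr_ge0 ?powR_ge0.
rewrite powRM ?powR_ge0// -!powRrM mulVf ?gt_eqF// powRr1//.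
rewrite mulrC ler_wpM2r// invf_div.
by rewrite divfK ?gt_eqF.
Qed.

End Lp_functions.

(** * Completeness of L^p *)

(** The limit 0 has to be treated apart, since powR is differentiable only at
positive points. *)
Lemma cvg_powR (R : realType) (u : nat -> R) (l s : R) : 0 < s ->
  (forall n, 0 <= u n) -> u n @[n --> \oo] --> l ->
  u n `^ s @[n --> \oo] --> l `^ s.
Proof.
move=> s0 u0 cu.
have l0 : 0 <= l by apply: (cvgr_to_ge cu); near=> n; exact: u0.
have [le0|ln0] := eqVneq l 0.
  rewrite le0 powR0 ?gt_eqF//; rewrite le0 in cu.
  apply/cvgrPdist_le => r r0.
  have rp : 0 < r `^ s^-1 by rewrite powR_gt0.
  move/cvgrPdist_le : cu => /(_ _ rp); apply: filterS => k.
  rewrite !sub0r !normrN (ger0_norm (u0 k)) (ger0_norm (powR_ge0 _ _)) => hk.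
  have := ge0_ler_powR (ltW s0) _ _ hk; rewrite !nnegrE.
  rewrite u0 (ltW rp) => /(_ isT isT) /le_trans; apply.
  by rewrite -powRrM mulVf ?gt_eqF// powRr1// ltW.
have lp : 0 < l by rewrite lt_neqAle eq_sym ln0.
apply: (@cvg_comp _ _ _ _ (@powR R ^~ s) _ _ _ cu).
have /derivable1_diffP/differentiable_continuous h :
    derivable (@powR R ^~ s) l 1.
  by apply: derivable_powR; rewrite in_itv/= lp.
exact: h.
Unshelve. all: by end_near. Qed.

Section Lp_complete.
Context d (T : measurableType d) (R : realType).
Variables (mu : {measure set T -> \bar R}) (D : set T).
Hypothesis mD : measurable D.
Implicit Types (g : T -> R) (p q : R).

(** Strong L^p convergence implies convergence of the pairings with L^q. Weak
gradients and linear functionals pass to the limit through this lemma. *)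
Lemma pnormX_conj_cvg p q (f : nat -> T -> R) g h : 0 < p -> 0 < q ->
  p^-1 + q^-1 = 1 -> (forall n, pint mu D p (f n)) -> pint mu D p g ->
  pint mu D q h -> pnormX mu D p (fun x => f n x - g x) @[n --> \oo] --> 0 ->
  \int[mu]_(x in D) (f n x * h x) @[n --> \oo] --> \int[mu]_(x in D) (g x * h x).
Proof.
move=> p0 q0 pq fp gp hq cv.
apply/cvgrPdist_le => e e0.
set C := pnormX mu D q h `^ q^-1.
have C0 : 0 <= C by exact: powR_ge0.
have C1 : 0 < C + 1 by rewrite ltr_wpDl.
have ep : 0 < (e / (C + 1)) `^ p by rewrite powR_gt0// divr_gt0.
move/cvgrPdist_le : cv => /(_ _ ep); apply: filterS => n.
rewrite sub0r normrN ger0_norm ?pnormX_ge0// => hn.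
rewrite distrC -RintegralB//; try exact: (integrable_conj_mul mD p0 q0 pq).
under eq_Rintegral do rewrite -mulrBl.
have fgp := pintB mD (ltW p0) (fp n) gp.
apply: le_trans (hoelder_Rintegral mD p0 q0 pq fgp hq) _; rewrite -/C.
have := ge0_ler_powR (_ : 0 <= p^-1) _ _ hn; rewrite !nnegrE.
rewrite pnormX_ge0 invr_ge0 (ltW p0) (ltW ep) => /(_ isT isT isT).
rewrite -powRrM mulfV ?gt_eqF// powRr1 ?divr_ge0 ?(ltW e0) ?(ltW C1)// => h1.
apply: le_trans (ler_wpM2r C0 h1) _.
rewrite mulrAC ler_pdivrMr// ler_pM2l// lerDl//.
Qed.

Let c (k : nat) : R := 2^-1 ^+ k.

Let c_gt0 k : 0 < c k.
Proof. by rewrite exprn_gt0// invr_gt0. Qed.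

(** If the jumps have p-th power integrals at most c_k c_k^p with c_k = 2^-k, then
S = sum_k c_k^-p |f_(k+1) - f_k|^p is integrable. Where S is finite, each jump is
at most S^(1/p) c_k, and the series of jumps converges. *)
Lemma fast_cauchy_ae_cvg p (f : nat -> T -> R) : 0 < p ->
  (forall n, pint mu D p (f n)) ->
  (forall k, pnormX mu D p (fun x => f k.+1 x - f k x) <= c k * c k `^ p) ->
  exists A, [/\ measurable A, A `<=` D, {ae mu, forall x, D x -> A x} &
    forall x, A x -> cvgn (fun k => f k x)].
Proof.
move=> p0 fp fast.
pose w k x := `|f k.+1 x - f k x| `^ p.
have wp k : pint mu D p (fun x => f k.+1 x - f k x).
  by apply: (pintB mD (ltW p0)).
have mw k : measurable_fun D (fun x => ((c k `^ p)^-1 * w k x)%:E).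
  by apply/measurable_EFinP/measurable_funM => //; exact: measurable_abs_powR (wp k).1.
have w0 k x : D x -> (0 <= ((c k `^ p)^-1 * w k x)%:E)%E.
  by move=> _; rewrite lee_fin mulr_ge0 ?invr_ge0 ?powR_ge0.
pose S x := (\sum_(k <oo) ((c k `^ p)^-1 * w k x)%:E)%E.
have mS : measurable_fun D S.
  by apply: ge0_emeasurable_sum => // k x Dx _; exact: w0.
have S0 x : D x -> (0 <= S x)%E by move=> Dx; apply: nneseries_ge0 => k _ _; exact: w0.
have iS : mu.-integrable D S.
  apply/integrableP; split => //.
  under eq_integral => x /[!inE] Dx do rewrite gee0_abs ?S0//.
  rewrite integral_nneseries//.
  apply: (@le_lt_trans _ _ (\sum_(k <oo) (c k)%:E)%E).
    apply: lee_nneseries => [k _ _|k _]; first by apply: integral_ge0 => x Dx; exact: w0.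
    have ik := RintegrableZl mD (c k `^ p)^-1 (wp k).2.
    rewrite -(EFin_Rintegral mD ik) lee_fin RintegralZl//; last exact: (wp k).2.
    by rewrite ler_pdivrMl ?powR_gt0// mulrC; exact: fast.
  have cs : cvgn (series c).
    rewrite (_ : c = geometric 1 (2^-1)); last first.
      by apply/funext => k; rewrite /c /= mul1r.
    by apply: is_cvg_geometric_series; rewrite ger0_norm// invf_lt1// ltr1n.
  have e : (fun n => (\sum_(0 <= k < n) (c k)%:E)%E) = EFin \o series c.
    by apply/funext => n; rewrite /= /series/= sumEFin.
  by rewrite e EFin_lim// ltry.
exists (D `&` [set x | S x < +oo]%E); split.
- exact: emeasurable_fun_infty_o.
- by move=> x [].
- have := integrable_ae mD iS; apply: filterS => x h Dx; split => //=.
  by have := h Dx; rewrite ge0_fin_numE ?S0.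
- move=> x [Dx Sx]; have Sfin : S x \is a fin_num by rewrite ge0_fin_numE ?S0.
  pose M := fine (S x).
  have M0 : 0 <= M by rewrite fine_ge0 ?S0.
  have wM k : `|f k.+1 x - f k x| <= M `^ p^-1 * c k.
    have hk : (c k `^ p)^-1 * w k x <= M.
      rewrite -lee_fin /M fineK//.
      have h := nneseries_lim_ge k.+1 (fun n (_ : (0 <= n)%N) (_ : true) => w0 n x Dx).
      apply: le_trans h; rewrite big_nat_recr//= leeDr//.
      by apply: sume_ge0 => i _; exact: w0.
    rewrite ler_pdivrMl ?powR_gt0// in hk.
    have := ge0_ler_powR (_ : 0 <= p^-1) _ _ hk; rewrite !nnegrE.
    rewrite powR_ge0 invr_ge0 (ltW p0) mulr_ge0 ?powR_ge0// => /(_ isT isT isT).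
    rewrite powRM ?powR_ge0// -!powRrM mulfV ?gt_eqF// !powRr1 ?(ltW (c_gt0 k))//.
    by rewrite mulrC.
  have : cvgn (series (telescope (fun k => f k x))).
    apply: normed_cvg; apply: (@series_le_cvg _ _ (geometric (M `^ p^-1) 2^-1)).
    + by move=> k; exact: normr_ge0.
    + by move=> k; rewrite /= mulr_ge0 ?powR_ge0// exprn_ge0// invr_ge0.
    + by move=> k; exact: wM.
    by apply: is_cvg_geometric_series; rewrite ger0_norm// invf_lt1// ltr1n.
  rewrite telescopeK => h.
  have -> : (fun k => f k x) = (fun k => (f k x - f 0%N x) + f 0%N x).
    by apply/funext => k; rewrite subrK.
  by apply: is_cvgD => //; exact: is_cvg_cst.
Qed.

Lemma limn_einf_le (u : (\bar R)^nat) (l : \bar R) N :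
  (forall n, (N <= n)%N -> (u n <= l)%E) -> (limn_einf u <= l)%E.
Proof.
move=> h; rewrite limn_einf_lim; apply: lime_le; first exact: is_cvg_einfs.
near=> n; apply: (@le_trans _ _ (u n)).
  by apply: ereal_inf_lbound => /=; exists n => //=.
by apply: h; near: n; exact: nbhs_infty_ge.
Unshelve. all: by end_near. Qed.

(** A fast subsequence converges almost everywhere; Fatou's lemma along it bounds
the distance from f_n to the limit by the Cauchy bound. *)
Lemma Lp_complete p (f : nat -> T -> R) : 0 < p ->
  (forall n, pint mu D p (f n)) ->
  (forall e, 0 < e -> exists N, forall m n, (N <= m)%N -> (N <= n)%N ->
     pnormX mu D p (fun x => f m x - f n x) <= e) ->
  exists g, pint mu D p g /\
    pnormX mu D p (fun x => f n x - g x) @[n --> \oo] --> 0.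
Proof.
move=> p0 fp cauchy.
have cc k : 0 < c k * c k `^ p by rewrite mulr_gt0 ?powR_gt0.
have [N NP] := choice (fun k => cauchy _ (cc k)).
(* The sum makes the indices nondecreasing and at least N k; the term k makes them
   tend to infinity. *)
pose s k := (k + \sum_(j < k.+1) N j)%N.
have Ns k : (N k <= s k)%N.
  by rewrite /s big_ord_recr/= addnA leq_addl.
have sS k : (s k <= s k.+1)%N.
  by rewrite /s [X in (_ <= _ + X)%N]big_ord_recr/= leq_add// leq_addr.
have sk k : (k <= s k)%N by exact: leq_addr.
have [||A [mA AD aeA cvA]] := @fast_cauchy_ae_cvg p (fun k => f (s k)) p0.
  by move=> n; exact: fp.
  by move=> k; apply: NP => //; exact: leq_trans (Ns k) (sS k).
(* Set to 0 off A, the subsequence converges everywhere, and its limit is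
   measurable. *)
pose v k := (f (s k)) \_ A.
pose g x := limn (fun k => v k x).
have vcv x : v k x @[k --> \oo] --> g x.
  rewrite /g; have [Ax|Ax] := boolP (x \in A).
    rewrite (_ : (fun k => v k x) = (fun k => f (s k) x)).
      by apply: cvA; exact: set_mem.
    by apply/funext => k; rewrite /v patchE Ax.
  rewrite (_ : (fun k => v k x) = cst 0); first exact: is_cvg_cst.
  by apply/funext => k; rewrite /v patchE (negbTE Ax).
have mv k : measurable_fun D (v k).
  apply/(measurable_restrict _ mA mD).
  by apply: measurable_funS (fp (s k)).1 => // x [].
have mg : measurable_fun D g.
  by apply: (@measurable_fun_cvg _ _ _ D v) => // x _; exact: vcv.
(* Integrability of the limit is not known yet, so the bound is stated for extended
   real integrals. *)
have bnd e : 0 < e -> exists M, forall n, (M <= n)%N ->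
    (\int[mu]_(x in D) (`|f n x - g x| `^ p)%:E <= e%:E)%E.
  move=> e0; have [M MP] := cauchy _ e0; exists M => n Mn.
  have mfv k : measurable_fun D (fun x => `|f n x - v k x| `^ p).
    by apply: measurable_abs_powR => //; apply: measurable_funB => //; exact: (fp n).1.
  have -> : (\int[mu]_(x in D) (`|f n x - g x| `^ p)%:E =
      \int[mu]_(x in D) limn_einf (fun k => (`|f n x - v k x| `^ p)%:E))%E.
    apply: eq_integral => x _; apply/esym.
    have cv : ((`|f n x - v k x| `^ p)%:E @[k --> \oo] --> (`|f n x - g x| `^ p)%:E)%E.
      apply: cvg_EFin; first by near=> k.
      have cn : `|f n x - v k x| @[k --> \oo] --> `|f n x - g x|.
        by apply: cvg_norm; apply: cvgB; [exact: cvg_cst|exact: vcv].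
      by apply: (cvg_powR p0 _ cn) => k; exact: normr_ge0.
    by rewrite is_cvg_limn_einfE; [exact/cvg_lim|apply/cvg_ex; eexists; exact: cv].
  apply: le_trans (fatou mu mD _ _) _.
  - by move=> k; exact/measurable_EFinP.
  - by move=> k x _; rewrite lee_fin powR_ge0.
  apply: (@limn_einf_le _ _ M) => k Mk.
  have -> : (\int[mu]_(x in D) (`|f n x - v k x| `^ p)%:E =
      \int[mu]_(x in D) (`|f n x - f (s k) x| `^ p)%:E)%E.
    apply: ae_eq_integral => //; first exact/measurable_EFinP.
      by apply/measurable_EFinP/measurable_abs_powR => //;
        apply: measurable_funB => //; [exact: (fp n).1|exact: (fp (s k)).1].
    by apply: filterS aeA => x Ax Dx; rewrite /v patchE mem_set//; exact: Ax.
  rewrite -EFin_Rintegral//; last exact: (pintB mD (ltW p0) (fp n) (fp (s k))).2.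
  by rewrite lee_fin; apply: MP => //; exact: leq_trans Mk (sk k).
have ifg : exists n, pint mu D p (fun x => f n x - g x).
  have [M MP] := bnd 1 ltr01; exists M.
  have mfg : measurable_fun D (fun x => f M x - g x).
    by apply: measurable_funB => //; exact: (fp M).1.
  split => //; apply/integrableP; split.
    by apply/measurable_EFinP; exact: measurable_abs_powR.
  apply: (@le_lt_trans _ _ 1%:E); last by rewrite ltry.
  apply: le_trans (MP M (leqnn M)); rewrite le_eqVlt; apply/orP; left; apply/eqP.
  by apply: eq_integral => x _; rewrite /= ger0_norm ?powR_ge0.
have gp : pint mu D p g.
  have [n h] := ifg; have := pintB mD (ltW p0) (fp n) h.
  by under eq_fun do rewrite subKr.
exists g; split => //; apply/cvgrPdist_le => e e0.
have [M MP] := bnd e e0; exists M => // n /= /MP.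
rewrite sub0r normrN ger0_norm ?pnormX_ge0//.
by rewrite -EFin_Rintegral ?lee_fin//; exact: (pintB mD (ltW p0) (fp n) gp).2.
Unshelve. all: by end_near. Qed.

End Lp_complete.

(** * Boxes and the translation invariance of Lebesgue measure *)

Section boxes.
Context (R : realType) (d : nat).
Implicit Types (a b x y h : 'rV[R]_d) (U : set 'rV[R]_d).

(** Open boxes form a pi-system that generates the Borel sets and on which Lebesgue
measure is explicit; they carry all the uniqueness arguments below. Closed boxes
are compact, and contain the supports of the bump functions. *)
Definition obox a b : set 'rV[R]_d :=
  [set x | forall i, a ord0 i < x ord0 i < b ord0 i].

Definition cbox a b : set 'rV[R]_d :=
  [set x | forall i, a ord0 i <= x ord0 i <= b ord0 i].

Lemma obox_cbox a b : obox a b `<=` cbox a b.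
Proof. by move=> x h i; have /andP[/ltW -> /ltW ->] := h i. Qed.

Lemma measurable_rV_forall (A : 'I_d -> set R) : (forall i, measurable (A i)) ->
  measurable [set x : 'rV[R]_d | forall i, A i (x ord0 i)].
Proof.
move=> mA; rewrite (_ : mkset _ = \bigcap_(i in [set: 'I_d])
    ((fun v : 'rV[R]_d => v ord0 i) @^-1` A i)); last first.
  by apply/seteqP; split => v /= H i; [move=> _; exact: H|exact: (H i I)].
apply: fin_bigcap_measurable => [|i _]; first exact: finite_finset.
by rewrite -[X in measurable X]setTI; apply: measurable_coord => //; exact: mA.
Qed.

Lemma obox_itv a b :
  obox a b = [set x | forall i, `]a ord0 i, b ord0 i[%classic (x ord0 i)].
Proof. by apply/seteqP; split => x h i; have := h i; rewrite /= in_itv. Qed.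

Lemma cbox_itv a b :
  cbox a b = [set x | forall i, `[a ord0 i, b ord0 i]%classic (x ord0 i)].
Proof. by apply/seteqP; split => x h i; have := h i; rewrite /= in_itv. Qed.

Lemma measurable_obox a b : measurable (obox a b).
Proof.
rewrite obox_itv.
exact: (@measurable_rV_forall (fun i => `]a ord0 i, b ord0 i[%classic)).
Qed.

Lemma measurable_cbox a b : measurable (cbox a b).
Proof.
rewrite cbox_itv.
exact: (@measurable_rV_forall (fun i => `[a ord0 i, b ord0 i]%classic)).
Qed.

Lemma lebesgue_obox a b : lebesgue_rV (obox a b) =
  (\prod_(i < d) lebesgue_measure (`]a ord0 i, b ord0 i[%classic : set R))%E.
Proof.
rewrite obox_itv.
exact: (@lebesgue_rV_box _ _ (fun i => `]a ord0 i, b ord0 i[%classic)).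
Qed.

Lemma lebesgue_cbox_lty a b : (lebesgue_rV (cbox a b) < +oo)%E.
Proof.
rewrite cbox_itv (@lebesgue_rV_box _ _ (fun i => `[a ord0 i, b ord0 i]%classic))//.
suff : (\prod_(i < d) lebesgue_measure (`[a ord0 i, b ord0 i]%classic : set R))%E
    \is a fin_num.
  by rewrite fin_numElt => /andP[].
apply: prode_fin_num => i _.
by rewrite lebesgue_measure_itv /=; case: ifPn.
Qed.

Lemma lebesgue_obox_gt0 a b : (forall i, a ord0 i < b ord0 i) ->
  (0 < lebesgue_rV (obox a b))%E.
Proof.
move=> ab; rewrite lebesgue_obox.
apply: (big_ind (fun x : \bar R => 0 < x)%E) => //.
- by move=> x y; exact: mule_gt0.
- move=> i _; rewrite lebesgue_measure_itv /= lte_fin ab.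
  by rewrite -EFinB lte_fin subr_gt0.
Qed.

Lemma obox_setI a b a' b' : obox a b `&` obox a' b' =
  obox (\row_i Num.max (a ord0 i) (a' ord0 i))
       (\row_i Num.min (b ord0 i) (b' ord0 i)).
Proof.
apply/seteqP; split => x /=.
  move=> [h1 h2] i; rewrite !mxE gt_max lt_min.
  by have /andP[-> ->] := h1 i; have /andP[-> ->] := h2 i.
move=> h; split => i; have := h i; rewrite !mxE gt_max lt_min;
  by move=> /andP[/andP[h1 h2] /andP[h3 h4]]; apply/andP.
Qed.

Definition oboxes : set (set 'rV[R]_d) := [set obox ab.1 ab.2 | ab in setT].

Lemma oboxes_setI : setI_closed oboxes.
Proof.
move=> _ _ [[a b] _ <-] [[a' b'] _ <-]; rewrite obox_setI.
by eexists (_, _).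
Qed.

Lemma obox_bigcup :
  \bigcup_k obox (const_mx (- k%:R)) (const_mx k%:R) = [set: 'rV[R]_d].
Proof.
rewrite -subTset => x _.
have [k kx] : exists k : nat, forall i, `|x ord0 i| < k%:R.
  exists (Num.truncn (\sum_i `|x ord0 i|)).+1 => i.
  apply: le_lt_trans (truncnS_gt _).
  by rewrite (bigD1 i)//= lerDl sumr_ge0.
exists k => // i; rewrite !mxE -ltr_norml; exact: kx.
Qed.

(** The sigma-algebra of the row vectors is generated by the coordinates; the
half-space where a coordinate exceeds a real is a countable union of boxes. *)
Lemma measurable_oboxes : measurable = <<s oboxes >>.
Proof.
apply/seteqP; split; last first.
  apply: smallest_sub; first exact: sigma_algebra_measurable.
  by move=> _ [[a b] _ <-]; exact: measurable_obox.
apply: smallest_sub; first exact: smallest_sigma_algebra.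
move=> _ [i0 [j [B [mB ->]]]]; rewrite (ord1 i0).
have mRE : (measurable : set (set R)) = (@RGenOInfty.G R).-sigma.-measurable.
  exact: RGenOInfty.measurableE.
rewrite mRE in mB.
pose f : 'rV[R]_d -> R := fun M => M ord0 j.
suff : (@RGenOInfty.G R).-sigma.-measurable `<=` image_set_system setT f <<s oboxes >>.
  by move=> /(_ _ mB); rewrite /image_set_system/= setTI.
apply: smallest_sub.
  by apply: sigma_algebra_image; exact: smallest_sigma_algebra.
move=> _ [x ->]; rewrite /image_set_system/= setTI.
rewrite (_ : f @^-1` _ = \bigcup_k
   obox (\row_i if i == j then x else - k%:R) (const_mx k%:R)).
  apply: sigma_algebra_bigcup => k.
  by apply: sub_sigma_algebra; eexists (_, _).
rewrite -[LHS]setTI -obox_bigcup setI_bigcupl; apply/seteqP; split.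
  move=> y [k _ [h]]; rewrite /f /= in_itv /= andbT => xy.
  exists k => // i; rewrite !mxE; case: eqVneq => [->|_].
    by have := h j; rewrite !mxE => /andP[_ ->]; rewrite xy.
  by have := h i; rewrite !mxE.
move=> y [k _ h].
have [m hm] : exists m : nat, forall i, `|y ord0 i| < m%:R.
  exists (Num.truncn (\sum_i `|y ord0 i|)).+1 => i.
  apply: le_lt_trans (truncnS_gt _).
  by rewrite (bigD1 i)//= lerDl sumr_ge0.
exists m => //; split; first by move=> i; rewrite !mxE -ltr_norml; exact: hm.
by rewrite /f /= in_itv /= andbT; have := h j; rewrite !mxE eqxx => /andP[].
Qed.

Lemma lebesgue_obox_lty a b : (lebesgue_rV (obox a b) < +oo)%E.
Proof.
apply: le_lt_trans (lebesgue_cbox_lty a b).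
apply: le_measure; rewrite ?inE; [exact: measurable_obox| |exact: obox_cbox].
exact: measurable_cbox.
Qed.

Lemma lebesgue_rV_unique (m : {measure set 'rV[R]_d -> \bar R}) :
  (forall a b, m (obox a b) = lebesgue_rV (obox a b)) ->
  forall A, measurable A -> m A = lebesgue_rV A.
Proof.
move=> h A mA; apply/esym.
apply: (measure_unique oboxes (fun k => obox (const_mx (- k%:R)) (const_mx k%:R))) mA.
- exact: measurable_oboxes.
- exact: oboxes_setI.
- by move=> k; eexists (_, _).
- exact: obox_bigcup.
- by move=> _ [[a b] _ <-].
- by move=> k; exact: lebesgue_obox_lty.
Qed.

Lemma measurable_addrV h : measurable_fun setT (fun x : 'rV[R]_d => x + h).
Proof.
apply: measurable_fun_mxP => i j; under eq_fun do rewrite mxE.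
by apply: measurable_funD => //; exact: measurable_coord.
Qed.

Lemma lebesgue_shift h A : measurable A ->
  lebesgue_rV ((fun x => x + h) @^-1` A) = lebesgue_rV A.
Proof.
move=> mA.
pose m := measure_function_pushforward__canonical__measure_function_Measure
  (lebesgue_rV (R:=R) (n:=d)) (measurable_addrV h).
rewrite -[LHS]/(m A); apply: lebesgue_rV_unique => // a b.
rewrite -[LHS]/(lebesgue_rV ((fun x => x + h) @^-1` obox a b)).
rewrite (_ : _ @^-1` _ = obox (a - h) (b - h)); last first.
  by apply/seteqP; split => x H i; have := H i; rewrite !mxE ltrBlDr ltrBrDr.
rewrite !lebesgue_obox; apply: eq_bigr => i _.
rewrite !lebesgue_measure_itv /= !mxE !lte_fin ltrD2r.
by case: ifPn => // _; rewrite -!EFinB opprB addrA subrK.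
Qed.

(** Rational corners make the family of boxes countable. *)
Lemma nbhs_rat_box U x : nbhs x U -> exists a b : 'rV[rat]_d,
  obox (map_mx (@ratr R) a) (map_mx (@ratr R) b) x /\
  cbox (map_mx (@ratr R) a) (map_mx (@ratr R) b) `<=` U.
Proof.
move=> /nbhs_ballP[e /= e0 xeU].
have ha i : exists q : rat, x ord0 i - e < ratr q < x ord0 i.
  have /rat_in_itvoo[q] : x ord0 i - e < x ord0 i by rewrite ltrBlDr ltrDl.
  by rewrite in_itv/= => h; exists q.
have hb i : exists q : rat, x ord0 i < ratr q < x ord0 i + e.
  have /rat_in_itvoo[q] : x ord0 i < x ord0 i + e by rewrite ltrDl.
  by rewrite in_itv/= => h; exists q.
have [a aP] := choice ha; have [b bP] := choice hb.
exists (\row_i a i), (\row_i b i); split.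
  by move=> i; rewrite !mxE; have /andP[_ ->] := aP i; have /andP[-> _] := bP i.
move=> y h; apply: xeU; split => // i' i; rewrite (ord1 i').
have := h i; rewrite !mxE => /andP[h1 h2].
have /andP[a1 _] := aP i; have /andP[_ b1] := bP i.
rewrite -ball_normE /ball_/= ltr_distlC; apply/andP; split.
  exact: lt_le_trans a1 h1.
exact: le_lt_trans h2 b1.
Qed.

Lemma open_measurable_rV U : open U -> measurable U.
Proof.
move=> oU.
pose box (ab : 'rV[rat]_d * 'rV[rat]_d) :=
  obox (map_mx (@ratr R) ab.1) (map_mx (@ratr R) ab.2).
pose F ab := if `[< box ab `<=` U >] then box ab else set0.
rewrite (_ : U = \bigcup_ab F ab).
  apply: countable_bigcupT_measurable => // ab; rewrite /F.
  by case: ifPn => // _; exact: measurable_obox.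
apply/seteqP; split => [x Ux|x [ab _]]; last first.
  by rewrite /F; case: asboolP => // h; exact: h.
have [a [b [xab abU]]] := nbhs_rat_box (open_nbhs_nbhs (conj oU Ux)).
exists (a, b) => //; rewrite /F; case: asboolP => // -[].
by apply: subset_trans abU; exact: obox_cbox.
Qed.

Lemma continuous_measurable_rV (f : 'rV[R]_d -> R) :
  continuous f -> measurable_fun setT f.
Proof.
move=> /continuousP cf; apply: (measurability _ (RGenOpens.measurableE R)).
move=> _ [_ [a [b ->] <-]]; rewrite setTI; apply: open_measurable_rV.
exact/cf/interval_open.
Qed.

Lemma compact_cbox a b : compact (cbox a b).
Proof.
rewrite cbox_itv; apply: (@rV_compact _ _ (fun i => `[a ord0 i, b ord0 i]%classic)).
by move=> i; exact: segment_compact.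
Qed.

Lemma coord_le_norm x i : `|x ord0 i| <= `|x|.
Proof.
have /mapP[j Hj ->] : `|x ord0 i| \in [seq `|x k.1 k.2| | k : 'I_1 * 'I_d].
  by apply/mapP; exists (ord0, i) => //=; rewrite mem_enum.
by rewrite [leRHS]/Num.norm /= mx_normrE; apply/bigmax_geP; right => /=; exists j.
Qed.

Lemma bounded_cbox U : bounded_set U ->
  exists M : R, U `<=` cbox (const_mx (- M)) (const_mx M).
Proof.
move=> [M [_ hM]]; exists (M + 1) => x Ux i; rewrite !mxE -ler_norml.
by apply: le_trans (coord_le_norm x i) _; apply: (hM _ _ _ Ux); rewrite ltrDl.
Qed.

End boxes.

(** * Smooth bump functions *)

Section flat_exponential.
Context (R : realType).
Implicit Types (c s t : R) (P : {poly R}).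

(** The function P (1/t) exp (- c / t), extended by 0 to t <= 0. Its derivative has
the same form with another polynomial P, also at 0. *)
Definition flatexp c P t := if 0 < t then P.[t^-1] * expR (- (c / t)) else 0.

(** By induction on the polynomial: half of the exponent absorbs the last factor s,
the other half is left for the remaining polynomial. *)
Lemma poly_expR_bounded P c : 0 < c ->
  exists K, forall s, 0 <= s -> `|P.[s]| * expR (- (c * s)) <= K.
Proof.
elim/poly_ind: P c => [|P a IH] c c0.
  by exists 0 => s _; rewrite horner0 normr0 mul0r.
have c2 : 0 < c / 2 by rewrite divr_gt0.
have [K hK] := IH _ c2; exists (K * (2 / c) + `|a|) => s s0.
rewrite hornerMXaddC.
have e1 : expR (- (c * s)) <= 1 by rewrite expR_le1 oppr_le0 mulr_ge0// ltW.
have es : s * expR (- (c / 2 * s)) <= 2 / c.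
  rewrite expRN ler_pdivrMr ?expR_gt0//.
  have h : c / 2 * s <= expR (c / 2 * s).
    by apply: le_trans (expR_ge1Dx _); rewrite lerDr.
  rewrite mulrC -ler_pdivrMr ?divr_gt0//; apply: le_trans h.
  by rewrite invf_div mulrC.
apply: (@le_trans _ _ ((`|P.[s]| * s + `|a|) * expR (- (c * s)))).
  rewrite ler_wpM2r ?expR_ge0//; apply: le_trans (ler_normD _ _) _.
  by rewrite normrM (ger0_norm s0).
rewrite mulrDl lerD//; last by rewrite -[leRHS]mulr1 ler_wpM2l.
have -> : - (c * s) = - (c / 2 * s) + - (c / 2 * s) by field.
rewrite expRD mulrACA ler_pM ?mulr_ge0 ?expR_ge0//; exact: hK.
Qed.

Definition flatexp_dpoly c P := (c *: P - P^`()) * 'X^2.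

(** At 0 the difference quotient for h > 0 is h times Q (1/h) exp (- c / h) with Q = P X^2,
and the second factor is bounded. *)
Lemma is_derive_flatexp c P t : 0 < c ->
  is_derive t 1 (flatexp c P) (flatexp c (flatexp_dpoly c P) t).
Proof.
move=> c0; have [t0|t0|t0] := ltgtP 0 t; last 2 first.
- have -> : flatexp c (flatexp_dpoly c P) t = 0.
    by rewrite /flatexp ltNge (ltW t0).
  have h : \forall y \near t, cst 0 y = flatexp c P y.
    near=> y; rewrite /flatexp ltNge.
    suff -> : y <= 0 by [].
    by apply: ltW; near: y; exact: lt_nbhsl.
  refine (near_eq_is_derive h _).
- rewrite -t0.
  have -> : flatexp c (flatexp_dpoly c P) 0 = 0 by rewrite /flatexp ltxx.
  have [K hK] := poly_expR_bounded (P * 'X^2) c0.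
  have K0 : 0 <= K by apply: le_trans (hK 0 (lexx 0)); rewrite mulr_ge0 ?expR_ge0.
  have cv : h^-1 *: (flatexp c P (h *: 1 + 0) - flatexp c P 0) @[h --> 0^'] --> 0.
    apply/cvgrPdist_le => e e0; near=> h.
    rewrite sub0r normrN /GRing.scale/= mulr1 addr0 {2}/flatexp ltxx subr0.
    have [h0|h0] := ltP 0 h; last by rewrite /flatexp ltNge h0/= mulr0 normr0 ltW.
    rewrite /flatexp h0 !normrM [X in _ * (_ * X)]ger0_norm ?expR_ge0//.
    rewrite ger0_norm ?invr_ge0 ?(ltW h0)//.
    have hi : 0 <= h^-1 by rewrite invr_ge0 ltW.
    have := hK _ hi; rewrite hornerM hornerXn normrM.
    rewrite [`|h^-1 ^+ 2|]ger0_norm ?exprn_ge0// => hh.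
    have he : h < e / (K + 1).
      apply: le_lt_trans (ler_norm h) _; near: h.
      apply: dnbhs0_lt; rewrite divr_gt0// ltr_wpDl//.
    rewrite ltr_pdivlMr ?ltr_wpDl// in he.
    apply: le_trans (ltW he); apply: (@le_trans _ _ (h * K)); last first.
      by rewrite mulrDr mulr1 lerDl ltW.
    rewrite -ler_pdivrMl//; apply: le_trans hh; rewrite le_eqVlt; apply/orP; left.
    by apply/eqP; ring.
  apply: DeriveDef; first by apply/cvg_ex; exists 0.
  exact: cvg_lim cv.
- pose F y := P.[y^-1] * expR (- (c / y)).
  have h : \forall y \near t, F y = flatexp c P y.
    near=> y; rewrite /flatexp /F ifT//.
    by near: y; exact: lt_nbhsr.
  refine (near_eq_is_derive h _).
  have tn0 : t != 0 by rewrite gt_eqF.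
  have dV : is_derive t 1 (fun y : R => y^-1) (- (t ^- 2)).
    have := @is_deriveV _ id t 1 1 tn0 (is_derive_id _ _).
    by rewrite /GRing.scale/= mulr1.
  have dP := @is_derive1_comp _ (horner P) _ _ _ _ (is_derive_poly P t^-1) dV.
  have dc := @is_deriveZ _ _ _ _ (- c) _ _ _ dV.
  have dE := @is_derive1_comp _ (@expR R) _ _ _ _ (is_derive_expR _) dc.
  have := is_deriveM dP dE.
  rewrite (_ : _ * _ = F); last first.
    apply/funext => y; transitivity (P.[y^-1] * expR (- c * y^-1)) => //.
    by rewrite /F mulNr.
  move/is_derive_eq; apply.
  rewrite /flatexp t0 /flatexp_dpoly.
  rewrite [LHS](_ : _ = P.[t^-1] * (expR (- c * t^-1) * (- c * - (t ^- 2))) +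
      expR (- c * t^-1) * ((P^`()).[t^-1] * - (t ^- 2))); last by [].
  by rewrite hornerM hornerD hornerN hornerZ hornerXn mulNr; field.
Unshelve. all: by end_near. Qed.

End flat_exponential.

Section smooth_class.
Context (R : realType) (d : nat).
Implicit Types (u v : 'rV[R]_d -> R) (x k : 'rV[R]_d).

(** A class of functions stable under partial derivatives, hence made of smooth
functions. It spares an induction on products of iterated derivatives. *)
Inductive flat_algebra : ('rV[R]_d -> R) -> Prop :=
| flat_cst a : flat_algebra (fun=> a)
| flat_gen c (P : {poly R}) s a i : 0 < c ->
    flat_algebra (fun x => flatexp c P (s * (x ord0 i - a)))
| flat_add u v : flat_algebra u -> flat_algebra v ->
    flat_algebra (fun x => u x + v x)
| flat_mul u v : flat_algebra u -> flat_algebra v ->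
    flat_algebra (fun x => u x * v x).

Lemma is_derive_coord (F : R -> R) x k i (l : R) :
  is_derive (x ord0 i) 1 F l ->
  is_derive x k (fun y : 'rV[R]_d => F (y ord0 i)) (k ord0 i * l).
Proof.
move=> dF.
have dc : is_derive x k (fun y : 'rV[R]_d => y ord0 i) (k ord0 i).
  have cv : h^-1 *: ((h *: k + x) ord0 i - x ord0 i) @[h --> (0:R)^'] --> k ord0 i.
    apply: cvg_near_cst; near=> h; rewrite !mxE addrK /GRing.scale/= mulKf//.
    by near: h; exact: nbhs_dnbhs_neq.
  apply: DeriveDef; first by apply/cvg_ex; exists (k ord0 i).
  exact: cvg_lim cv.
have [df vE] := dF.
have dF1 : is_derive (0 : R) 1 (fun h : R => F (h * k ord0 i + x ord0 i)) (k ord0 i * l).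
  have dg : is_derive (0 : R) 1 (fun h : R => h * k ord0 i + x ord0 i) (k ord0 i).
    have := @is_deriveD _ _ _ (fun h : R => h * k ord0 i) (cst (x ord0 i)) 0 1
       (k ord0 i) 0 _ (is_derive_cst _ _ _).
    rewrite addr0; apply.
    have := @is_deriveM _ _ (@id R) (cst (k ord0 i)) 0 1 _ _ (is_derive_id _ _) (is_derive_cst _ _ _).
    rewrite /GRing.scale/= mul0r add0r mulr1; exact.
  rewrite mulrC; apply: (@is_derive1_comp _ F _ 0 l (k ord0 i)) => //.
  by rewrite mul0r add0r.
have e : (fun h : R => F (h * k ord0 i + x ord0 i)) =
    (fun h : R => (fun y : 'rV[R]_d => F (y ord0 i)) (h *: k + x)).
  by apply/funext => h; rewrite !mxE.
rewrite e in dF1; have [dF2 vF2] := dF1.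
pose f y := F ((y : 'rV[R]_d) ord0 i).
have df' : derivable f x k by apply/derivable1P; exact: dF2.
apply: (DeriveDef df').
rewrite -vF2 /derive; set g1 := fun h => h^-1 *: _; set g2 := fun h => h^-1 *: _.
suff -> : g1 = g2 by [].
by rewrite funeqE /g1 /g2 => h /=; rewrite addr0 scale0r add0r [_%:A]mulr1.
Unshelve. all: by end_near. Qed.

(** Derivatives in all directions are provided at once: directional derivatives are
needed along arbitrary segments, not only along the axes. *)
Lemma flat_algebra_derive u : flat_algebra u ->
  exists Du : 'I_d -> 'rV[R]_d -> R, (forall i, flat_algebra (Du i)) /\
    forall x k, is_derive x k u (\sum_i k ord0 i * Du i x).
Proof.
elim => {u} [a|c P s a i c0|u v _ [Du [Du1 Du2]] _ [Dv [Dv1 Dv2]]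
  |u v fu [Du [Du1 Du2]] fv [Dv [Dv1 Dv2]]].
- exists (fun _ => fun=> 0); split; first by move=> i; exact: flat_cst.
  move=> x k; rewrite big1; first exact: is_derive_cst.
  by move=> i _; rewrite mulr0.
- exists (fun j x => (if j == i then s else 0) *
     flatexp c (flatexp_dpoly c P) (s * (x ord0 i - a))); split.
    move=> j; apply: (@flat_mul (fun=> _)); [exact: flat_cst|exact: flat_gen].
  move=> x k; rewrite (bigD1 i)//= eqxx big1 ?addr0; last first.
    by move=> j /negbTE ->; rewrite mul0r mulr0.
  apply: (@is_derive_coord (fun y => flatexp c P (s * (y - a)))).
  have dg : is_derive (x ord0 i) 1 (fun y : R => s * (y - a)) s.
    have := @is_deriveZ _ _ _ (fun y : R => y - a) s (x ord0 i) 1 1.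
    rewrite /GRing.scale/= mulr1; apply.
    have := @is_deriveD _ _ _ (@id R) (cst (- a)) (x ord0 i) 1 1 0
      (is_derive_id _ _) (is_derive_cst _ _ _).
    by rewrite addr0.
  rewrite mulrC.
  exact: (@is_derive1_comp _ _ _ _ _ _ (is_derive_flatexp P _ c0) dg).
- exists (fun i x => Du i x + Dv i x); split; first by move=> i; exact: flat_add.
  move=> x k; under eq_bigr do rewrite mulrDr; rewrite big_split.
  exact: is_deriveD.
- exists (fun i x => u x * Dv i x + v x * Du i x); split.
    by move=> i; apply: flat_add; exact: flat_mul.
  move=> x k; have := @is_deriveM _ _ u v x k _ _ (Du2 x k) (Dv2 x k).
  rewrite /GRing.scale/=; congr (is_derive _ _ _ _).
  rewrite !mulr_sumr -big_split; apply: eq_bigr => i _ /=; ring.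
Qed.

Lemma continuous_flat_algebra u : flat_algebra u -> continuous u.
Proof.
elim => {u} [a|c P s a i c0|u v _ cu _ cv|u v _ cu _ cv] x.
- exact: cst_continuous.
- have cc : continuous (flatexp c P).
    move=> y; have [/derivable1_diffP/differentiable_continuous h _] :=
      is_derive_flatexp P y c0.
    exact: h.
  have ca : {for x, continuous (fun x : 'rV[R]_d => s * (x ord0 i - a))}.
    apply: (@continuousM _ _ (fun=> s) (fun x : 'rV[R]_d => x ord0 i - a)).
      exact: cst_continuous.
    apply: (@continuousB _ _ _ (fun x : 'rV[R]_d => x ord0 i) (fun=> a)).
      exact: coord_continuous.
    exact: cst_continuous.
  exact: (@continuous_comp _ _ _ _ (flatexp c P) _ ca (cc _)).
- by apply: continuousD; [exact: cu|exact: cv].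
- by apply: continuousM; [exact: cu|exact: cv].
Qed.

Lemma flat_algebra_pderive u i : flat_algebra u -> flat_algebra (pderive i u).
Proof.
move=> /flat_algebra_derive[Du [Du1 Du2]].
suff -> : pderive i u = Du i by exact: Du1.
apply/funext => x; have [_ h] := Du2 x (delta_mx ord0 i); rewrite /pderive h.
rewrite (bigD1 i)//= mxE !eqxx mul1r big1 ?addr0// => j ji.
by rewrite mxE eqxx (negbTE ji) mul0r.
Qed.

Lemma flat_algebra_is_derive u x k : flat_algebra u ->
  is_derive x k u (\sum_i k ord0 i * pderive i u x).
Proof.
move=> /flat_algebra_derive[Du [Du1 Du2]].
suff h i : pderive i u x = Du i x by under eq_bigr do rewrite h.
have [_ h] := Du2 x (delta_mx ord0 i); rewrite /pderive h.
rewrite (bigD1 i)//= mxE !eqxx mul1r big1 ?addr0// => j ji.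
by rewrite mxE eqxx (negbTE ji) mul0r.
Qed.

Lemma smooth_flat_algebra u : flat_algebra u -> smooth u.
Proof.
move=> fu s.
have h : flat_algebra (foldr (@pderive R d) u s).
  by elim: s => //= i s; exact: flat_algebra_pderive.
split; first exact: continuous_flat_algebra.
by move=> x i; have [] := flat_algebra_is_derive x (delta_mx ord0 i) h.
Qed.

(** A smooth function positive exactly on the open box (a, b). As c tends to 0 it
tends to the indicator of the box, which replaces mollification. *)
Definition bump c (a b : 'rV[R]_d) x :=
  \prod_i (flatexp c 1 (1 * (x ord0 i - a ord0 i)) *
           flatexp c 1 (-1 * (x ord0 i - b ord0 i))).

Lemma flatexp1 c (t : R) : flatexp c 1 t = if 0 < t then expR (- (c / t)) else 0.
Proof. by rewrite /flatexp hornerC mul1r. Qed.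

Lemma flatexp1_ge0 c (t : R) : 0 <= flatexp c 1 t.
Proof. by rewrite flatexp1; case: ifP => // _; exact: expR_ge0. Qed.

Lemma flatexp1_le1 c (t : R) : 0 <= c -> flatexp c 1 t <= 1.
Proof.
move=> c0; rewrite flatexp1; case: ifP => // t0.
by rewrite expR_le1 oppr_le0 divr_ge0// ltW.
Qed.

Lemma flat_algebra_bump c a b : 0 < c -> flat_algebra (bump c a b).
Proof.
move=> c0.
have h (r : seq 'I_d) : flat_algebra (fun x =>
    \prod_(i <- r) (flatexp c 1 (1 * (x ord0 i - a ord0 i)) *
                    flatexp c 1 (-1 * (x ord0 i - b ord0 i)))).
  elim: r => [|i r IH].
    by under eq_fun do rewrite big_nil; exact: flat_cst.
  under eq_fun do rewrite big_cons; apply: flat_mul => //.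
  by apply: flat_mul; exact: flat_gen.
exact: h.
Qed.

Lemma bump_ge0 c a b x : 0 <= bump c a b x.
Proof. by apply: prodr_ge0 => i _; rewrite mulr_ge0// flatexp1_ge0. Qed.

Lemma bump_le1 c a b x : 0 <= c -> bump c a b x <= 1.
Proof.
move=> c0; apply: prodr_ile1 => i _.
by rewrite mulr_ge0 ?flatexp1_ge0//= mulr_ile1 ?flatexp1_ge0 ?flatexp1_le1.
Qed.

Lemma bump_out c a b x : ~ obox a b x -> bump c a b x = 0.
Proof.
move=> /existsNP[i /negP]; rewrite negb_and -!leNgt => h.
rewrite /bump (bigD1 i)//= !flatexp1 mul1r mulN1r opprB !subr_gt0.
by case/orP: h => /le_gtF ->; rewrite ?(mul0r, mulr0).
Qed.

Lemma bump_in c a b x : obox a b x -> bump c a b x =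
  expR (- (c * \sum_i ((x ord0 i - a ord0 i)^-1 + (b ord0 i - x ord0 i)^-1))).
Proof.
move=> h; rewrite mulr_sumr -sumrN expR_sum; apply: eq_bigr => i _.
have /andP[h1 h2] := h i.
by rewrite !flatexp1 mul1r mulN1r opprB !subr_gt0 h1 h2 -expRD mulrDr opprD.
Qed.

Lemma bump_shift c a b k x : bump c a b (x - k) = bump c (a + k) (b + k) x.
Proof.
by apply: eq_bigr => i _; rewrite !mxE !opprD !addrA !(addrAC _ (- k ord0 i)).
Qed.

Lemma cvg_bump a b x :
  bump n.+1%:R^-1 a b x @[n --> \oo] --> (\1_(obox a b) x : R).
Proof.
rewrite indicE; have [/set_mem h|/negP h] := boolP (x \in obox a b).
  under eq_fun do rewrite bump_in//.
  set S := \sum_i _.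
  have cS : n.+1%:R^-1 * S @[n --> \oo] --> 0 * S.
    by apply: cvgM; [exact: cvg_harmonic|exact: cvg_cst].
  have cN : - (n.+1%:R^-1 * S) @[n --> \oo] --> - (0 * S) by apply: cvgN.
  have -> : (true%:R : R) = expR (- (0 * S)) by rewrite mul0r oppr0 expR0.
  exact: (cvg_comp _ _ cN (@continuous_expR R (- (0 * S)))).
rewrite (_ : (fun n => _) = cst 0); first exact: cvg_cst.
by apply/funext => n; rewrite bump_out// => ab; apply: h; rewrite inE.
Qed.

Lemma test_function_bump c a b (U : set 'rV[R]_d) : 0 < c ->
  cbox a b `<=` U -> test_function U (bump c a b).
Proof.
move=> c0 abU; rewrite /test_function.
have cc : closed (cbox a b).
  by apply: compact_closed; [exact: norm_hausdorff|exact: compact_cbox].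
have sub : closure [set x | bump c a b x != 0] `<=` cbox a b.
  rewrite (closure_id (cbox a b)).1//; apply: closure_subset => x /= bx.
  apply: obox_cbox; apply: contrapT => h; move: bx.
  by rewrite bump_out// eqxx.
have comp : compact (closure [set x | bump c a b x != 0]).
  apply: (subclosed_compact _ (compact_cbox (a := a) (b := b)) sub).
  exact: closed_closure.
split => //; last exact: subset_trans abU.
exact/smooth_flat_algebra/flat_algebra_bump.
Qed.

End smooth_class.

(** * Real-valued integrals: limits, translations, vanishing on boxes *)

Lemma dominated_cvg_Rintegral d (T : measurableType d) (R : realType)
    (mu : {measure set T -> \bar R}) (D : set T) (f_ : nat -> T -> R)
    (f g : T -> R) : measurable D -> (forall n, measurable_fun D (f_ n)) ->
  (forall x, D x -> f_ n x @[n --> \oo] --> f x) ->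
  mu.-integrable D (EFin \o g) -> (forall n x, D x -> `|f_ n x| <= g x) ->
  mu.-integrable D (EFin \o f) /\
  \int[mu]_(x in D) f_ n x @[n --> \oo] --> \int[mu]_(x in D) f x.
Proof.
move=> mD mf_ cf ig fg.
have mf : measurable_fun D f by exact: (@measurable_fun_cvg _ _ _ D f_).
have h := @dominated_convergence _ _ _ mu D mD (fun n => EFin \o f_ n) (EFin \o f)
  (EFin \o g).
have [||||h1 _ h2] := h _ _ _ ig.
- by move=> n; exact/measurable_EFinP.
- exact/measurable_EFinP.
- apply/aeW => x Dx; apply: cvg_EFin; first by near=> n.
  exact: cf.
- by apply/aeW => x n Dx; rewrite /= lee_fin fg.
split => //; apply: fine_cvg.
by rewrite EFin_Rintegral.
Unshelve. all: by end_near. Qed.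

Section shift.
Context (R : realType) (d : nat).
Local Notation mu := (@lebesgue_rV R d).
Implicit Types (h : 'rV[R]_d).

Let shifted_measure h : {measure set 'rV[R]_d -> \bar R} :=
  measure_function_pushforward__canonical__measure_function_Measure
    mu (measurable_addrV h).

Let integral_shifted_measure h (f : 'rV[R]_d -> \bar R) :
  (\int[shifted_measure h]_x f x = \int[mu]_x f x)%E.
Proof. by apply: eq_measure_integral => A mA _; exact: lebesgue_shift. Qed.

Lemma ge0_integral_shift (f : 'rV[R]_d -> \bar R) h : measurable_fun setT f ->
  (forall x, 0 <= f x)%E -> (\int[mu]_x f (x + h)%R = \int[mu]_x f x)%E.
Proof.
move=> mf f0.
have := @ge0_integral_pushforward _ _ _ _ _ _ (measurable_addrV h) mu setT f
  measurableT mf (fun x _ => f0 x).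
rewrite preimage_setT => <-; exact: (integral_shifted_measure h).
Qed.

Lemma integrable_shift (f : 'rV[R]_d -> R) h : mu.-integrable setT (EFin \o f) ->
  mu.-integrable setT (EFin \o (fun x => f (x + h))).
Proof.
move=> fi; have [mf foo] := integrableP _ _ _ fi.
apply/integrableP; split.
  exact: (measurableT_comp mf (measurable_addrV h)).
rewrite (@ge0_integral_shift (fun x => `|(f x)%:E|)%E)//.
exact: measurableT_comp.
Qed.

Lemma Rintegral_shift (f : 'rV[R]_d -> R) h : mu.-integrable setT (EFin \o f) ->
  \int[mu]_x f (x + h) = \int[mu]_x f x.
Proof.
move=> fi; have fi' := integrable_shift h fi; congr fine.
have [mf _] := integrableP _ _ _ fi.
have := @integral_pushforward _ _ _ _ _ _ (measurable_addrV h) mu setT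
  (EFin \o f) mf fi' measurableT.
rewrite preimage_setT => <-; exact: (integral_shifted_measure h).
Qed.

End shift.

Section fundamental_lemma.
Context (R : realType) (d : nat).
Local Notation mu := (@lebesgue_rV R d).
Variables (w : 'rV[R]_d -> R) (U : set 'rV[R]_d).
Hypothesis wi : mu.-integrable setT (EFin \o w).

Let wiS A : measurable A -> mu.-integrable A (EFin \o w).
Proof. by move=> mA; exact: integrableS wi. Qed.

Let mw A : measurable_fun A (EFin \o w).
Proof. exact: measurable_funTS (measurable_int _ wi). Qed.

(** The sets E such that w has integral 0 over E intersected with the box form a
Dynkin system containing all boxes, hence all Borel sets. *)
Lemma box_integrals_eq0 a b :
  (forall a' b', cbox a' b' `<=` cbox a b -> (\int[mu]_(x in obox a' b') (w x)%:E = 0)%E) ->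
  {ae mu, forall x, obox a b x -> w x = 0}.
Proof.
move=> h; have mB := measurable_obox a b.
(* Intersecting with the box keeps everything in a set where h applies. *)
have hE E : measurable E -> (\int[mu]_(x in E `&` obox a b) (w x)%:E = 0)%E.
  rewrite (measurable_oboxes R d).
  apply: (@dynkin_induction _ _ (@oboxes R d)
    (fun E => \int[mu]_(x in E `&` obox a b) (w x)%:E = 0)%E).
  - exact: measurable_oboxes.
  - exact: oboxes_setI.
  - by rewrite setTI; exact: h.
  - move=> _ [[a' b'] _ <-] /=; rewrite obox_setI; apply: h => x hx i.
    by have := hx i; rewrite !mxE ge_max le_min => /andP[/andP[_ ->] /andP[_ ->]].
  - move=> S mS S0; have := h a b (fun x => id).
    rewrite -{1}(setTI (obox a b)) -(setUv S) setIUl integral_setU//.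
    + by rewrite S0 add0e.
    + exact: measurableI.
    + by apply: measurableI => //; exact: measurableC.
    + by apply/disj_setPS => x [[Sx _] [nSx _]].
  - move=> F mF tF F0; rewrite setI_bigcupl integral_bigcup.
    + by rewrite eseries0.
    + exact: trivIset_setIr.
    + by move=> k; exact: measurableI.
    + by apply: wiS; apply: bigcupT_measurable => k; exact: measurableI.
have := @integral_ae_eq _ _ _ mu (obox a b) mB (cst 0%E) (EFin \o w) (wiS mB).
move=> /(_ (measurable_cst _)) H.
have : ae_eq mu (obox a b) (EFin \o w) (cst 0%E).
  apply: H => E Eab mE; rewrite integral0 -(hE E mE).
  by rewrite (setIidl Eab).
by apply: filterS => x H' /H' [].
Qed.

(** Countably many boxes with rational corners cover the open set. *)
Lemma box_integrals_eq0_open : open U ->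
  (forall a b, cbox a b `<=` U -> (\int[mu]_(x in obox a b) (w x)%:E = 0)%E) ->
  {ae mu, forall x, U x -> w x = 0}.
Proof.
move=> oU h.
pose r (a : 'rV[rat]_d) := map_mx (@ratr R) a.
pose P (ab : 'rV[rat]_d * 'rV[rat]_d) x := cbox (r ab.1) (r ab.2) `<=` U ->
  obox (r ab.1) (r ab.2) x -> w x = 0.
have aeP ab : {ae mu, forall x, P ab x}.
  have [abU|abU] := pselect (cbox (r ab.1) (r ab.2) `<=` U); last first.
    by apply/aeW => x /abU.
  have : {ae mu, forall x, obox (r ab.1) (r ab.2) x -> w x = 0}.
    by apply: box_integrals_eq0 => a' b' sub; apply: h; exact: subset_trans abU.
  by apply: filterS => x H _.
have : {ae mu, forall x n, if unpickle n is Some ab then P ab x else True}.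
  apply/ae_foralln => n; case: unpickle => [ab|]; first exact: aeP.
  exact: aeW.
apply: filterS => x H Ux.
have [a [b [xab abU]]] := nbhs_rat_box (open_nbhs_nbhs (conj oU Ux)).
by have := H (pickle (a, b)); rewrite pickleK; apply.
Qed.

End fundamental_lemma.

(** * Fubini for real-valued integrals and test functions *)

Section real_fubini.
Context d1 d2 (T1 : measurableType d1) (T2 : measurableType d2) (R : realType).
Variables (m1 : {sigma_finite_measure set T1 -> \bar R})
  (m2 : {sigma_finite_measure set T2 -> \bar R}) (f : T1 * T2 -> R).
Hypothesis fi : (m1 \x m2)%E.-integrable setT (EFin \o f).

Let integrable_fineE d (T : measurableType d) (m : {measure set T -> \bar R})
    (F : T -> \bar R) : m.-integrable setT F ->
  m.-integrable setT (EFin \o (fine \o F)) /\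
  \int[m]_x fine (F x) = fine (\int[m]_x F x)%E.
Proof.
move=> Fi; have mF := measurable_int _ Fi.
have mf : measurable_fun setT (EFin \o (fine \o F)).
  apply/measurable_EFinP; exact: (measurableT_comp (fine_measurable measurableT) mF).
split.
  apply: (le_integrable measurableT mf _ Fi) => x _ /=.
  by case: (F x) => [r||] /=; rewrite ?normr0 ?leey ?lexx.
congr fine; apply: ae_eq_integral => //.
have := integrable_ae measurableT Fi; apply: filterS => x h _ /=.
by rewrite fineK//; exact: h.
Qed.

Let integrable_G : m2.-integrable setT (fubini_G m1 (EFin \o f)).
Proof.
have mf := measurable_int _ fi.
have mG := measurable_fubini_G fi.
apply/integrableP; split; first exact: mG.
apply: le_lt_trans ((integrable21ltyP m1 m2 mf).1 fi).
apply: ge0_le_integral => //.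
- exact: (measurableT_comp (@abse_measurable _ _) mG).
- apply: (@measurable_fun_fubini_tonelli_G _ _ T1 T2 R m1 (abse \o (EFin \o f))).
    exact: (measurableT_comp (@abse_measurable _ _) mf).
  by move=> x; exact: abse_ge0.
- move=> y _; apply: le_abse_integral => //.
  exact: (measurableT_comp mf (pair2_measurable y)).
Qed.

Lemma integrable_fubini1 : m1.-integrable setT (EFin \o (fun x => \int[m2]_y f (x, y))).
Proof. exact: (integrable_fineE (integrable_fubini_F fi)).1. Qed.

Lemma integrable_fubini2 : m2.-integrable setT (EFin \o (fun y => \int[m1]_x f (x, y))).
Proof. exact: (integrable_fineE (integrable_G)).1. Qed.

Lemma Fubini_Rintegral :
  \int[m1]_x \int[m2]_y f (x, y) = \int[m2]_y \int[m1]_x f (x, y).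
Proof.
rewrite [LHS](integrable_fineE (integrable_fubini_F fi)).2.
rewrite [RHS](integrable_fineE (integrable_G)).2.
by rewrite /fubini_F /fubini_G Fubini.
Qed.

End real_fubini.

Section Lp_pint.
Context (R : realType) (d : nat) (Omega : set 'rV[R]_d).
Hypothesis mO : measurable Omega.
Local Notation mu := (@lebesgue_rV R d).

(** Lp is defined through the norm of the extension by 0 to the whole space. *)
Lemma LpP (p : R) (u : 'rV[R]_d -> R) : 0 < p -> Lp Omega p u <-> pint mu Omega p u.
Proof.
move=> p0; rewrite /Lp /=.
have e : (\int[mu]_x `| (EFin \o (u \_ Omega)) x | `^ p =
    \int[mu]_(x in Omega) `|(`|u x| `^ p)%:E|)%E.
  rewrite [RHS]integral_mkcond; apply: eq_integral => x _; rewrite /= !patchE.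
  case: ifPn => _; first by rewrite (ger0_norm (powR_ge0 _ _)).
  by rewrite normr0 powR0 ?gt_eqF.
split.
  move=> /andP[mu1 h]; have {}mu1 := set_mem mu1; move: h; rewrite inE /=.
  rewrite /finite_norm unlock e => h.
  have mu2 : measurable_fun Omega u by apply/(measurable_restrictT u mO).
  split => //; apply/integrableP; split.
    by apply/measurable_EFinP; exact: measurable_abs_powR.
  move: h; case: (\int[mu]_(x in Omega) _)%E => [r _|/=|//]; first exact: ltry.
  by rewrite invr_eq0 gt_eqF.
move=> [mu2 /integrableP[_ i]]; apply/andP; split.
  by apply/mem_set/(measurable_restrictT u mO).
rewrite inE /= /finite_norm unlock e; apply: poweR_lty; exact: i.
Qed.

End Lp_pint.

Section test_functions.
Context (R : realType) (d : nat) (Omega : set 'rV[R]_d).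
Implicit Types (psi u : 'rV[R]_d -> R) (x h : 'rV[R]_d).

Lemma test_function_out psi x : test_function Omega psi -> ~ Omega x ->
  psi x = 0.
Proof.
move=> [_ _ sub] Ox; apply: contrapT => /eqP px; apply: Ox; apply: sub.
exact: subset_closure.
Qed.

Lemma pderive_out psi x i : ~ closure [set x | psi x != 0] x -> pderive i psi x = 0.
Proof.
move=> Cx; rewrite /pderive.
rewrite -(@near_eq_derive _ _ _ (cst 0)); first exact: derive_cst.
have : nbhs x (~` closure [set x | psi x != 0]).
  by apply: open_nbhs_nbhs; split => //; exact/closed_openC/closed_closure.
apply: filterS => y Cy /=; apply/esym/eqP; apply: contrapT => /negP py.
by apply: Cy; exact: subset_closure.
Qed.

Lemma test_function_bounded psi : test_function Omega psi ->
  exists M, 0 <= M /\ forall x, `|psi x| <= M /\ forall i, `|pderive i psi x| <= M.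
Proof.
move=> [sm cp _]; set C := closure _ in cp.
have bnd (f : 'rV[R]_d -> R) : continuous f -> (forall x, ~ C x -> f x = 0) ->
    exists M, forall x, `|f x| <= M.
  move=> cf f0.
  have cfC : compact (f @` C).
    by apply: continuous_compact cp; exact: continuous_subspaceT.
  have [M [_ hM]] := compact_bounded cfC.
  exists (Num.max 0 (M + 1)) => x; have [Cx|/f0 ->] := pselect (C x).
    by rewrite le_max (hM (M + 1)) ?orbT ?ltrDl//; exists x.
  by rewrite normr0 le_max lexx.
have [M0 h0] : exists M, forall x, `|psi x| <= M.
  apply: bnd; first exact: (sm [::]).1.
  move=> x Cx; apply: contrapT => /eqP px; apply: Cx.
  exact: subset_closure.
have /choice[M hM] i : exists M, forall x, `|pderive i psi x| <= M.
  by apply: bnd; [exact: (sm [:: i]).1|move=> x; exact: pderive_out].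
have M00 : 0 <= M0 by apply: le_trans (h0 0).
exists (M0 + \sum_i `|M i|); split; first by rewrite addr_ge0// sumr_ge0.
move=> x; split; first by apply: le_trans (h0 x) _; rewrite lerDl sumr_ge0.
move=> i; apply: le_trans (hM i x) _; rewrite (bigD1 i)//= addrCA.
apply: le_trans (ler_norm _) _; rewrite lerDl addr_ge0// sumr_ge0//.
Qed.

Lemma measurable_test_function psi : test_function Omega psi ->
  measurable_fun setT psi.
Proof. by move=> [sm _ _]; apply: continuous_measurable_rV; exact: (sm [::]).1. Qed.

Lemma measurable_pderive psi i : test_function Omega psi ->
  measurable_fun setT (pderive i psi).
Proof. by move=> [sm _ _]; apply: continuous_measurable_rV; exact: (sm [:: i]).1. Qed.

(** The fundamental theorem of calculus along the segment from x to x - h. The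
indicator of [0, 1] under the integral over the whole line allows Fubini's
theorem on a product of full spaces. *)
Lemma line_integral u x h : flat_algebra u ->
  \int[lebesgue_measure]_t
    (\1_(`[0, 1]%classic : set R) t * \sum_i h ord0 i * pderive i u (x - t *: h)) =
  u x - u (x - h).
Proof.
move=> fu.
pose F (t : R) := u (x - t *: h).
pose K (y : 'rV[R]_d) := \sum_i h ord0 i * pderive i u y.
have dF (t : R) : is_derive t (1 : R) F (- K (x - t *: h)).
  have [dv vE] := flat_algebra_is_derive (x - t *: h) (- h) fu.
  have -> : - K (x - t *: h) = 'D_(- h) u (x - t *: h).
    by rewrite vE -sumrN; apply: eq_bigr => i _; rewrite mxE mulNr.
  have e : (fun s : R => s^-1 *: ((F \o shift t) (s *: (1 : R)) - F t)) =
      (fun s : R => s^-1 *: ((u \o shift (x - t *: h)) (s *: - h) - u (x - t *: h))).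
    apply/funext => s; rewrite /F /= [s%:A]mulr1; congr (_ *: (u _ - _)).
    by rewrite scalerDl scalerN opprD addrCA.
  by apply: DeriveDef; rewrite /derivable /derive e.
have cline : continuous (fun t : R => x - t *: h).
  move=> t; apply: (@continuousB _ _ _ (fun=> x) (fun t : R => t *: h)).
    exact: cst_continuous.
  exact: scalel_continuous.
have cK : continuous K.
  have fK (r : seq 'I_d) :
      flat_algebra (fun y => \sum_(i <- r) h ord0 i * pderive i u y).
    elim: r => [|i r IH].
      by under eq_fun do rewrite big_nil; exact: flat_cst.
    under eq_fun do rewrite big_cons; apply: flat_add => //.
    by apply: flat_mul; [exact: flat_cst|exact: flat_algebra_pderive].
  exact: continuous_flat_algebra (fK _).
have cKl : continuous (fun t : R => - K (x - t *: h)).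
  move=> t; apply: (@continuousN _ _ _ (fun t : R => K (x - t *: h))).
  exact: (@continuous_comp _ _ _ (fun t : R => x - t *: h) K _ (cline t) (cK _)).
have H : (\int[lebesgue_measure]_(t in `[0%R, 1%R]) (- K (x - t *: h))%:E =
    (F 1)%:E - (F 0)%:E)%E.
  apply: continuous_FTC2 => //.
  - exact: continuous_subspaceT.
  - split; first by move=> t _; have [] := dF t.
    + apply: cvg_at_right_filter; have [/derivable1_diffP/differentiable_continuous] := dF 0.
      by move=> h0 _; exact: h0.
    + apply: cvg_at_left_filter; have [/derivable1_diffP/differentiable_continuous] := dF 1.
      by move=> h0 _; exact: h0.
  - by move=> t _; rewrite derive1E; have [_ ->] := dF t.
transitivity (- \int[lebesgue_measure]_(t in `[0%R, 1%R]) (- K (x - t *: h))).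
  rewrite -mulN1r -RintegralZl//; last first.
    apply: continuous_compact_integrable; first exact: segment_compact.
    exact: continuous_subspaceT.
  rewrite [RHS]Rintegral_mkcond; apply: eq_Rintegral => t _.
  rewrite patchE indicE; case: (t \in _); last by rewrite mul0r.
  by rewrite mul1r mulN1r opprK.
by rewrite /Rintegral H /= opprB /F scale0r scale1r subr0.
Qed.

End test_functions.

(** * Weak gradients and integration along segments *)

Lemma convex_segment (R : realType) (d : nat) (Omega : set 'rV[R]_d) x h (t : R) :
  convex_set Omega -> Omega x -> Omega (x + h) -> 0 <= t <= 1 ->
  Omega (x + t *: h).
Proof.
move=> cO Ox Oxh t01.
have := cO (x + h) x (Itv01 (andP t01).1 (andP t01).2) (mem_set Oxh) (mem_set Ox).
move=> /set_mem; congr (Omega _).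
rewrite [LHS](_ : _ = t *: (x + h) + (1 - t) *: x)//.
by rewrite scalerDr scalerBl scale1r [LHS]addrC addrA subrK.
Qed.

Lemma pderive_shift (R : realType) (d : nat) (u : 'rV[R]_d -> R) (k x : 'rV[R]_d) i :
  pderive i (fun y => u (y - k)) x = pderive i u (x - k).
Proof.
rewrite /pderive /derive; set g1 := fun s => s^-1 *: _; set g2 := fun s => s^-1 *: _.
suff -> : g1 = g2 by [].
by apply/funext => s; rewrite /g1 /g2 /= addrA.
Qed.

Lemma ae_eq_Rintegral d (T : measurableType d) (R : realType)
    (m : {measure set T -> \bar R}) (D : set T) (u v : T -> R) :
  measurable D -> measurable_fun D u -> measurable_fun D v ->
  {ae m, forall x, D x -> u x = v x} ->
  \int[m]_(x in D) u x = \int[m]_(x in D) v x.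
Proof.
move=> mD mu mv uv; congr fine; apply: ae_eq_integral => //.
- exact/measurable_EFinP.
- exact/measurable_EFinP.
- by apply: filterS uv => x h Dx; rewrite h.
Qed.

Section lines.
Context (R : realType) (d : nat).
Local Notation mu := (@lebesgue_rV R d).
Local Notation lam := (@lebesgue_measure R).
Variable h : 'rV[R]_d.

(** The indicator of [0, 1] as a real-valued factor, which turns integrals over
[0, 1] into integrals over the whole line. *)
Definition unit01 (t : R) : R := \1_(`[0, 1]%classic : set R) t.
Local Notation I := unit01.

Lemma integrable_unit01_fun : lam.-integrable setT (EFin \o I).
Proof.
exact: integrable_indic_itv.
Qed.

Lemma unit01_ge0 t : 0 <= I t. Proof. by rewrite /unit01 indicE. Qed.

Lemma measurable_unit01 : measurable_fun setT I. Proof. exact: measurable_indic. Qed.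

Lemma measurable_line (s : R) : measurable_fun setT
  (fun xt : 'rV[R]_d * R => xt.1 + (s * xt.2) *: h).
Proof.
apply: measurable_fun_mxP => i j; under eq_fun do rewrite !mxE.
apply: measurable_funD.
  exact: (measurableT_comp (@measurable_coord R 1 d i j) measurable_fst).
by apply: measurable_funM => //; apply: measurable_funM.
Qed.

Lemma measurable_ray (x : 'rV[R]_d) : measurable_fun setT (fun t : R => x - t *: h).
Proof.
apply: measurable_fun_mxP => i j; under eq_fun do rewrite !mxE.
apply: measurable_funD => //; apply: measurableT_comp => //.
exact: measurable_funM.
Qed.

(** By Tonelli's theorem: for fixed t the factor v is at most M, and translation
invariance makes the integral of |u (x + s t h)| over x independent of t. *)
Lemma integrable_line_product (u v : 'rV[R]_d -> R) (M s s' : R) :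
  mu.-integrable setT (EFin \o u) ->
  measurable_fun setT v -> (forall x, `|v x| <= M) ->
  (mu \x lam)%E.-integrable setT (EFin \o (fun xt : 'rV[R]_d * R =>
     I xt.2 * (u (xt.1 + (s * xt.2) *: h) * v (xt.1 + (s' * xt.2) *: h)))).
Proof.
move=> ui mv vM.
have mu1 := integrable_measurable ui.
have mF : measurable_fun setT (fun xt : 'rV[R]_d * R =>
     I xt.2 * (u (xt.1 + (s * xt.2) *: h) * v (xt.1 + (s' * xt.2) *: h))).
  apply: measurable_funM; first exact: (measurableT_comp measurable_unit01 measurable_snd).
  apply: measurable_funM; first exact: (measurableT_comp mu1 (measurable_line s)).
  exact: (measurableT_comp mv (measurable_line s')).
have M0 : 0 <= M by exact: le_trans (vM 0).
have mFE := (measurable_EFinP _ _).2 mF.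
apply: (proj2 (@integrable21ltyP _ _ _ _ R mu lam _ mFE)).
pose N := (\int[mu]_x `|(u x)%:E|)%E.
have N0 : (0 <= N)%E by exact: integral_ge0.
have Noo : (N < +oo)%E by have /integrableP[] := ui.
apply: (@le_lt_trans _ _ (\int[lam]_t ((I t)%:E * (M%:E * N)))%E).
  apply: ge0_le_integral => //.
  - by move=> t _; exact: integral_ge0.
  - apply: (@measurable_fun_fubini_tonelli_G _ _ _ _ R mu
      (abse \o (EFin \o (fun xt : 'rV[R]_d * R =>
     I xt.2 * (u (xt.1 + (s * xt.2) *: h) * v (xt.1 + (s' * xt.2) *: h)))))).
      exact: (measurableT_comp (@abse_measurable _ _) mFE).
    by move=> xt; exact: abse_ge0.
  - apply: emeasurable_funM => //.
    by apply/measurable_EFinP; exact: measurable_unit01.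
  - move=> t _ /=.
    have ma : measurable_fun setT (fun x : 'rV[R]_d => `|(u (x + (s * t) *: h)%R)%:E|)%E.
      apply: measurableT_comp => //; apply/measurable_EFinP.
      exact: (measurableT_comp mu1 (measurable_addrV _)).
    rewrite -[N](@ge0_integral_shift _ _ (fun x => `|(u x)%:E|)%E ((s * t) *: h))//;
      last by apply: measurableT_comp => //; exact/measurable_EFinP.
    rewrite -!ge0_integralZl//.
    + apply: ge0_le_integral => //.
      * exact: (measurableT_comp (@abse_measurable _ _)
          (measurableT_comp mFE (pair2_measurable t))).
      * by apply: emeasurable_funM => //; exact: emeasurable_funM.
      move=> x _; rewrite -!EFinM lee_fin !normrM (ger0_norm (unit01_ge0 t)).
      by rewrite ler_wpM2l// mulrC ler_wpM2r.
    + by apply: emeasurable_funM.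
    + by move=> x _; rewrite mule_ge0// lee_fin.
    + by rewrite lee_fin unit01_ge0.
have -> : (M%:E * N)%E = (M * fine N)%:E.
  by rewrite EFinM fineK// ge0_fin_numE.
have /integrableP[_] := RintegrableZl measurableT (M * fine N) integrable_unit01_fun.
apply: le_lt_trans; rewrite le_eqVlt; apply/orP; left; apply/eqP.
apply: eq_integral => t _.
rewrite -EFinM [(EFin \o _) t]/= [abse _]/= ger0_norm ?mulr_ge0 ?unit01_ge0 ?fine_ge0//.
by rewrite mulrC.
Qed.

End lines.

Section unit_interval.
Context (R : realType).
Local Notation lam := (@lebesgue_measure R).
Implicit Type k : measurableTypeR R -> R.

(** The ascription selects the measurable structure that lebesgue_measure expects. *)
Definition itv01 : set (measurableTypeR R) := `[0%R, 1%R]%classic.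

Lemma measurable_itv01 : measurable itv01.
Proof. exact: measurable_itv. Qed.

Lemma lebesgue_itv01 : lam itv01 = 1%E.
Proof. by rewrite /itv01 lebesgue_measure_itv/= lte01 oppr0 adde0. Qed.

Lemma unit01_patch k : (fun t => unit01 t * k t) = k \_ itv01.
Proof.
apply/funext => t; rewrite patchE /unit01 indicE -/itv01.
by case: (t \in _); rewrite ?mul1r ?mul0r.
Qed.

Lemma Rintegral_unit01 k :
  \int[lam]_t (unit01 t * k t) = \int[lam]_(t in itv01) k t.
Proof. by rewrite [RHS]Rintegral_mkcond -unit01_patch. Qed.

Lemma integrable_unit01 k :
  lam.-integrable setT (EFin \o (fun t => unit01 t * k t)) <->
  lam.-integrable itv01 (EFin \o k).
Proof.
rewrite unit01_patch -restrict_EFin; apply: iff_sym.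
exact: (integrable_mkcond _ measurable_itv01).
Qed.

Lemma integral_unit01 : \int[lam]_t unit01 t = 1.
Proof.
have := Rintegral_unit01 (fun=> 1).
rewrite (Rintegral_cst _ measurable_itv01).
rewrite [X in fine X](_ : _ = 1%E) ?mulr1; last exact: lebesgue_itv01.
move=> <-.
by apply: eq_Rintegral => t _; rewrite mulr1.
Qed.

End unit_interval.

Section translation.
Context (R : realType) (d : nat) (Omega : set 'rV[R]_d).
Local Notation mu := (@lebesgue_rV R d).
Local Notation lam := (@lebesgue_measure R).
Hypotheses (oO : open Omega) (cO : convex_set Omega) (fO : (mu Omega < +oo)%E).
Variables (p : R) (phi : 'rV[R]_d -> R) (g : 'rV[R]_d -> 'rV[R]_d).
Hypotheses (p1 : 1 <= p) (W : W1 Omega p phi g).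

Let mO : measurable Omega. Proof. exact: open_measurable_rV. Qed.
Let p0 : 0 < p. Proof. exact: lt_le_trans p1. Qed.

Let phi0 := phi \_ Omega.
Let G i := (fun x => g x ord0 i) \_ Omega.

Let integrable_patch u : Lp Omega p u -> mu.-integrable setT (EFin \o (u \_ Omega)).
Proof.
move=> /(LpP mO _ p0) /(pint_integrable mO fO p1) /(integrable_mkcond _ mO).
by rewrite restrict_EFin.
Qed.

Let phi0_int : mu.-integrable setT (EFin \o phi0).
Proof. by apply: integrable_patch; have [] := W. Qed.

Let G_int i : mu.-integrable setT (EFin \o G i).
Proof. by apply: integrable_patch; have [_ + _] := W; apply. Qed.

Let weakE psi i : test_function Omega psi ->
  \int[mu]_x (phi0 x * pderive i psi x) = - \int[mu]_x (G i x * psi x).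
Proof.
move=> tpsi; have [_ _ /(_ psi tpsi i)] := W.
rewrite Rintegral_mkcond [in X in _ = - X]Rintegral_mkcond.
have e (u v : 'rV[R]_d -> R) : (fun x => u x * v x) \_ Omega =
    (fun x => (u \_ Omega) x * v x).
  by apply/funext => x; rewrite !patchE; case: ifPn => //; rewrite mul0r.
by rewrite !e.
Qed.

Variable h : 'rV[R]_d.

Let Gh x := \sum_i h ord0 i * G i x.
Local Notation I := (@unit01 R).

Definition line_mean x := \int[lam]_t (I t * Gh (x + t *: h)).

Let Gh_int : mu.-integrable setT (EFin \o Gh).
Proof.
have H := @integrable_sum _ _ _ mu setT measurableT _ (index_enum 'I_d) xpredT
  (fun i x => (h ord0 i * G i x)%:E)
  (fun i _ => RintegrableZl measurableT (h ord0 i) (G_int i)).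
by apply: eq_integrable H => //= x _; rewrite sumEFin.
Qed.

Let line_prod (psi : 'rV[R]_d -> R) M : measurable_fun setT psi ->
  (forall x, `|psi x| <= M) ->
  (mu \x lam)%E.-integrable setT (EFin \o (fun xt : 'rV[R]_d * R =>
     I xt.2 * (Gh (xt.1 + xt.2 *: h) * psi xt.1))).
Proof.
move=> mpsi psiM; have := integrable_line_product h 1 0 Gh_int mpsi psiM.
congr (integrable _ _ (_ \o _)); apply/funext => -[x t] /=.
by rewrite mul1r mul0r scale0r addr0.
Qed.

Let line_prod1 : (mu \x lam)%E.-integrable setT (EFin \o (fun xt : 'rV[R]_d * R =>
     I xt.2 * Gh (xt.1 + xt.2 *: h))).
Proof.
have m1 : measurable_fun setT (fun _ : 'rV[R]_d => 1 : R) by exact: measurable_cst.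
have := @line_prod (fun=> 1) 1 m1.
have b1 (x : 'rV[R]_d) : `|1 : R| <= 1 by rewrite normr1.
move=> /(_ b1); congr (integrable _ _ (_ \o _)).
by apply/funext => xt /=; rewrite mulr1.
Qed.

Lemma integrable_line_mean : mu.-integrable setT (EFin \o line_mean).
Proof.
exact: (integrable_fubini1 line_prod1).
Qed.

Let bounded_int (u v : 'rV[R]_d -> R) M : mu.-integrable setT (EFin \o u) ->
  measurable_fun setT v -> (forall x, `|v x| <= M) ->
  mu.-integrable setT (EFin \o (fun x => u x * v x)).
Proof.
move=> ui mv vM.
have ui' := RintegrableZl measurableT M (integrable_norm ui).
apply: (integrable_le measurableT _ ui').
  by apply: measurable_funM => //; exact: integrable_measurable ui.
by move=> x _ /=; rewrite normrM mulrC ler_wpM2r.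
Qed.

Section bump_test.
Variables (a b : 'rV[R]_d) (c : R).
Hypotheses (c0 : 0 < c) (abU : forall x, cbox a b x -> Omega x /\ Omega (x + h)).

Let psi := bump c a b.
Let K (y : 'rV[R]_d) := \sum_i h ord0 i * pderive i psi y.

Let psiM x : `|psi x| <= 1.
Proof. by rewrite ger0_norm ?bump_ge0// bump_le1// ltW. Qed.

Let flat_psi : flat_algebra psi. Proof. exact: flat_algebra_bump. Qed.

Let mpsi : measurable_fun setT psi.
Proof. exact: continuous_measurable_rV (continuous_flat_algebra flat_psi). Qed.

Let tpsi t : 0 <= t <= 1 -> test_function Omega (fun x => psi (x - t *: h)).
Proof.
(* The box slides along h from Omega to Omega, and stays inside by convexity. *)
move=> t01; rewrite (_ : (fun x => _) = bump c (a + t *: h) (b + t *: h)).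
  apply: test_function_bump => // x xab.
  have xab' : cbox a b (x - t *: h).
    by move=> i; have := xab i; rewrite !mxE lerBrDr lerBlDr.
  have [Ox Oxh] := abU xab'.
  by have := convex_segment cO Ox Oxh t01; rewrite subrK.
by apply/funext => x; exact: bump_shift.
Qed.

Let K_bounded : exists M, forall y, `|K y| <= M.
Proof.
have t0 := tpsi (_ : 0 <= 0 <= 1).
have {t0} := t0 (introT andP (conj (lexx 0) ler01)).
under eq_fun do rewrite scale0r subr0.
move=> /test_function_bounded[M [M0 hM]].
exists (\sum_i `|h ord0 i| * M) => y.
apply: le_trans (ler_norm_sum _ _ _) _; apply: ler_sum => i _.
by rewrite normrM ler_wpM2l//; exact: (hM y).2.
Qed.

Let mK : measurable_fun setT K.
Proof.
apply: measurable_sum => i; apply: measurable_funM => //.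
exact: (continuous_measurable_rV (continuous_flat_algebra (flat_algebra_pderive i flat_psi))).
Qed.

Let slice (t : R) : 0 <= t <= 1 ->
  \int[mu]_x (Gh (x + t *: h) * psi x) = - \int[mu]_x (phi0 x * K (x - t *: h)).
Proof.
move=> t01; have tt := tpsi t01.
have mp : measurable_fun setT (fun x : 'rV[R]_d => psi (x - t *: h)).
  exact: (measurableT_comp mpsi (measurable_addrV _)).
have pM x : `|psi (x - t *: h)| <= 1 by exact: psiM.
have GP i : mu.-integrable setT (EFin \o (fun x => G i x * psi (x - t *: h))).
  exact: (bounded_int (G_int i) mp pM).
have [M [M0 hM]] := test_function_bounded tt.
have PP i : mu.-integrable setT
    (EFin \o (fun x => phi0 x * pderive i (fun x => psi (x - t *: h)) x)).
  apply: (bounded_int phi0_int (measurable_pderive i tt)) => x.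
  exact: (hM x).2.
have -> : \int[mu]_x (Gh (x + t *: h) * psi x) = \int[mu]_x (Gh x * psi (x - t *: h)).
  have := Rintegral_shift (t *: h) (bounded_int Gh_int mp pM).
  by move=> <-; apply: eq_Rintegral => x _; rewrite addrK.
transitivity (\sum_i h ord0 i * \int[mu]_x (G i x * psi (x - t *: h))).
  under [RHS]eq_bigr => i _ do rewrite -RintegralZl//.
  rewrite -(@Rintegral_sum _ _ _ mu setT measurableT _
    (fun i x => h ord0 i * (G i x * psi (x - t *: h)))).
    apply: eq_Rintegral => x _; rewrite mulr_suml; apply: eq_bigr => i _.
    by rewrite mulrA.
  by move=> i; exact: (RintegrableZl measurableT).
transitivity (- \sum_i h ord0 i * \int[mu]_x
    (phi0 x * pderive i (fun x => psi (x - t *: h)) x)).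
  rewrite -sumrN; apply: eq_bigr => i _.
  by rewrite (weakE i tt) mulrN opprK.
congr (- _).
under eq_bigr => i _ do rewrite -RintegralZl//.
rewrite -(@Rintegral_sum _ _ _ mu setT measurableT _
  (fun i x => h ord0 i * (phi0 x * pderive i (fun x => psi (x - t *: h)) x))).
  apply: eq_Rintegral => x _; rewrite mulr_sumr; apply: eq_bigr => i _.
  by rewrite pderive_shift mulrCA.
by move=> i; exact: (RintegrableZl measurableT).
Qed.

(** The identity of translation_line_mean, tested against a bump function psi whose
box and its translate by h are in Omega. By Fubini's theorem and the weak
gradient, the integral of line_mean times psi is minus the integral over t and x
of phi x times the derivative of psi at x - t h along h. The integral over t is
psi x - psi (x - h), and a translation moves this difference onto phi. *)
Lemma bump_line_mean :
  \int[mu]_x ((phi0 (x + h) - phi0 x - line_mean x) * psi x) = 0.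
Proof.
have [M KM] := K_bounded.
have i1 := bounded_int (integrable_shift h phi0_int) mpsi psiM.
have i2 := bounded_int phi0_int mpsi psiM.
have i3 := bounded_int integrable_line_mean mpsi psiM.
have LP := line_prod mpsi psiM.
have e1 : \int[mu]_x (line_mean x * psi x) =
    \int[mu]_x \int[lam]_t (I t * (Gh (x + t *: h) * psi x)).
  apply: ae_eq_Rintegral => //.
  - exact: integrable_measurable i3.
  - exact: integrable_measurable (integrable_fubini1 LP).
  have := ae_integrable1 line_prod1; apply: filterS => x xi _.
  rewrite /line_mean mulrC -RintegralZl//.
  by apply: eq_Rintegral => t _; rewrite mulrCA (mulrC (psi x)).
have PK := integrable_line_product h 0 (-1) phi0_int mK KM.
have e2 : \int[mu]_x (line_mean x * psi x) =
   - \int[mu]_x (phi0 x * (psi x - psi (x - h))).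
  rewrite e1 (Fubini_Rintegral LP) /=.
  transitivity (- \int[lam]_t \int[mu]_x
     (I t * (phi0 (x + (0 * t) *: h) * K (x + (-1 * t) *: h)))).
    rewrite -[RHS]mulN1r -RintegralZl//; last exact: (integrable_fubini2 PK).
    apply: eq_Rintegral => t _; rewrite /unit01 indicE.
    have [/set_mem|_] := boolP (t \in _); last first.
      have z (F : 'rV[R]_d -> R) : \int[mu]_x (false%:R * F x) = 0.
        under eq_Rintegral do rewrite mul0r.
        by rewrite Rintegral_cst// mul0r.
      by rewrite !z mulr0.
    rewrite /= in_itv/= => t01.
    under eq_Rintegral do rewrite mul1r.
    rewrite slice// [RHS]mulN1r; congr (- _); apply: eq_Rintegral => x _.
    by rewrite mul1r mul0r scale0r addr0 mulN1r scaleNr.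
  congr (- _); rewrite -(Fubini_Rintegral PK) /=; apply: eq_Rintegral => x _.
  have KI : lam.-integrable setT (EFin \o (fun t => I t * K (x - t *: h))).
    have MI := RintegrableZl measurableT M (@integrable_unit01_fun R).
    apply: (integrable_le measurableT _ MI).
      exact: (measurable_funM (@measurable_unit01 R) (measurableT_comp mK (measurable_ray h x))).
    move=> t _; rewrite normrM (ger0_norm (unit01_ge0 t)) mulrC.
    by apply: ler_wpM2r; [exact: unit01_ge0|exact: KM].
  have L : \int[lam]_t (I t * K (x - t *: h)) = psi x - psi (x - h).
    exact: line_integral.
  rewrite -L -(RintegralZl (phi0 x) measurableT KI).
  apply: eq_Rintegral => t _; rewrite mulrCA; congr (phi0 _ * (_ * K _)).
    by rewrite mul0r scale0r addr0.
  by rewrite mulN1r scaleNr.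
have mph : measurable_fun setT (fun x : 'rV[R]_d => psi (x - h)).
  exact: (measurableT_comp mpsi (measurable_addrV _)).
have i4 := bounded_int phi0_int mph (fun x => psiM (x - h)).
have e3 : \int[mu]_x (phi0 (x + h) * psi x) = \int[mu]_x (phi0 x * psi (x - h)).
  rewrite -(Rintegral_shift h i4).
  by apply: eq_Rintegral => x _; rewrite addrK.
have e4 : \int[mu]_x (phi0 x * (psi x - psi (x - h))) =
  \int[mu]_x (phi0 x * psi x) - \int[mu]_x (phi0 x * psi (x - h)).
  by rewrite -(RintegralB measurableT i2 i4); apply: eq_Rintegral => x _;
    rewrite mulrBr.
under eq_Rintegral do rewrite !mulrBl.
have i12 := RintegrableB measurableT i1 i2.
rewrite (RintegralB measurableT i12 i3) (RintegralB measurableT i1 i2).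
rewrite e2 e3 e4.
move: (\int[mu]_x (phi0 x * psi x)) (\int[mu]_x (phi0 x * psi (x - h))) => A B.
by ring.
Qed.

End bump_test.

(** For a fixed h. By bump_line_mean the difference of the two sides integrates to 0
against all bump functions on the open set where x and x + h are in Omega, hence
over all boxes in it. *)
Lemma translation_line_mean :
  {ae mu, forall x, Omega x -> Omega (x + h) -> phi (x + h) - phi x = line_mean x}.
Proof.
pose w x := phi0 (x + h) - phi0 x - line_mean x.
have wi : mu.-integrable setT (EFin \o w).
  apply: (RintegrableB measurableT) => //; last exact: integrable_line_mean.
  by apply: (RintegrableB measurableT) => //; exact: (integrable_shift h phi0_int).
pose U := [set x | Omega x /\ Omega (x + h)].
have oU : open U.
  apply: openI => //; have /continuousP : continuous (fun x : 'rV[R]_d => x + h).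
    move=> x; apply: (@continuousD _ _ _ id (fun=> h)); first exact: cvg_id.
    exact: cst_continuous.
  exact.
have : {ae mu, forall x, U x -> w x = 0}.
  apply: box_integrals_eq0_open => // a b abU.
  have wiab : mu.-integrable (obox a b) (EFin \o w).
    by apply: integrableS wi => //; exact: measurable_obox.
  rewrite -EFin_Rintegral//; last exact: measurable_obox.
  have mb n : measurable_fun setT (bump n.+1%:R^-1 a b : _ -> R).
    apply: continuous_measurable_rV; apply: continuous_flat_algebra.
    exact: flat_algebra_bump.
  have [||||_ cv] := @dominated_cvg_Rintegral _ _ _ mu setT
    (fun n x => w x * bump n.+1%:R^-1 a b x) (fun x => w x * \1_(obox a b) x)
    (fun x => `|w x|) measurableT.
  - move=> n; apply: measurable_funM => //; exact: integrable_measurable wi.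
  - by move=> x _; apply: cvgM; [exact: cvg_cst|exact: cvg_bump].
  - exact: integrable_norm wi.
  - move=> n x _; rewrite normrM ler_piMr// ger0_norm ?bump_ge0//.
    exact: bump_le1.
  have e : \int[mu]_x (w x * \1_(obox a b) x) = 0.
    apply: (cvg_unique _ cv) => //.
    rewrite (_ : (fun n : nat => _) = cst 0); first exact: cvg_cst.
    by apply/funext => n; apply: bump_line_mean => // x /abU.
  congr EFin; rewrite Rintegral_mkcond -[RHS]e; apply: eq_Rintegral => x _.
  by rewrite patchE indicE; case: ifPn => _; rewrite ?mulr1 ?mulr0.
apply: filterS => x Ux Ox Oxh; have := Ux (conj Ox Oxh).
rewrite /w /phi0 !patchE !mem_set// => /eqP; rewrite subr_eq0 => /eqP.
exact.
Qed.

End translation.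

(** * The Poincare inequality *)

Section vector_Lp.
Context (R : realType) (d : nat) (Omega : set 'rV[R]_d).
Local Notation mu := (@lebesgue_rV R d).
Hypothesis mO : measurable Omega.

Lemma measurable_enorm (D : set 'rV[R]_d) (v : 'rV[R]_d -> 'rV[R]_d) :
  (forall i, measurable_fun D (fun x => v x ord0 i)) ->
  measurable_fun D (fun x => enorm (v x)).
Proof.
move=> mv.
have mdot : measurable_fun D (fun x => dotrV (v x) (v x)).
  by apply: measurable_sum => i; apply: measurable_funM.
rewrite (_ : (fun x => _) = (fun x => dotrV (v x) (v x) `^ 2^-1)).
  exact: (measurableT_comp (measurable_powR 2^-1) mdot).
by apply/funext => x; rewrite powR12_sqrt ?dotrV_ge0.
Qed.

(** The Euclidean norm is between each |x_i| and their sum. *)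
Lemma pint_enorm (p : R) (v : 'rV[R]_d -> 'rV[R]_d) : 0 < p ->
  Lp_vec Omega p v <->
  (forall i, measurable_fun Omega (fun x => v x ord0 i)) /\
  pint mu Omega p (fun x => enorm (v x)).
Proof.
move=> p0; split.
  move=> vp; have vi i := (LpP mO (fun x => v x ord0 i) p0).1 (vp i).
  split; first by move=> i; exact: (vi i).1.
  apply: (pint_le mO (ltW p0) _ (pint_sum mO p0 (fun i => pint_abs mO (vi i)))).
    by apply: measurable_enorm => i; exact: (vi i).1.
  move=> x Ox; rewrite ger0_norm ?enorm_ge0// ger0_norm ?sumr_ge0//.
  exact: enorm_le_sum.
move=> [mv ep] i; apply/(LpP mO _ p0).
apply: (pint_le mO (ltW p0) (mv i) ep) => x Ox.
by rewrite [X in _ <= X]ger0_norm ?enorm_ge0// coord_le_enorm.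
Qed.

End vector_Lp.

Section poincare.
Context (R : realType) (d : nat) (Omega : set 'rV[R]_d).
Local Notation mu := (@lebesgue_rV R d).
Local Notation lam := (@lebesgue_measure R).
Hypotheses (oO : open Omega) (cO : convex_set Omega) (bO : bounded_set Omega).
Hypothesis O0 : Omega !=set0.

Let mO : measurable Omega. Proof. exact: open_measurable_rV. Qed.

Lemma bounded_lebesgue_lty : (mu Omega < +oo)%E.
Proof.
have [M OM] := bounded_cbox bO.
apply: le_lt_trans (lebesgue_cbox_lty (const_mx (- M)) (const_mx M)).
by apply: le_measure OM; rewrite inE//; exact: measurable_cbox.
Qed.
Local Notation fO := bounded_lebesgue_lty.

Lemma open_lebesgue_gt0 : 0 < fine (mu Omega).
Proof.
have [x Ox] := O0.
have [a [b [xab abO]]] := nbhs_rat_box (open_nbhs_nbhs (conj oO Ox)).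
apply: fine_gt0; rewrite fO andbT.
apply: (@lt_le_trans _ _ (mu (obox (map_mx (@ratr R) a) (map_mx (@ratr R) b)))).
  by apply: lebesgue_obox_gt0 => i; have /andP[] := xab i; exact: lt_trans.
apply: le_measure; rewrite ?inE//; first exact: measurable_obox.
exact: subset_trans (@obox_cbox _ _ _ _) abO.
Qed.

Variables (p : R) (p1 : 1 < p).
Let p0 : 0 < p. Proof. exact: lt_trans p1. Qed.

Section one_function.
Variables (phi : 'rV[R]_d -> R) (g : 'rV[R]_d -> 'rV[R]_d).
Hypothesis W : W1 Omega p phi g.

Let E0 x := ((fun x => enorm (g x)) \_ Omega) x `^ p.
Let phi0 := phi \_ Omega.
Let pn := pnormX mu Omega p (fun x => enorm (g x)).

Let gp : (forall i, measurable_fun Omega (fun x => g x ord0 i)) /\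
  pint mu Omega p (fun x => enorm (g x)).
Proof. by apply/(pint_enorm mO g p0); have [] := W. Qed.

Let E0E : E0 = (fun x => `|enorm (g x)| `^ p) \_ Omega.
Proof.
apply/funext => x; rewrite /E0 !patchE; case: ifPn => _.
  by rewrite ger0_norm ?enorm_ge0.
by rewrite powR0 ?gt_eqF.
Qed.

Let E0_int : mu.-integrable setT (EFin \o E0).
Proof.
have := gp.2.2; move/(integrable_mkcond _ mO).
by rewrite restrict_EFin E0E.
Qed.

Let E0_integral : \int[mu]_x E0 x = pn.
Proof. by rewrite E0E -Rintegral_mkcond. Qed.

Let mphi0 : measurable_fun setT phi0.
Proof.
by apply/(measurable_restrictT _ mO); have [/(LpP mO _ p0)[]] := W.
Qed.

Let D h x := (\1_Omega x : R) * (\1_Omega (x + h) * `|phi0 (x + h) - phi0 x| `^ p).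

Let D_ge0 h x : 0 <= D h x.
Proof. by rewrite /D !indicE !mulr_ge0// powR_ge0. Qed.

Let line_E0_prod h : (mu \x lam)%E.-integrable setT (EFin \o (fun xt : 'rV[R]_d * R =>
     unit01 xt.2 * E0 (xt.1 + xt.2 *: h))).
Proof.
have mc : measurable_fun setT (fun _ : 'rV[R]_d => 1 : R) by exact: measurable_cst.
have b1 (x : 'rV[R]_d) : `|1 : R| <= 1 by rewrite normr1.
have := integrable_line_product h 1 1 E0_int mc b1.
congr (integrable _ _ (_ \o _)).
by apply/funext => xt /=; rewrite mulr1 mul1r.
Qed.

Let Q h x := \int[lam]_t (unit01 t * E0 (x + t *: h)).

Let Q_int h : mu.-integrable setT (EFin \o Q h).
Proof. exact: (integrable_fubini1 (line_E0_prod h)). Qed.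

Let Q_integral h : \int[mu]_x Q h x = pn.
Proof.
rewrite /Q (Fubini_Rintegral (line_E0_prod h)) /=.
transitivity (\int[lam]_t (pn * unit01 t)).
  apply: eq_Rintegral => t _.
  rewrite (RintegralZl (unit01 t) measurableT (integrable_shift (t *: h) E0_int)).
  by rewrite (Rintegral_shift (t *: h) E0_int) E0_integral mulrC.
by rewrite (RintegralZl pn measurableT (@integrable_unit01_fun R)) integral_unit01 mulr1.
Qed.

Let D_le h : {ae mu, forall x, D h x <= enorm h `^ p * Q h x}.
Proof.
have h1 := translation_line_mean oO cO fO (ltW p1) W h.
have h2 := ae_integrable1 (line_E0_prod h).
apply: filterS2 h1 h2 => x h1 h2.
have Q0 : 0 <= Q h x.
  by apply: Rintegral_ge0 => t _; rewrite mulr_ge0 ?unit01_ge0 ?powR_ge0.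
have R0 : 0 <= enorm h `^ p * Q h x by rewrite mulr_ge0 ?powR_ge0.
rewrite /D !indicE; have [/set_mem Ox|_] := boolP (x \in Omega); last by rewrite mul0r.
have [/set_mem Oxh|_] := boolP (x + h \in Omega); last by rewrite mul0r mulr0.
rewrite !mul1r /phi0 !patchE (mem_set Ox) (mem_set Oxh) (h1 Ox Oxh).
pose f (t : measurableTypeR R) :=
  \sum_i h ord0 i * ((fun x => g x ord0 i) \_ Omega) (x + t *: h).
pose e (t : measurableTypeR R) := E0 (x + t *: h).
(* On the probability space [0, 1], Jensen's inequality needs no constant. *)
have -> : line_mean Omega g h x = \int[lam]_(t in @itv01 R) f t.
  exact: Rintegral_unit01.
have m01 := @measurable_itv01 R.
have QE : Q h x = \int[lam]_(t in @itv01 R) e t by exact: Rintegral_unit01.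
have iE : lam.-integrable (@itv01 R) (EFin \o e) by exact/integrable_unit01.
have fE t : `|f t| `^ p <= enorm h `^ p * e t.
  rewrite /e /E0 /f; set y := x + t *: h; clearbody y.
  have [Oy|Oy] := boolP (y \in Omega).
    rewrite patchE Oy -powRM ?enorm_ge0//.
    apply: ge0_ler_powR; rewrite ?(ltW p0) ?nnegrE ?mulr_ge0 ?enorm_ge0//.
    under eq_bigr => i _ do rewrite patchE Oy.
    exact: dotrV_le_enorm.
  under eq_bigr => i _ do rewrite patchE (negbTE Oy) mulr0.
  by rewrite big1// normr0 powR0 ?gt_eqF// mulr_ge0 ?powR_ge0.
have mray : measurable_fun setT (fun t : R => x + t *: h).
  have := measurable_ray (- h) x.
  by congr (measurable_fun _ _); apply/funext => t; rewrite scalerN opprK.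
have mf : measurable_fun setT f.
  apply: measurable_sum => i; apply: measurable_funM => //.
  apply: (measurableT_comp _ mray).
  by apply/(measurable_restrictT _ mO); exact: gp.1.
have fp : pint lam (@itv01 R) p f.
  split; first exact: measurable_funTS.
  apply: (integrable_le m01 _ (RintegrableZl m01 (enorm h `^ p) iE)).
    by apply: measurable_abs_powR; exact: measurable_funTS.
  by move=> t _; rewrite ger0_norm ?powR_ge0//; exact: fE.
have l01 := @lebesgue_itv01 R.
have f01 : (lam (@itv01 R) < +oo)%E by rewrite l01 ltry.
have := Rintegral_powR_le m01 f01 p1 fp.
rewrite [X in fine X](_ : _ = 1%E); last exact: lebesgue_itv01.
rewrite powR1 mul1r => H.
apply: le_trans H _.
rewrite QE -(RintegralZl _ m01 iE).
apply: (le_Rintegral m01 fp.2 (RintegrableZl m01 _ iE)) => t _; exact: fE.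
Qed.

Let F (x y : 'rV[R]_d) := (\1_Omega x : R) * (\1_Omega y * `|phi0 y - phi0 x| `^ p).

Let measurable_F : measurable_fun setT (fun xy : 'rV[R]_d * 'rV[R]_d => F xy.1 xy.2).
Proof.
have mi : measurable_fun setT (\1_Omega : 'rV[R]_d -> R) by exact: measurable_indic.
apply: measurable_funM; first exact: (measurableT_comp mi measurable_fst).
apply: measurable_funM; first exact: (measurableT_comp mi measurable_snd).
apply: measurable_abs_powR => //; apply: measurable_funB.
  exact: (measurableT_comp mphi0 measurable_snd).
exact: (measurableT_comp mphi0 measurable_fst).
Qed.

Let measurable_D h : measurable_fun setT (D h).
Proof.
have mp : measurable_fun setT (fun x : 'rV[R]_d => (x, x + h)).
  by apply: measurable_fun_pair => //; exact: measurable_addrV.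
exact: (measurableT_comp measurable_F mp).
Qed.

Let D_integral h : (\int[mu]_x (D h x)%:E <= (enorm h `^ p * pn)%:E)%E.
Proof.
have i := RintegrableZl measurableT (enorm h `^ p) (Q_int h).
rewrite -(Q_integral h) -(RintegralZl _ measurableT (Q_int h)) (EFin_Rintegral measurableT i).
apply: (ae_ge0_le_integral measurableT _ _ _ (measurable_int _ i)).
- by move=> x _; rewrite lee_fin; exact: D_ge0.
- by apply/measurable_EFinP; exact: measurable_D.
- move=> x _; rewrite lee_fin; apply: mulr_ge0; first exact: powR_ge0.
  apply: Rintegral_ge0 => t _; apply: mulr_ge0; first exact: unit01_ge0.
  exact: powR_ge0.
- by apply: filterS (D_le h) => x hx _; rewrite lee_fin.
Qed.

(** After the substitution y = x + h, the inner integral is at most |h|^p times the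
integral of |grad phi|^p: apply Jensen's inequality on each segment, and
translation invariance for each t. Only the h in a box matter, since Omega is
bounded. *)
Lemma two_point_bound M : Omega `<=` cbox (const_mx (- M)) (const_mx M) ->
  (\int[mu]_x \int[mu]_y (F x y)%:E <=
   ((\sum_(i < d) (2 * M)) `^ p * pn)%R%:E *
    mu (cbox (const_mx (- (2 * M)))%R (const_mx (2 * M))%R))%E.
Proof.
move=> OM; set K := \sum_(i < d) _; set B := cbox _ _.
have mB : measurable B by exact: measurable_cbox.
have -> : (\int[mu]_x \int[mu]_y (F x y)%:E =
    \int[mu]_x \int[mu]_h (F x (h + x))%:E)%E.
  apply: eq_integral => x _; apply/esym.
  apply: (@ge0_integral_shift _ _ (fun y => (F x y)%:E) x).
    apply/measurable_EFinP.
    exact: (measurableT_comp measurable_F (pair1_measurable x)).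
  by move=> y; have := D_ge0 (y - x) x; rewrite /D addrC subrK lee_fin.
have mf : measurable_fun setT
    (fun xh : 'rV[R]_d * 'rV[R]_d => (F xh.1 (xh.2 + xh.1))%:E).
  apply/measurable_EFinP.
  have mp : measurable_fun setT
      (fun xh : 'rV[R]_d * 'rV[R]_d => (xh.1, xh.2 + xh.1)).
    apply: measurable_fun_pair; first exact: measurable_fst.
    apply: measurable_fun_mxP => i j; under eq_fun do rewrite mxE.
    apply: measurable_funD.
      exact: (measurableT_comp (@measurable_coord R 1 d i j) measurable_snd).
    exact: (measurableT_comp (@measurable_coord R 1 d i j) measurable_fst).
  exact: (measurableT_comp measurable_F mp).
have F0 x h : 0 <= F x (h + x) by have := D_ge0 h x; rewrite /D addrC.
have FT := @fubini_tonelli _ _ _ _ R mu mu _ mf (fun xh => F0 xh.1 xh.2).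
rewrite [leLHS]FT /=.
apply: (@le_trans _ _ (\int[mu]_h ((K `^ p * pn)%:E * (\1_B h)%:E))%E); last first.
  have k0 : 0 <= K `^ p * pn by apply: mulr_ge0; [exact: powR_ge0|exact: pnormX_ge0].
  move: k0; generalize (K `^ p * pn) => k k0.
  have mI : measurable_fun setT (fun h : 'rV[R]_d => (\1_B h : R)%:E).
    by apply/measurable_EFinP; exact: measurable_indic.
  have I0 (h : 'rV[R]_d) : setT h -> (0 <= (\1_B h : R)%:E)%E.
    by move=> _; rewrite lee_fin.
  have := @ge0_integralZl _ _ _ mu setT measurableT _ mI k%:E I0 k0 => ->.
  have := @integral_indic _ _ _ mu setT measurableT B mB => ->.
  by rewrite setIT.
apply: ge0_le_integral.
- exact: measurableT.
- by move=> h _; apply: integral_ge0 => x _; rewrite lee_fin; exact: F0.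
- exact: (@measurable_fun_fubini_tonelli_G _ _ _ _ R mu _ mf (fun xh => F0 xh.1 xh.2)).
- apply: emeasurable_funM; first exact: measurable_cst.
  by apply/measurable_EFinP; exact: measurable_indic.
move=> h _; rewrite indicE; have [/set_mem Bh|Bh] := boolP (h \in B).
  rewrite mule1; apply: (@le_trans _ _ (enorm h `^ p * pn)%:E).
    apply: le_trans (D_integral h); rewrite le_eqVlt; apply/orP; left; apply/eqP.
    by apply: eq_integral => x _; rewrite /D addrC.
  rewrite lee_fin; apply: ler_wpM2r; first exact: pnormX_ge0.
  have hK : enorm h <= K.
    apply: le_trans (enorm_le_sum h) _; apply: ler_sum => i _.
    by have := Bh i; rewrite !mxE ler_norml.
  apply: (ge0_ler_powR (ltW p0) _ _ hK); rewrite nnegrE; first exact: enorm_ge0.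
  exact: le_trans (enorm_ge0 h) hK.
rewrite mule0 le_eqVlt; apply/orP; left; apply/eqP.
apply: integral0_eq => x _; congr EFin; rewrite /F !indicE.
have [/set_mem Ox|_] := boolP (x \in Omega); last by rewrite mul0r.
have [/set_mem Oxh|_] := boolP (h + x \in Omega); last by rewrite mul0r mulr0.
(* Both points are in the box of half side M, so their difference h is in that of
   half side 2 M. *)
move/negP : Bh; case; apply/mem_set => i.
have := OM _ Ox i; have := OM _ Oxh i; rewrite !mxE.
by move=> /andP[h1 h2] /andP[h3 h4]; apply/andP; split; lra.
Qed.

(** As phi has mean 0, - phi x is the mean over y of phi y - phi x; Jensen's
inequality bounds its p-th power. *)
Lemma zero_mean_bound : \int[mu]_(x in Omega) phi x = 0 ->
  ((pnormX mu Omega p phi)%:E <=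
   (fine (mu Omega))^-1%:E * \int[mu]_x \int[mu]_y (F x y)%:E)%E.
Proof.
move=> phi_mean; set m := fine (mu Omega).
have m0 : 0 < m by exact: open_lebesgue_gt0.
have phip : pint mu Omega p phi by have [/(LpP mO _ p0)] := W.
have cp (k : R) : pint mu Omega p (fun=> k).
  apply: (@pint_bounded _ _ _ mu Omega mO p `|k|) => //; first exact: fO.
  exact: ltW.
have pw x : Omega x -> ((`|phi x| `^ p)%:E <=
    m^-1%:E * \int[mu]_y (F x y)%:E)%E.
  move=> Ox.
  have dp := pintB mO (ltW p0) phip (cp (phi x)).
  have iphi := pint_integrable mO fO (ltW p1) phip.
  have ic := pint_integrable mO fO (ltW p1) (cp (phi x)).
  have -> : (\int[mu]_y (F x y)%:E = (pnormX mu Omega p (fun y => phi y - phi x))%:E)%E.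
    rewrite /pnormX (EFin_Rintegral mO dp.2) [RHS]integral_mkcond.
    apply: eq_integral => y _; rewrite /F !indicE mem_set// mul1r /= patchE.
    rewrite /phi0 !patchE (mem_set Ox); case: ifPn => _; first by rewrite mul1r.
    by rewrite mul0r.
  have := Rintegral_powR_le mO fO p1 dp.
  rewrite (RintegralB mO iphi ic) phi_mean sub0r (Rintegral_cst _ mO) -/m.
  rewrite normrN normrM (ger0_norm (ltW m0)) powRM ?(ltW m0)// => H.
  rewrite -EFinM lee_fin ler_pdivlMl//.
  have mp1 : 0 < m `^ (p - 1) by exact: powR_gt0.
  rewrite -(ler_pM2l mp1); apply: le_trans H.
  rewrite mulrA mulrC -(@mulr_powRB1 _ m p (ltW m0) p0) [_ * m]mulrC.
  by [].
have mF : measurable_fun setT (fun xy : 'rV[R]_d * 'rV[R]_d => (F xy.1 xy.2)%:E).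
  by apply/measurable_EFinP; exact: measurable_F.
have F0 (xy : 'rV[R]_d * 'rV[R]_d) : (0 <= (F xy.1 xy.2)%:E)%E.
  by have := D_ge0 (xy.2 - xy.1) xy.1; rewrite /D addrC subrK lee_fin.
pose J x := (\int[mu]_y (F x y)%:E)%E.
have mJ : measurable_fun setT J.
  exact: (@measurable_fun_fubini_tonelli_F _ _ _ _ R mu _ mF F0).
have J0 x : setT x -> (0 <= J x)%E.
  by move=> _; apply: integral_ge0 => y _; exact: (F0 (x, y)).
have mi0 : (0 <= m^-1%:E)%E by rewrite lee_fin invr_ge0 ltW.
have Z := @ge0_integralZl _ _ _ mu setT measurableT J mJ m^-1%:E J0 mi0.
rewrite -Z /pnormX (EFin_Rintegral mO phip.2).
have mJ' : measurable_fun setT (fun x => m^-1%:E * J x)%E by exact: measurable_funeM.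
have J0' x : (0 <= m^-1%:E * J x)%E by apply: mule_ge0 => //; exact: J0.
apply: (@le_trans _ _ (\int[mu]_(x in Omega) (m^-1%:E * J x))%E).
  apply: ge0_le_integral.
  - exact: mO.
  - by move=> x _; rewrite lee_fin; exact: powR_ge0.
  - exact: (measurable_int _ phip.2).
  - exact: measurable_funTS.
  - exact: pw.
by apply: ge0_subset_integral.
Qed.

End one_function.

(** The double integral of |phi y - phi x|^p lies between the two sides, by
zero_mean_bound and two_point_bound. *)
Lemma poincare : exists C, 0 <= C /\ forall phi g, W1 Omega p phi g ->
  \int[mu]_(x in Omega) phi x = 0 ->
  pnormX mu Omega p phi <= C * pnormX mu Omega p (fun x => enorm (g x)).
Proof.
have [M OM] := bounded_cbox bO.
set m := fine (mu Omega); have m0 : 0 < m by exact: open_lebesgue_gt0.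
pose B : set 'rV[R]_d := cbox (const_mx (- (2 * M))) (const_mx (2 * M)).
pose K := \sum_(i < d) (2 * M).
have Bfin : mu B \is a fin_num.
  by rewrite ge0_fin_numE//; exact: lebesgue_cbox_lty.
exists (m^-1 * (K `^ p * fine (mu B))); split.
  by rewrite !mulr_ge0 ?invr_ge0 ?(ltW m0) ?powR_ge0// fine_ge0.
move=> phi g W phi0; rewrite -lee_fin.
apply: le_trans (zero_mean_bound W phi0) _; rewrite -/m.
apply: le_trans (lee_wpmul2l _ (two_point_bound W OM)) _.
  by rewrite lee_fin invr_ge0 ltW.
rewrite -/B -/K -(fineK Bfin) -!EFinM lee_fin le_eqVlt; apply/orP; left; apply/eqP.
by ring.
Qed.

End poincare.

(** * The Sobolev space W^{1,p} *)

Section W1_space.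
Context (R : realType) (d : nat) (Omega : set 'rV[R]_d).
Local Notation mu := (@lebesgue_rV R d).
Hypotheses (oO : open Omega) (bO : bounded_set Omega).
Variables (p q : R).
Hypotheses (p0 : 0 < p) (q0 : 0 < q) (pq : p^-1 + q^-1 = 1).

Let mO : measurable Omega. Proof. exact: open_measurable_rV. Qed.
Let fO : (mu Omega < +oo)%E. Proof. exact: bounded_lebesgue_lty. Qed.
Let p_ge0 : 0 <= p. Proof. exact: ltW. Qed.
Let q_ge0 : 0 <= q. Proof. exact: ltW. Qed.

Lemma pint_test psi : test_function Omega psi -> pint mu Omega q psi.
Proof.
move=> t; have [M [_ hM]] := test_function_bounded t.
apply: (pint_bounded mO fO q_ge0 (M := M)).
  by apply: measurable_funTS; exact: measurable_test_function t.
by move=> x _; exact: (hM x).1.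
Qed.

Lemma pint_pderive psi i : test_function Omega psi ->
  pint mu Omega q (pderive i psi).
Proof.
move=> t; have [M [_ hM]] := test_function_bounded t.
apply: (pint_bounded mO fO q_ge0 (M := M)).
  by apply: measurable_funTS; exact: measurable_pderive t.
by move=> x _; exact: (hM x).2.
Qed.

(** The difference quotients of psi in a direction have integral 0 by translation
invariance, and are dominated because psi has bounded derivatives and compact
support. *)
Lemma integral_pderive psi i : test_function Omega psi ->
  \int[mu]_(x in Omega) pderive i psi x = 0.
Proof.
move=> t; have [M [M0 hM]] := test_function_bounded t.
have [N ON] := bounded_cbox bO.
have mpsi := measurable_test_function t.
have mdpsi := measurable_pderive i t.
pose e : 'rV[R]_d := delta_mx ord0 i.
pose B := cbox (const_mx (- (N + 1)) : 'rV[R]_d) (const_mx (N + 1)).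
have mB : measurable B by exact: measurable_cbox.
pose s n : R := n.+1%:R^-1.
have s0 n : 0 < s n by rewrite invr_gt0.
have s1 n : s n <= 1 by rewrite invf_le1// ler1n.
pose D n (x : 'rV[R]_d) := (s n)^-1 * (psi (x + s n *: e) - psi x).
have tB : mu.-integrable setT (EFin \o (fun x => M * \1_B x)).
  have := (integrable_mkcond _ mB).1 (finite_integrable_cst mB M (lebesgue_cbox_lty _ _)).
  rewrite restrict_EFin; congr (integrable _ _ (_ \o _)).
  by apply/funext => x; rewrite patchE indicE; case: (x \in B); rewrite ?mulr1 ?mulr0.
have dline (x : 'rV[R]_d) (r : R) : is_derive r (1 : R)
    (fun r : R => psi (x + r *: e)) (pderive i psi (x + r *: e)).
  move: (t) => [sm _ _]; have dp := (sm [::]).2 (x + r *: e) i.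
  have ee : (fun h : R => h^-1 *: ((fun r : R => psi (x + r *: e)) (h *: (1:R) + r) -
        psi (x + r *: e))) =
      (fun h : R => h^-1 *: (psi (h *: e + (x + r *: e)) - psi (x + r *: e))).
    apply/funext => h; rewrite [h%:A]mulr1 scalerDl; congr (_ *: (psi _ - _)).
    by rewrite addrCA.
  apply: DeriveDef; first by rewrite /derivable ee.
  by rewrite /derive ee.
have DM n x : `|D n x| <= M * \1_B x.
  have [Bx|Bx] := boolP (x \in B).
    rewrite indicE Bx mulr1 /D normrM ger0_norm ?invr_ge0 ?(ltW (s0 n))//.
    rewrite ler_pdivrMl//.
    have [] := @MVT_segment R (fun r : R => psi (x + r *: e))
      (fun r => pderive i psi (x + r *: e)) 0 (s n) (ltW (s0 n)).
      apply: continuous_subspaceT => r.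
      have [/derivable1_diffP/differentiable_continuous h _] := dline x r.
      exact: h.
    move=> c ?; rewrite scale0r addr0 subr0 => ->.
    rewrite normrM (ger0_norm (ltW (s0 n))) mulrC ler_wpM2l ?(ltW (s0 n))//.
    exact: (hM _).2.
  (* Outside B both terms of the difference quotient vanish: a point within distance 1
     of Omega along the axis is in B. *)
  have NB y r : 0 <= r <= 1 -> Omega y -> x = y - r *: e -> False.
    move=> /andP[r0 r1] Oy xy; move/negP : Bx; case; apply/mem_set => j.
    have := ON _ Oy j; rewrite xy !mxE eqxx /=.
    by case: (j == i) => /andP[h1 h2]; apply/andP; split; rewrite ?mulr1 ?mulr0; lra.
  rewrite /D !(test_function_out t); first by rewrite subr0 mulr0 normr0 mulr_ge0.
    by move=> Ox; apply: (NB x 0) => //; rewrite ?lexx ?ler01// scale0r subr0.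
  move=> Ox; apply: (NB _ (s n) _ Ox); first by rewrite (ltW (s0 n)) s1.
  by rewrite addrK.
have cD x : D n x @[n --> \oo] --> pderive i psi x.
  have [dx vx] := dline x 0; rewrite scale0r addr0 in vx.
  move: dx; rewrite /derivable => /cvg_ex[l cl].
  have vl : l = pderive i psi x by rewrite -vx /derive (cvg_lim _ cl).
  rewrite -vl.
  have cs : s n @[n --> \oo] --> (0 : R)^'.
    move=> A nA; have h : nbhs (0 : R) [set y | y != 0 -> A y] by exact: nA.
    have : \forall n \near \oo, [set y | y != 0 -> A y] (harmonic n : R).
      by apply: (@cvg_harmonic R); exact: h.
    by apply: filterS => n; apply; rewrite gt_eqF//; exact: s0.
  have := cvg_comp _ _ cs cl; apply: cvg_trans; apply: near_eq_cvg; near=> n => /=.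
  by rewrite /D /= [_%:A]mulr1 addr0 scale0r addr0.
have mDn n : measurable_fun setT (D n).
  apply: measurable_funM; first exact: measurable_cst.
  apply: measurable_funB => //.
  exact: (measurableT_comp mpsi (measurable_addrV _)).
have [_ cv] := dominated_cvg_Rintegral measurableT mDn (fun x _ => cD x) tB
  (fun n x _ => DM n x).
have e0 n : \int[mu]_x D n x = 0.
  have ipsi : mu.-integrable setT (EFin \o psi).
    apply: (integrable_le measurableT mpsi tB) => x _.
    have [Ox|Ox] := pselect (Omega x); last first.
      by rewrite (test_function_out t Ox) normr0 mulr_ge0.
    rewrite indicE mem_set ?mulr1; first exact: (hM x).1.
    move=> j; have := ON _ Ox j; rewrite !mxE => /andP[h1 h2].
    by apply/andP; split; lra.
  rewrite RintegralZl//; last exact: RintegrableB (integrable_shift _ ipsi) ipsi.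
  rewrite RintegralB//; last exact: integrable_shift.
  by rewrite Rintegral_shift// subrr mulr0.
have -> : \int[mu]_(x in Omega) pderive i psi x = \int[mu]_x pderive i psi x.
  rewrite Rintegral_mkcond; apply: eq_Rintegral => x _; rewrite patchE.
  case: ifPn => // /negP Ox; rewrite pderive_out// => cx; apply: Ox.
  by apply/mem_set; move: (t) => [_ _]; apply.
apply: (cvg_unique _ cv) => //.
by rewrite (_ : (fun n : nat => _) = cst 0); [exact: cvg_cst|apply/funext].
Unshelve. all: by end_near. Qed.

Lemma W1_pint phi g : W1 Omega p phi g -> pint mu Omega p phi.
Proof. by move=> [/(LpP mO _ p0)]. Qed.

Lemma W1_pint_coord phi g i : W1 Omega p phi g -> pint mu Omega p (fun x => g x ord0 i).
Proof. by move=> [_ + _] => /(_ i) /(LpP mO _ p0). Qed.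

Lemma W1_comb a b phi g phi' g' : W1 Omega p phi g -> W1 Omega p phi' g' ->
  W1 Omega p (fun x => a * phi x + b * phi' x) (fun x => a *: g x + b *: g' x).
Proof.
move=> W W'; split.
- apply/(LpP mO _ p0); apply: (pintD mO p_ge0); apply: (pintZ mO).
    exact: W1_pint W.
  exact: W1_pint W'.
- move=> i; apply/(LpP mO _ p0).
  under eq_fun do rewrite !mxE.
  apply: (pintD mO p_ge0); apply: (pintZ mO).
    exact: W1_pint_coord W.
  exact: W1_pint_coord W'.
move=> psi t i.
have dq := pint_pderive i t; have tq := pint_test t.
have M u v : pint mu Omega p u -> pint mu Omega q v ->
    mu.-integrable Omega (EFin \o (fun x => u x * v x)).
  exact: integrable_conj_mul.
have L (u u' v : 'rV[R]_d -> R) : pint mu Omega p u -> pint mu Omega p u' ->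
    pint mu Omega q v ->
    \int[mu]_(x in Omega) ((a * u x + b * u' x) * v x) =
    a * \int[mu]_(x in Omega) (u x * v x) + b * \int[mu]_(x in Omega) (u' x * v x).
  move=> up u'p vq; have i1 := M _ _ up vq; have i2 := M _ _ u'p vq.
  rewrite -(RintegralZl a mO i1) -(RintegralZl b mO i2).
  rewrite -(RintegralD mO (RintegrableZl mO a i1) (RintegrableZl mO b i2)).
  by apply: eq_Rintegral => x _; rewrite mulrDl !mulrA.
rewrite (L _ _ _ (W1_pint W) (W1_pint W') dq).
under [in RHS]eq_Rintegral do rewrite !mxE.
rewrite (L _ _ _ (W1_pint_coord i W) (W1_pint_coord i W') tq).
have [_ _ /(_ _ t i) ->] := W; have [_ _ /(_ _ t i) ->] := W'.
by rewrite opprD !mulrN.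
Qed.

(** A constant has weak gradient 0, because derivatives of test functions have
integral 0. *)
Lemma W1_subr_cst (c : R) phi g : W1 Omega p phi g -> W1 Omega p (fun x => phi x - c) g.
Proof.
move=> W; have cp : pint mu Omega p (fun=> c).
  by apply: (pint_bounded mO fO p_ge0 (M := `|c|)).
split; last 1 first.
- move=> psi t i; have dq := pint_pderive i t.
  have i1 := integrable_conj_mul mO p0 q0 pq (W1_pint W) dq.
  have i2 := integrable_conj_mul mO p0 q0 pq cp dq.
  under [in LHS]eq_Rintegral do rewrite mulrBl.
  rewrite (RintegralB mO i1 i2) RintegralZl ?integral_pderive ?mulr0 ?subr0//.
    by have [_ _ /(_ _ t i)] := W.
  apply: (pint_integrable mO fO (p := q)) => //.
  by rewrite -(invf_le1 q0) -pq lerDr invr_ge0.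
- by apply/(LpP mO _ p0)/(pintB mO p_ge0) => //; exact: W1_pint W.
- by have [] := W.
Qed.

Lemma W1_closed (phi_ : nat -> 'rV[R]_d -> R) (g_ : nat -> 'rV[R]_d -> 'rV[R]_d)
    (phi : 'rV[R]_d -> R) (g : 'rV[R]_d -> 'rV[R]_d) :
  (forall n, W1 Omega p (phi_ n) (g_ n)) -> pint mu Omega p phi ->
  (forall i, pint mu Omega p (fun x => g x ord0 i)) ->
  pnormX mu Omega p (fun x => phi_ n x - phi x) @[n --> \oo] --> 0 ->
  (forall i, pnormX mu Omega p (fun x => g_ n x ord0 i - g x ord0 i) @[n --> \oo] --> 0) ->
  W1 Omega p phi g.
Proof.
move=> W pp gp cp cg; split; first exact/(LpP mO _ p0).
  by move=> i; exact/(LpP mO _ p0).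
move=> psi t i.
have h1 := pnormX_conj_cvg mO p0 q0 pq (fun n => W1_pint (W n)) pp (pint_pderive i t) cp.
have h2 := pnormX_conj_cvg mO p0 q0 pq (fun n => W1_pint_coord i (W n)) (gp i)
  (pint_test t) (cg i).
apply: (cvg_unique _ h1) => //.
rewrite (_ : (fun n : nat => _) = fun n =>
   - \int[mu]_(x in Omega) (g_ n x ord0 i * psi x)); first exact: cvgN.
by apply/funext => n; have [_ _ ->] := W n.
Qed.

End W1_space.

(** * Minimisation of the p-Dirichlet functional *)

Lemma conj_exponent_mul (R : realType) (p q : R) : 0 < p -> 0 < q ->
  p^-1 + q^-1 = 1 -> (p - 1) * q = p.
Proof.
move=> p0 q0 pq.
have pn0 : p != 0 by rewrite gt_eqF.
have qn0 : q != 0 by rewrite gt_eqF.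
have e : q^-1 = 1 - p^-1 by rewrite -[X in X - _]pq addrAC subrr add0r.
apply: (mulIf (invr_neq0 qn0)); rewrite -mulrA mulfV// mulr1 e.
by rewrite mulrBr mulfV// mulr1.
Qed.

Lemma scaled_young (R : realType) (a b t p q : R) : 0 <= a -> 0 <= b -> 0 < t ->
  0 < p -> 0 < q -> p^-1 + q^-1 = 1 ->
  a * b <= (t * a) `^ p / p + (b / t) `^ q / q.
Proof.
move=> a0 b0 t0 p0 q0 pq.
have -> : a * b = (t * a) * (b / t) 
  by field; rewrite gt_eqF.
by apply: conjugate_powR => //; rewrite mulr_ge0 ?invr_ge0// ltW.
Qed.

Lemma enorm_powR_dotrV (R : realType) d (x : 'rV[R]_d) (p : R) : 2 < p ->
  enorm x `^ (p - 2) * dotrV x x = enorm x `^ p.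
Proof.
move=> p2; rewrite -enorm_sqr -powR_mulrn ?enorm_ge0//.
have [->|e0] := eqVneq (enorm x) 0.
  by rewrite !powR0 ?mulr0// gt_eqF//; lra.
by rewrite -powRD ?subrK// e0 implybT.
Qed.

(** The arithmetic of gradient_distance_le: a, b and m are the integrals of
|grad|^p for two competitors and their midpoint, D is t times larger than that
of the half difference, and s, s' are the source terms. *)
Lemma gap_of_midpoint (R : realType) (a b s s' m D t r I : R) : 0 < t -> 0 < r ->
  I <= m / r - (2^-1 * s + 2^-1 * s') -> m + t^-1 * D <= (a + b) / 2 ->
  D <= t * r * ((a / r - s + (b / r - s')) / 2 - I).
Proof.
move=> t0 r0 h1 h2; rewrite -ler_pdivrMl ?mulr_gt0//.
have h3 : (m + t^-1 * D) / r <= (a + b) / 2 / r by rewrite ler_pM2r ?invr_gt0.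
have -> : (t * r)^-1 * D = (t^-1 * D) / r by field; rewrite !gt_eqF.
move: h1 h3; rewrite mulrDl (mulrAC (a + b)) mulrDl.
by lra.
Qed.

Section minimisation.
Context (R : realType) (d : nat) (Omega : set 'rV[R]_d).
Local Notation mu := (@lebesgue_rV R d).
Hypotheses (oO : open Omega) (cO : convex_set Omega) (bO : bounded_set Omega).
Hypothesis O0 : Omega !=set0.
Variables (p q : R).
Hypotheses (p2 : 2 < p) (q0 : 0 < q) (pq : p^-1 + q^-1 = 1).
Variable f : 'rV[R]_d -> R.
Hypotheses (fq : pint mu Omega q f) (f0 : \int[mu]_(x in Omega) f x = 0).

Let mO : measurable Omega. Proof. exact: open_measurable_rV. Qed.
Let fO : (mu Omega < +oo)%E. Proof. exact: bounded_lebesgue_lty. Qed.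
Let p0 : 0 < p. Proof. exact: lt_trans p2. Qed.
Let p1 : 1 < p. Proof. by apply: lt_trans p2; rewrite ltr1n. Qed.
Let q1 : 1 <= q. Proof. by rewrite -(invf_le1 q0) -pq lerDr invr_ge0 ltW. Qed.
Let qp : q^-1 + p^-1 = 1. Proof. by rewrite addrC. Qed.

Local Notation G g := (\int[mu]_(x in Omega) (enorm (g x) `^ p)).
Local Notation S phi := (\int[mu]_(x in Omega) (f x * phi x)).

Lemma W1_enorm phi g : W1 Omega p phi g -> pint mu Omega p (fun x => enorm (g x)).
Proof. by move=> [_ h _]; have [] := (pint_enorm mO g p0).1 h. Qed.

Lemma integrable_enorm phi g : W1 Omega p phi g ->
  mu.-integrable Omega (EFin \o (fun x => enorm (g x) `^ p)).
Proof.
move=> /W1_enorm[_ i]; apply: eq_integrable i => //= x _.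
by rewrite ger0_norm ?enorm_ge0.
Qed.

Lemma pnormX_enorm (g : 'rV[R]_d -> 'rV[R]_d) :
  pnormX mu Omega p (fun x => enorm (g x)) = G g.
Proof. by apply: eq_Rintegral => x _; rewrite ger0_norm ?enorm_ge0. Qed.

Lemma gradient_integral_ge0 (g : 'rV[R]_d -> 'rV[R]_d) : 0 <= G g.
Proof. by apply: Rintegral_ge0 => x _; exact: powR_ge0. Qed.

(** The map x |-> |x|^(p-2) x sends L^p to L^q because (p - 1) q = p. *)
Lemma pint_flux phi g i : W1 Omega p phi g ->
  pint mu Omega q (fun x => enorm (g x) `^ (p - 2) * g x ord0 i).
Proof.
move=> W; have [me ie] := W1_enorm W; have [mg _] := W1_pint_coord oO p0 i W.
have h : pint mu Omega q (fun x => enorm (g x) `^ (p - 1)).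
  split; first exact: (measurableT_comp (measurable_powR _)).
  apply: eq_integrable ie => //= x _.
  rewrite (ger0_norm (enorm_ge0 _)) (ger0_norm (powR_ge0 _ _)) -powRrM.
  by rewrite (conj_exponent_mul p0 q0 pq).
apply: (pint_le mO (ltW q0) _ h).
  by apply: measurable_funM => //; exact: (measurableT_comp (measurable_powR _)).
move=> x _; rewrite normrM !(ger0_norm (powR_ge0 _ _)).
have [e0|e0] := eqVneq (enorm (g x)) 0.
  have := coord_le_enorm (g x) i; rewrite e0 normr_le0 => /eqP ->.
  by rewrite normr0 mulr0 powR_ge0.
have ->: p - 1 = (p - 2) + 1 by lra.
rewrite (@powRD _ _ (p - 2) 1); last by rewrite e0 implybT.
by rewrite powRr1 ?enorm_ge0// ler_wpM2l ?powR_ge0// coord_le_enorm.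
Qed.

Lemma flux_dotrV phi g phi' g' : W1 Omega p phi g -> W1 Omega p phi' g' ->
  mu.-integrable Omega
    (EFin \o (fun x => enorm (g x) `^ (p - 2) * dotrV (g x) (g' x))) /\
  \int[mu]_(x in Omega) (enorm (g x) `^ (p - 2) * dotrV (g x) (g' x)) =
  \sum_i \int[mu]_(x in Omega) (g' x ord0 i * (enorm (g x) `^ (p - 2) * g x ord0 i)).
Proof.
move=> W W'.
have i1 i := integrable_conj_mul mO p0 q0 pq (W1_pint_coord oO p0 i W') (pint_flux i W).
have e x : enorm (g x) `^ (p - 2) * dotrV (g x) (g' x) =
    \sum_i (g' x ord0 i * (enorm (g x) `^ (p - 2) * g x ord0 i)).
  by rewrite mulr_sumr; apply: eq_bigr => i _; rewrite mulrA mulrC.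
split; last by rewrite -Rintegral_sum//; apply: eq_Rintegral => x _.
have := integrable_sum mO (index_enum 'I_d) (fun i (_ : xpredT i) => i1 i).
apply: (eq_integrable mO) => x _ /=; by rewrite e sumEFin.
Qed.

Lemma source_integrable phi g : W1 Omega p phi g ->
  mu.-integrable Omega (EFin \o (fun x => f x * phi x)).
Proof. by move=> /(W1_pint oO p0); exact: (integrable_conj_mul mO q0 p0 qp fq). Qed.

Lemma source_comb a b phi g phi' g' : W1 Omega p phi g -> W1 Omega p phi' g' ->
  S (fun x => a * phi x + b * phi' x) = a * S phi + b * S phi'.
Proof.
move=> /source_integrable i /source_integrable i'.
rewrite -(RintegralZl a mO i) -(RintegralZl b mO i').
rewrite -(RintegralD mO (RintegrableZl mO a i) (RintegrableZl mO b i')).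
by apply: eq_Rintegral => x _; rewrite mulrDr !(mulrCA (f x)).
Qed.

(** As f has integral 0, the functional does not see constants. *)
Lemma W1_zero_mean phi g : W1 Omega p phi g -> exists psi,
  [/\ W1 Omega p psi g, \int[mu]_(x in Omega) psi x = 0 & S psi = S phi].
Proof.
move=> W; pose c := (\int[mu]_(x in Omega) phi x) / fine (mu Omega).
have m0 : fine (mu Omega) != 0 by rewrite gt_eqF// open_lebesgue_gt0.
have ip := pint_integrable mO fO (ltW p1) (W1_pint oO p0 W).
have ic := finite_integrable_cst mO c fO.
exists (fun x => phi x - c); split; first exact: W1_subr_cst pq _ _ _ W.
  by rewrite (RintegralB mO ip ic) Rintegral_cst// /c divfK// subrr.
have ifq := pint_integrable mO fO q1 fq.
rewrite -[RHS]subr0 -[in RHS](mulr0 c) -f0 -(RintegralZl c mO ifq).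
rewrite -(RintegralB mO (source_integrable W) (RintegrableZl mO c ifq)).
by apply: eq_Rintegral => x _; rewrite mulrBr (mulrC c).
Qed.

Lemma W1_mid phi g phi' g' : W1 Omega p phi g -> W1 Omega p phi' g' ->
  W1 Omega p (fun x => 2^-1 * phi x + 2^-1 * phi' x) (fun x => 2^-1 *: (g x + g' x)).
Proof.
move=> W W'; rewrite (_ : (fun x => _ *: _) = fun x => 2^-1 *: g x + 2^-1 *: g' x).
  exact: (W1_comb oO bO p0 q0 pq 2^-1 2^-1 W W').
by apply/funext => x; exact: scalerDr.
Qed.

Lemma W1B phi g phi' g' : W1 Omega p phi g -> W1 Omega p phi' g' ->
  W1 Omega p (fun x => phi x - phi' x) (fun x => g x - g' x).
Proof.
move=> W W'; have := W1_comb oO bO p0 q0 pq 1 (-1) W W'.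
rewrite (_ : (fun x => _ *: _ + _ *: _) = fun x => g x - g' x).
  rewrite (_ : (fun x => _ * _ + _ * _) = fun x => phi x - phi' x)//.
  by apply/funext => x; rewrite mul1r mulN1r.
by apply/funext => x; rewrite scale1r scaleN1r.
Qed.

Local Notation J phi g := (G g / p - S phi).

(** For phi of mean 0, Young's inequality with a scaling t bounds int f phi by
t^p int |phi|^p / p plus a constant; t is chosen so that Poincare's inequality
makes the first term at most int |grad phi|^p / p. *)
Lemma functional_bounded_below : exists B, forall phi g, W1 Omega p phi g -> B <= J phi g.
Proof.
have [C [C0 HC]] := poincare oO cO bO O0 p1.
have C1 : 0 < C + 1 by rewrite ltr_wpDl.
(* The scaling satisfies t^p C <= 1. *)
pose b := pnormX mu Omega q f `^ q^-1; pose t := (C + 1) `^ (- p^-1).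
have t0 : 0 < t by rewrite powR_gt0.
exists (- ((b / t) `^ q / q)) => phi g W.
have [psi [W' m0 <-]] := W1_zero_mean W.
pose a := pnormX mu Omega p psi `^ p^-1.
have h1 : S psi <= b * a.
  by apply: le_trans (ler_norm _) (hoelder_Rintegral mO q0 p0 qp fq (W1_pint oO p0 W')).
have h2 : a * b <= (t * a) `^ p / p + (b / t) `^ q / q.
  exact: scaled_young (powR_ge0 _ _) (powR_ge0 _ _) t0 p0 q0 pq.
have h3 : (t * a) `^ p <= G g.
  rewrite powRM ?powR_ge0 ?(ltW t0)// -!powRrM mulNr mulVf ?gt_eqF//.
  rewrite powRr1 ?pnormX_ge0// powR_inv1 ?(ltW C1)// ler_pdivrMl//.
  apply: le_trans (HC _ _ W' m0) _; rewrite pnormX_enorm ler_wpM2r ?gradient_integral_ge0//.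
  by rewrite lerDl.
have h4 : (t * a) `^ p / p <= G g / p by rewrite ler_pM2r ?invr_gt0.
by rewrite mulrC in h1; lra.
Qed.

Lemma W1_0 : W1 Omega p (fun=> 0) (fun=> 0).
Proof.
have z : pint mu Omega p (fun=> 0).
  by apply: (pint_bounded mO fO (ltW p0) (M := 0)) => // x _; rewrite normr0.
split; first exact/(LpP mO _ p0).
  by move=> i; apply/(LpP mO _ p0); under eq_fun do rewrite mxE.
move=> psi _ i; under eq_Rintegral do rewrite mul0r.
under [in RHS]eq_Rintegral do rewrite mxE mul0r.
by rewrite Rintegral_cst// mul0r oppr0.
Qed.

Lemma clarkson_gradient phi g phi' g' : W1 Omega p phi g -> W1 Omega p phi' g' ->
  G (fun x => 2^-1 *: (g x + g' x)) + (2 `^ p)^-1 * G (fun x => g x - g' x) <=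
  (G g + G g') / 2.
Proof.
move=> W W'; have i := integrable_enorm W; have i' := integrable_enorm W'.
have iD := integrable_enorm (W1_mid W W').
have iB := RintegrableZl mO (2 `^ p)^-1 (integrable_enorm (W1B W W')).
have -> : (G g + G g') / 2 =
    \int[mu]_(x in Omega) (2^-1 * (enorm (g x) `^ p + enorm (g' x) `^ p)).
  rewrite (RintegralZl 2^-1 mO (RintegrableD mO i i')) (RintegralD mO i i').
  exact: mulrC.
rewrite -(RintegralZl _ mO (integrable_enorm (W1B W W'))).
rewrite -(RintegralD mO iD iB).
apply: (le_Rintegral mO (RintegrableD mO iD iB)
  (RintegrableZl mO 2^-1 (RintegrableD mO i i'))) => x _.
have := enorm_clarkson (g x) (g' x) (ltW p2).
have e : `|2^-1 : R| `^ p = (2 `^ p)^-1.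
  by rewrite ger0_norm// -[2^-1]powR_inv1// -powRrM mulN1r powRN.
by rewrite (mulrC 2^-1) (enormZ 2^-1 (g x - g' x)) powRM ?enorm_ge0// e.
Qed.

(** The midpoint of two competitors has value at least I, so Clarkson's inequality
bounds the half difference by the mean excess of the two values over I. *)
Lemma gradient_distance_le I phi g phi' g' :
  (forall phi g, W1 Omega p phi g -> I <= J phi g) ->
  W1 Omega p phi g -> W1 Omega p phi' g' ->
  G (fun x => g x - g' x) <= 2 `^ p * p * ((J phi g + J phi' g') / 2 - I).
Proof.
move=> low W W'; have := low _ _ (W1_mid W W').
rewrite (source_comb 2^-1 2^-1 W W').
have t0 : 0 < (2 : R) `^ p by rewrite powR_gt0.
by move=> h; exact: gap_of_midpoint t0 p0 h (clarkson_gradient W W').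
Qed.

(** The direct method. The gradients of a minimising sequence are Cauchy by
gradient_distance_le, the functions of mean 0 are Cauchy by Poincare's
inequality, and the limit is a minimiser by the tangent inequality at the limit,
whose linear side converges. *)
Lemma minimiser_exists : exists u gu, W1 Omega p u gu /\
  forall phi g, W1 Omega p phi g -> J u gu <= J phi g.
Proof.
have [B HB] := functional_bounded_below.
pose E : set R := [set e | exists phi g, W1 Omega p phi g /\ e = J phi g].
have iE : has_inf E.
  split; first by eexists; exists (fun=> 0), (fun=> 0); split; first exact: W1_0.
  by exists B => _ [phi [g [W ->]]]; exact: HB.
pose I := inf E.
have low phi g : W1 Omega p phi g -> I <= J phi g.
  by move=> W; apply: (ge_inf iE.2); exists phi, g.
have /choice[u_ /choice[g_ Hn]] n : exists phi, exists g, [/\ W1 Omega p phi g,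
    \int[mu]_(x in Omega) phi x = 0 & J phi g <= I + n.+1%:R^-1].
  have [|_ [phi [g [W ->]]] le] := @inf_adherent _ E n.+1%:R^-1 _ iE.
    by rewrite invr_gt0.
  have [psi [W' m0 e]] := W1_zero_mean W.
  by exists psi, g; split => //; rewrite e; exact: ltW.
have Wn n : W1 Omega p (u_ n) (g_ n) by have [] := Hn n.
have Jn n : J (u_ n) (g_ n) <= I + n.+1%:R^-1 by have [] := Hn n.
have [C [C0 HC]] := poincare oO cO bO O0 p1.
pose K := 2 `^ p * p.
have K0 : 0 < K by rewrite mulr_gt0// powR_gt0.
have half (a b c e i : R) : a <= i + c -> b <= i + e -> (a + b) / 2 - i <= (c + e) / 2.
  by lra.
have avg (a b c : R) : a <= c -> b <= c -> (a + b) / 2 <= c by lra.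
have Gmn m n : G (fun x => g_ m x - g_ n x) <= K * ((m.+1%:R^-1 + n.+1%:R^-1) / 2).
  apply: le_trans (gradient_distance_le low (Wn m) (Wn n)) _.
  by rewrite ler_pM2l//; exact: half.
have Wd m n := W1B (Wn m) (Wn n).
have cauchy (e : R) : 0 < e -> exists M, forall m n, (M <= m)%N -> (M <= n)%N ->
    (C + 1) * G (fun x => g_ m x - g_ n x) <= e.
  move=> e0; have C1 : 0 < (C + 1) * K by rewrite mulr_gt0// ltr_wpDl.
  (* The factor C + 1 serves the gradients and, by Poincare's inequality, the functions. *)
  exists (Num.truncn (((C + 1) * K) / e)) => m n Mm Mn.
  have hk k : (Num.truncn (((C + 1) * K) / e) <= k)%N -> (k.+1%:R : R)^-1 <= e / ((C + 1) * K).
    move=> le; rewrite -[leRHS]invf_div lef_pV2 ?posrE ?divr_gt0//.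
    apply: ltW; apply: lt_le_trans (truncnS_gt _) _; first by rewrite ler_nat.
  have h : (m.+1%:R^-1 + n.+1%:R^-1) / 2 <= e / ((C + 1) * K).
    by exact: avg (hk m Mm) (hk n Mn).
  apply: (@le_trans _ _ ((C + 1) * (K * (e / ((C + 1) * K))))).
    rewrite ler_pM2l ?ltr_wpDl//; apply: le_trans (Gmn m n) _.
    by rewrite ler_pM2l.
  have eK (x : R) : 0 < x -> x * (e / x) <= e by move=> x0; rewrite mulrC divfK ?gt_eqF.
  by rewrite (mulrA (C + 1) K (e / _)); exact: eK.
have GC (m n : nat) : G (fun x => g_ m x - g_ n x) <= (C + 1) * G (fun x => g_ m x - g_ n x).
  by rewrite ler_peMl ?gradient_integral_ge0// lerDr.
have [|u [up cu]] := Lp_complete mO p0 (fun n => W1_pint oO p0 (Wn n)) _.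
  move=> e e0; have [M HM] := cauchy e e0; exists M => m n Mm Mn.
  apply: le_trans (HM m n Mm Mn).
  have := HC _ _ (Wd m n).
  rewrite (RintegralB mO (pint_integrable mO fO (ltW p1) (W1_pint oO p0 (Wn m)))
    (pint_integrable mO fO (ltW p1) (W1_pint oO p0 (Wn n)))).
  have [_ -> _] := Hn m; have [_ -> _] := Hn n; rewrite subrr => /(_ erefl) h.
  apply: le_trans h _; rewrite pnormX_enorm ler_wpM2r ?gradient_integral_ge0//.
  by rewrite lerDl.
have /choice[v Hv] i : exists v, pint mu Omega p v /\
    pnormX mu Omega p (fun x => g_ n x ord0 i - v x) @[n --> \oo] --> 0.
  apply: (Lp_complete mO p0 (fun n => W1_pint_coord oO p0 i (Wn n))).
  move=> e e0; have [M HM] := cauchy e e0; exists M => m n Mm Mn.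
  apply: le_trans (HM m n Mm Mn); apply: le_trans (GC m n).
  have hp := W1_pint_coord oO p0 i (Wd m n).
  apply: (le_Rintegral mO _ (integrable_enorm (Wd m n))) => [|x _].
    by apply: eq_integrable hp.2 => // x _; rewrite /= !mxE.
  apply: ge0_ler_powR; rewrite ?nnegrE ?enorm_ge0 ?(ltW p0)//.
  by have := coord_le_enorm (g_ m x - g_ n x) i; rewrite !mxE.
pose gu (x : 'rV[R]_d) : 'rV[R]_d := \row_i v i x.
have guE i : (fun x => gu x ord0 i) = v i by apply/funext => x; rewrite mxE.
have Hg i : pint mu Omega p (fun x => gu x ord0 i) /\
    pnormX mu Omega p (fun x => g_ n x ord0 i - gu x ord0 i) @[n --> \oo] --> 0.
  by have := Hv i; rewrite -(guE i).
have Wu : W1 Omega p u gu.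
  by apply: (W1_closed oO bO p0 q0 pq Wn up _ cu) => i; have [] := Hg i.
exists u, gu; split => // phi g W; apply: le_trans (low _ _ W).
have cS : S (u_ n) @[n --> \oo] --> S u.
  have := pnormX_conj_cvg mO p0 q0 pq (fun n => W1_pint oO p0 (Wn n)) up fq cu.
  rewrite (_ : \int[mu]_(x in Omega) (u x * f x) = S u); last first.
    by apply: eq_Rintegral => x _; rewrite mulrC.
  rewrite (_ : (fun n : nat => \int[mu]_(x in Omega) _) = fun n => S (u_ n))//.
  by apply/funext => n; apply: eq_Rintegral => x _; rewrite mulrC.
pose Hu i x := enorm (gu x) `^ (p - 2) * gu x ord0 i.
have cH i : \int[mu]_(x in Omega) (g_ n x ord0 i * Hu i x) @[n --> \oo] -->
    \int[mu]_(x in Omega) (gu x ord0 i * Hu i x).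
  apply: (pnormX_conj_cvg mO p0 q0 pq _ (Hg i).1 (pint_flux i Wu) (Hg i).2).
  by move=> n; exact: (W1_pint_coord oO p0 i (Wn n)).
pose T n := \sum_i \int[mu]_(x in Omega) (g_ n x ord0 i * Hu i x).
have GuE : \sum_i \int[mu]_(x in Omega) (gu x ord0 i * Hu i x) = G gu.
  rewrite -(flux_dotrV Wu Wu).2; apply: eq_Rintegral => x _.
  exact: enorm_powR_dotrV p2.
have cT : T n @[n --> \oo] --> G gu.
  rewrite -GuE; apply: cvg_big => [|i _]; [exact: add_continuous|exact: cH].
(* Lower semicontinuity: the gradient of the n-th competitor is above the tangent at
   the limit gradient gu, and T n is the linear part. *)
have tangent n : p * T n <= G (g_ n) + (p - 1) * G gu.
  have [i1 e1] := flux_dotrV Wu (Wn n); rewrite /T -e1.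
  have i2 := integrable_enorm (Wn n); have i3 := integrable_enorm Wu.
  rewrite -(RintegralZl p mO i1) -(RintegralZl (p - 1) mO i3).
  rewrite -(RintegralD mO i2 (RintegrableZl mO (p - 1) i3)).
  apply: (le_Rintegral mO (RintegrableZl mO p i1)
    (RintegrableD mO i2 (RintegrableZl mO (p - 1) i3))) => x _.
  exact: enorm_tangent.
have lim : T n - (p - 1) / p * G gu - S (u_ n) @[n --> \oo] --> J u gu.
  have -> : J u gu = G gu - (p - 1) / p * G gu - S u.
    by congr (_ - _); move: (G gu) => a; field; rewrite gt_eqF.
  by apply: cvgB cS; apply: cvgB cT (cvg_cst _).
have hI : I + n.+1%:R^-1 @[n --> \oo] --> I.
  rewrite -[X in _ --> X]addr0; apply: cvgD; first exact: cvg_cst.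
  exact: cvg_harmonic.
have arith (a b c : R) : p * a <= b + (p - 1) * c -> a - (p - 1) / p * c <= b / p.
  rewrite ler_pdivlMr//.
  have -> : (a - (p - 1) / p * c) * p = p * a - (p - 1) * c by field; rewrite gt_eqF.
  by rewrite lerBlDr.
apply: ler_cvg_to lim hI _; near=> n.
by apply: le_trans (Jn n); rewrite lerD2r; exact: arith (tangent n).
Unshelve. all: by end_near. Qed.

End minimisation.

(** * The Euler-Lagrange equation *)

(** The arithmetic of source_le_flux: a and b are the integrals of |grad|^p at u and
at u + r phi. *)
Lemma perturbation_bound (R : realType) (p a b s s' c r : R) : 0 < p -> 0 < r ->
  a / p - s <= b / p - (1 * s + r * s') -> b <= a + p * r * c -> s' <= c.
Proof.
move=> p0 r0 k1 k2; rewrite -(ler_pM2l r0).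
have : b / p <= a / p + r * c.
  have -> : a / p + r * c = (a + p * r * c) / p by field; rewrite gt_eqF.
  by rewrite ler_pM2r ?invr_gt0.
by lra.
Qed.

Section euler_lagrange.
Context (R : realType) (d : nat) (Omega : set 'rV[R]_d).
Local Notation mu := (@lebesgue_rV R d).
Hypotheses (oO : open Omega) (cO : convex_set Omega) (bO : bounded_set Omega).
Hypothesis O0 : Omega !=set0.
Variables (p q : R).
Hypotheses (p2 : 2 < p) (q0 : 0 < q) (pq : p^-1 + q^-1 = 1).
Variable f : 'rV[R]_d -> R.
Hypotheses (fq : pint mu Omega q f) (f0 : \int[mu]_(x in Omega) f x = 0).

Let mO : measurable Omega. Proof. exact: open_measurable_rV. Qed.
Let p0 : 0 < p. Proof. exact: lt_trans p2. Qed.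
Let pm2 : 0 < p - 2. Proof. by rewrite subr_gt0. Qed.
Let p1 : 1 < p. Proof. by apply: lt_trans p2; rewrite ltr1n. Qed.

Local Notation G g := (\int[mu]_(x in Omega) (enorm (g x) `^ p)).
Local Notation S phi := (\int[mu]_(x in Omega) (f x * phi x)).
Local Notation J phi g := (G g / p - S phi).
Local Notation flux g g' :=
  (\int[mu]_(x in Omega) (enorm (g x) `^ (p - 2) * dotrV (g x) (g' x))).

Let t (n : nat) : R := n.+1%:R^-1.

Let t0 n : 0 < t n.
Proof. by rewrite invr_gt0. Qed.

Let t1 n : t n <= 1.
Proof. by rewrite invf_le1// ler1n. Qed.

Let cvg_t : t n @[n --> \oo] --> (0 : R).
Proof. exact: cvg_harmonic. Qed.

(** The domination, uniform in n, for the limit of the fluxes. *)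
Lemma flux_dominated (x y : 'rV[R]_d) (h : R) : enorm x <= h -> enorm y <= h ->
  `|enorm x `^ (p - 2) * dotrV x y| <= h `^ p.
Proof.
move=> xh yh; have h0 : 0 <= h by apply: le_trans xh; exact: enorm_ge0.
have -> : h `^ p = h `^ (p - 2) * h ^+ 2.
  rewrite -powR_mulrn//; have [->|hn0] := eqVneq h 0.
    by rewrite !powR0 ?mulr0// gt_eqF.
  by rewrite -powRD ?subrK// hn0 implybT.
rewrite normrM ger0_norm ?powR_ge0// ler_pM ?powR_ge0//.
  by apply: ge0_ler_powR; rewrite ?nnegrE ?enorm_ge0 ?(ltW pm2).
by apply: le_trans (dotrV_le_enorm x y) _; rewrite expr2 ler_pM ?enorm_ge0.
Qed.

Lemma cvg_flux (x y : 'rV[R]_d) :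
  enorm (1 *: x + t n *: y) `^ (p - 2) * dotrV (1 *: x + t n *: y) y
    @[n --> \oo] --> enorm x `^ (p - 2) * dotrV x y.
Proof.
apply: cvgM; last first.
  have h : dotrV x y + t n * dotrV y y @[n --> \oo] --> dotrV x y + 0 * dotrV y y.
    by apply: cvgD; [exact: cvg_cst|apply: cvgMl; exact: cvg_t].
  rewrite mul0r addr0 in h.
  rewrite (_ : (fun n : nat => _) = fun n => dotrV x y + t n * dotrV y y)//.
  by apply/funext => n; rewrite scale1r dotrVDl dotrVZl.
apply: cvg_powR => [|n|]; [exact: pm2|exact: enorm_ge0|].
apply: (@cvg_comp _ _ _ (fun n => dotrV (1 *: x + t n *: y) (1 *: x + t n *: y))
  Num.sqrt \oo (nbhs (dotrV x x))); last exact: sqrt_continuous.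
have h : dotrV x x + (t n * (2 * dotrV x y) + t n * (t n * dotrV y y)) @[n --> \oo]
    --> dotrV x x + (0 * (2 * dotrV x y) + 0 * (0 * dotrV y y)).
  apply: cvgD; first exact: cvg_cst.
  apply: cvgD; first by apply: cvgMl; exact: cvg_t.
  by apply: cvgM; [exact: cvg_t|apply: cvgMl; exact: cvg_t].
rewrite !mul0r !addr0 in h.
rewrite (_ : (fun n : nat => _) = fun n =>
   dotrV x x + (t n * (2 * dotrV x y) + t n * (t n * dotrV y y)))//.
apply/funext => n; rewrite scale1r dotrVDl !dotrVDr !dotrVZl !dotrVZr (dotrVC y x).
by ring.
Qed.

Section minimiser.
Variables (u : 'rV[R]_d -> R) (gu : 'rV[R]_d -> 'rV[R]_d).
Hypotheses (Wu : W1 Omega p u gu)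
  (min_u : forall phi g, W1 Omega p phi g -> J u gu <= J phi g).

(** Compare u with u + phi / (n + 1). Minimality and the tangent inequality at the
perturbed gradient bound int f phi by its flux tested with grad phi, which
converges to that of u. *)
Lemma source_le_flux phi g : W1 Omega p phi g -> S phi <= flux gu g.
Proof.
move=> W; have Wt n := W1_comb oO bO p0 q0 pq 1 (t n) Wu W.
pose x_ n x := 1 *: gu x + t n *: g x.
have step n : S phi <= flux (x_ n) g.
  have [i1 _] := flux_dotrV oO p2 q0 pq (Wt n) W.
  have i2 := integrable_enorm oO p2 (Wt n); have i3 := integrable_enorm oO p2 Wu.
  have i4 := RintegrableZl mO (p * t n) i1.
  have h1 : G (x_ n) <= G gu + p * t n * flux (x_ n) g.
    rewrite -(RintegralZl (p * t n) mO i1) -(RintegralD mO i3 i4).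
    apply: (le_Rintegral mO i2 (RintegrableD mO i3 i4)) => x _.
    rewrite -/(x_ n x).
    have e := enorm_powR_dotrV (x_ n x) p2.
    have e' : dotrV (x_ n x) (x_ n x) = dotrV (x_ n x) (gu x) + t n * dotrV (x_ n x) (g x).
      by rewrite [in X in dotrV _ X = _]/x_ scale1r dotrVDr dotrVZr.
    have arith (a b c k l r D : R) : k * D = r -> D = b + a * c ->
        p * (k * b) <= l + (p - 1) * r -> r <= l + p * a * (k * c).
      move=> <- -> h; rewrite -subr_ge0.
      have -> : l + p * a * (k * c) - k * (b + a * c) =
          l + (p - 1) * (k * (b + a * c)) - p * (k * b) by ring.
      by rewrite subr_ge0.
    exact: arith e e' (enorm_tangent (x_ n x) (gu x) p1).
  have := min_u (Wt n); rewrite (source_comb oO p2 q0 pq fq 1 (t n) Wu W) => h2.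
  exact: perturbation_bound p0 (t0 n) h2 h1.
(* The perturbed gradients are all bounded by h, since the factors t n are at most 1. *)
pose h x := enorm (gu x) + enorm (g x).
have ih : mu.-integrable Omega (EFin \o (fun x => h x `^ p)).
  have [_ i] := pintD mO (ltW p0) (W1_enorm oO p2 Wu) (W1_enorm oO p2 W).
  apply: (eq_integrable mO) i => x _ /=.
  by rewrite ger0_norm ?addr_ge0 ?enorm_ge0.
have m n : measurable_fun Omega
    (fun x => enorm (x_ n x) `^ (p - 2) * dotrV (x_ n x) (g x)).
  exact: integrable_measurable (flux_dotrV oO p2 q0 pq (Wt n) W).1.
have [|_ cv] := dominated_cvg_Rintegral mO m
    (fun x _ => @cvg_flux (gu x) (g x)) ih.
  move=> n x _; apply: flux_dominated; last by rewrite lerDr enorm_ge0.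
  apply: le_trans (enormD _ _) _; rewrite scale1r lerD2l enormZ.
  by rewrite ger0_norm ?(ltW (t0 n))// ler_piMl ?enorm_ge0.
by apply: (cvgr_to_ge cv); near=> n; exact: step.
Unshelve. all: by end_near. Qed.

(** The inequality source_le_flux for phi and for - phi. *)
Lemma minimiser_p_poisson : p_poisson Omega p f u gu.
Proof.
split => // phi g W; apply/le_anti/andP; split; last exact: source_le_flux W.
have Wm := W1_comb oO bO p0 q0 pq (-1) 0 W W.
have := source_le_flux Wm; rewrite (source_comb oO p2 q0 pq fq (-1) 0 W W).
have -> : flux gu (fun x => -1 *: g x + 0 *: g x) = -1 * flux gu g.
  have [i1 _] := flux_dotrV oO p2 q0 pq Wu W.
  rewrite -(RintegralZl (-1) mO i1); apply: eq_Rintegral => x _.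
  by rewrite scale0r addr0 dotrVZr mulrCA.
by rewrite mul0r addr0 !mulN1r lerN2.
Qed.

End minimiser.

Lemma p_poisson_exists : exists u gu, p_poisson Omega p f u gu.
Proof.
have [u [gu [W h]]] := minimiser_exists oO cO bO O0 p2 q0 pq fq f0.
by exists u, gu; exact: minimiser_p_poisson.
Qed.

End euler_lagrange.

(** * Duality *)

Lemma ae_eq0_of_Rintegral d (T : measurableType d) (R : realType)
    (mu : {measure set T -> \bar R}) (D : set T) (h : T -> R) :
  measurable D -> mu.-integrable D (EFin \o h) -> (forall x, D x -> 0 <= h x) ->
  \int[mu]_(x in D) h x <= 0 -> {ae mu, forall x, D x -> h x = 0}.
Proof.
move=> mD ih h0 int0.
have mh : measurable_fun D (EFin \o h).
  by apply/measurable_EFinP; exact: integrable_measurable ih.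
have e : (\int[mu]_(x in D) `|(EFin \o h) x| = 0)%E.
  rewrite (_ : (\int[mu]_(x in D) `|(EFin \o h) x| = \int[mu]_(x in D) (h x)%:E)%E).
    rewrite -(EFin_Rintegral mD ih); congr EFin; apply/le_anti.
    by rewrite int0 Rintegral_ge0.
  by apply: eq_integral => x /[!inE] Dx; rewrite gee0_abs// lee_fin h0.
have := (ae_eq_integral_abs mu mD mh).1 e; apply: filterS => x hx Dx.
by have [] := hx Dx.
Qed.

(** The exponents p/2 and r are conjugate: r = p / (p - 2). *)
Lemma conj_half (R : realType) (p r : R) : 2 < p -> 0 < r -> (p - 2) * r = p ->
  (p / 2)^-1 + r^-1 = 1 /\ 1 < r.
Proof.
move=> p2 r0 pr; have pm2 : 0 < p - 2 by rewrite subr_gt0.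
have p0 : 0 < p by apply: lt_trans p2.
have -> : r = p / (p - 2) by rewrite -{1}pr mulrC mulKf// gt_eqF.
split; last by rewrite ltr_pdivlMr// mul1r ltrBlDr ltrDl.
by field; rewrite !gt_eqF.
Qed.

Lemma enorm_sqr_powR (R : realType) d (x : 'rV[R]_d) (p : R) :
  (enorm x ^+ 2) `^ (p / 2) = enorm x `^ p.
Proof.
by rewrite -powR_mulrn ?enorm_ge0// -powRrM mulrC divfK// pnatr_eq0.
Qed.

Lemma dual_value_arith (R : realType) (p q r A M C g : R) : 0 < p -> 0 < r ->
  p^-1 + q^-1 = 1 -> g = A / (p / 2) + C / r - 2 * M ->
  A / q + 2^-1 * g = A - M + 2^-1 * (C / r).
Proof.
move=> p0 r0 pq ->.
have -> : q^-1 = 1 - p^-1 by rewrite -[X in X - _]pq addrAC subrr add0r.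
by field; rewrite !gt_eqF.
Qed.

Lemma star_value_arith (R : realType) (p q r A : R) : 0 < p -> 0 < r ->
  p^-1 + q^-1 = 1 -> (p / 2)^-1 + r^-1 = 1 -> A / 2 + 2^-1 * (A / r) = A / q.
Proof.
move=> p0 r0 pq pr.
have flip (a b : R) : a + b = 1 -> b = 1 - a by move=> <-; rewrite addrAC subrr add0r.
rewrite (flip _ _ pq) (flip _ _ pr).
by field; rewrite !gt_eqF.
Qed.

Lemma flux_value_arith (R : realType) (p q A V : R) : 0 < q -> p^-1 + q^-1 = 1 ->
  A <= q^-1 * V + p^-1 * A -> A <= V.
Proof.
move=> q0 pq; have -> : p^-1 = 1 - q^-1 by rewrite -[X in X - _]pq addrK.
rewrite mulrBl mul1r => h; rewrite -(ler_pM2l (_ : 0 < q^-1)) ?invr_gt0//.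
by lra.
Qed.

Lemma flux_norm_powR (R : realType) (e p q : R) : 0 <= e -> 2 < p -> 0 < q ->
  p^-1 + q^-1 = 1 -> (e `^ (p - 2) * e) `^ q = e `^ p.
Proof.
move=> e0 p2 q0 pq; have p0 : 0 < p by apply: lt_trans p2.
have [->|en0] := eqVneq e 0.
  by rewrite mulr0 !powR0 ?gt_eqF.
rewrite -{2}[e]powRr1// -powRD ?en0 ?implybT// -powRrM.
congr (_ `^ _); rewrite (_ : p - 2 + 1 = p - 1); last by ring.
exact: conj_exponent_mul p0 q0 pq.
Qed.

Section duality.
Context (R : realType) (d : nat) (Omega : set 'rV[R]_d).
Local Notation mu := (@lebesgue_rV R d).
Hypothesis oO : open Omega.
Variables (p q r : R).
Hypotheses (p2 : 2 < p) (q0 : 0 < q) (pq : p^-1 + q^-1 = 1).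
Hypotheses (r0 : 0 < r) (pr : (p - 2) * r = p).
Variable f : 'rV[R]_d -> R.
Hypothesis fq : pint mu Omega q f.

Let mO : measurable Omega. Proof. exact: open_measurable_rV. Qed.
Let p0 : 0 < p. Proof. exact: lt_trans p2. Qed.
Let pp0 : 0 < p / 2. Proof. by rewrite divr_gt0. Qed.
Let prq : (p / 2)^-1 + r^-1 = 1. Proof. by have [] := conj_half p2 r0 pr. Qed.

Local Notation G g := (\int[mu]_(x in Omega) (enorm (g x) `^ p)).
Local Notation S phi := (\int[mu]_(x in Omega) (f x * phi x)).
Local Notation M g m := (\int[mu]_(x in Omega) (enorm (g x) ^+ 2 / 2 * m x)).
Local Notation L m := (energy Omega p f m +
  2^-1%:E * \int[mu]_(x in Omega) (m x `^ r / r)%:E)%E.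

Lemma pint_Lp_plus m : Lp_plus Omega r m -> pint mu Omega r m.
Proof. by move=> [/(LpP mO _ r0)]. Qed.

Lemma pint_enorm_sqr phi g : W1 Omega p phi g ->
  pint mu Omega (p / 2) (fun x => enorm (g x) ^+ 2).
Proof.
move=> W; have [me _] := W1_enorm oO p2 W; split; first exact: measurable_funX.
apply: (eq_integrable mO) (integrable_enorm oO p2 W) => x _ /=.
by rewrite ger0_norm ?sqr_ge0// enorm_sqr_powR.
Qed.

Lemma integrable_weighted phi g m : W1 Omega p phi g -> pint mu Omega r m ->
  mu.-integrable Omega (EFin \o (fun x => enorm (g x) ^+ 2 / 2 * m x)).
Proof.
move=> W rm.
have i := integrable_conj_mul mO pp0 r0 prq (pint_enorm_sqr W) rm.
apply: (eq_integrable mO) (RintegrableZl mO 2^-1 i) => x _ /=.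
by rewrite mulrA (mulrC 2^-1).
Qed.

Lemma test_energyE phi g m : W1 Omega p phi g -> pint mu Omega r m ->
  (\int[mu]_(x in Omega) (phi x * f x)%:E -
   \int[mu]_(x in Omega) (enorm (g x) ^+ 2 / 2 * m x)%:E =
   (S phi - M g m)%:E)%E.
Proof.
move=> W rm; rewrite -(EFin_Rintegral mO (integrable_weighted W rm)).
have i := source_integrable oO p2 q0 pq fq W.
rewrite (_ : (\int[mu]_(x in Omega) (phi x * f x)%:E = (S phi)%:E)%E)//.
rewrite (EFin_Rintegral mO i); apply: eq_integral => x _.
by rewrite mulrC.
Qed.

(** A density is non-negative only almost everywhere, so its powers are compared with
those of its absolute value. *)
Lemma convex_termE m : Lp_plus Omega r m ->
  (\int[mu]_(x in Omega) (m x `^ r / r)%:E = (pnormX mu Omega r m / r)%:E)%E.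
Proof.
move=> Lm; have [mm im] := pint_Lp_plus Lm; have [_ m0] := Lm.
have -> : pnormX mu Omega r m / r = \int[mu]_(x in Omega) (r^-1 * `|m x| `^ r).
  by rewrite (RintegralZl r^-1 mO im) mulrC.
rewrite (EFin_Rintegral mO (RintegrableZl mO r^-1 im)).
apply: (ae_eq_integral _ _ mO).
- apply/measurable_EFinP/measurable_funM => //.
  exact: (measurableT_comp (measurable_powR r)).
- apply/measurable_EFinP/measurable_funM => //.
  exact: measurable_abs_powR.
by apply: filterS m0 => x m0 Ox; rewrite ger0_norm ?m0// mulrC.
Qed.

Section solution.
Variables (u : 'rV[R]_d -> R) (gu : 'rV[R]_d -> 'rV[R]_d).
Hypothesis sol : p_poisson Omega p f u gu.

Let Wu : W1 Omega p u gu. Proof. exact: sol.1. Qed.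

Let sourceE : S u = G gu.
Proof.
rewrite -(sol.2 _ _ Wu); apply: eq_Rintegral => x _.
exact: enorm_powR_dotrV p2.
Qed.

Let gap (m : 'rV[R]_d -> R) (x : 'rV[R]_d) :=
  (enorm (gu x) ^+ 2) `^ (p / 2) / (p / 2) + `|m x| `^ r / r -
  enorm (gu x) ^+ 2 * `|m x|.

Let gap_ge0 m x : 0 <= gap m x.
Proof. by rewrite subr_ge0; apply: conjugate_powR => //; exact: sqr_ge0. Qed.

Let gapE m : Lp_plus Omega r m ->
  mu.-integrable Omega (EFin \o gap m) /\
  \int[mu]_(x in Omega) gap m x =
  G gu / (p / 2) + pnormX mu Omega r m / r - 2 * M gu m.
Proof.
move=> Lm; have rm := pint_Lp_plus Lm; have [_ m0] := Lm.
have i1 := RintegrableZl mO (p / 2)^-1 (pint_enorm_sqr Wu).2.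
have i2 := RintegrableZl mO r^-1 rm.2.
have i3 := integrable_conj_mul mO pp0 r0 prq (pint_enorm_sqr Wu) (pint_abs mO rm).
have gapf x : gap m x = ((p / 2)^-1 * `|enorm (gu x) ^+ 2| `^ (p / 2) +
    r^-1 * `|m x| `^ r) - enorm (gu x) ^+ 2 * `|m x|.
  by rewrite (ger0_norm (sqr_ge0 _)) /gap (mulrC (_ `^ (p / 2))) (mulrC (_ `^ r)).
split.
  apply: (eq_integrable mO) (RintegrableB mO (RintegrableD mO i1 i2) i3) => x _ /=.
  by rewrite gapf.
have -> : \int[mu]_(x in Omega) gap m x = \int[mu]_(x in Omega)
   (((p / 2)^-1 * `|enorm (gu x) ^+ 2| `^ (p / 2) +
    r^-1 * `|m x| `^ r) - enorm (gu x) ^+ 2 * `|m x|).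
  by apply: eq_Rintegral => x _; exact: gapf.
rewrite (RintegralB mO (RintegrableD mO i1 i2) i3) (RintegralD mO i1 i2).
rewrite (RintegralZl _ mO (pint_enorm_sqr Wu).2) (RintegralZl _ mO rm.2).
have e1 : \int[mu]_(x in Omega) (`|enorm (gu x) ^+ 2| `^ (p / 2)) = G gu.
  by apply: eq_Rintegral => x _; rewrite ger0_norm ?sqr_ge0// enorm_sqr_powR.
congr (_ + _ - _).
- exact: etrans (mulrC _ _) (congr1 (fun z => z / (p / 2)) e1).
- exact: mulrC.
have i4 := RintegrableZl mO 2 (integrable_weighted Wu rm).
(* The gap contains |m|, which equals m almost everywhere. *)
rewrite -(RintegralZl 2 mO (integrable_weighted Wu rm)).
apply: (ae_eq_Rintegral mO); [exact: integrable_measurable i3| exact: integrable_measurable i4|].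
apply: filterS m0 => x m0 Ox; rewrite ger0_norm ?m0//.
by field.
Qed.

(** The solution u as a competitor in the energy; what is lost over A / q is half of
the gap in Young's inequality for |grad u|^2 and |m|. *)
Lemma Lbeta_ge_young_gap m : Lp_plus Omega r m ->
  ((G gu / q + 2^-1 * \int[mu]_(x in Omega) gap m x)%:E <= L m)%E.
Proof.
move=> Lm; rewrite (dual_value_arith p0 r0 pq (gapE Lm).2) (convex_termE Lm).
rewrite EFinD EFinM; apply: leeD2r; apply: ereal_sup_ubound.
exists u, gu; split => //; have rm := pint_Lp_plus Lm.
by rewrite (test_energyE Wu rm) sourceE.
Qed.

Lemma Lbeta_ge m : Lp_plus Omega r m -> ((G gu / q)%:E <= L m)%E.
Proof.
move=> Lm; apply: le_trans (Lbeta_ge_young_gap Lm); rewrite lee_fin lerDl.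
by rewrite mulr_ge0// Rintegral_ge0.
Qed.

(** A density with value at most A / q has a Young gap of integral 0; the equality
case gives |grad u|^p = m^r pointwise. *)
Lemma Lbeta_le_ae m : Lp_plus Omega r m -> (L m <= (G gu / q)%:E)%E ->
  {ae mu, forall x, Omega x -> m x = enorm (gu x) `^ (p - 2)}.
Proof.
move=> Lm le; have [ig _] := gapE Lm.
have := le_trans (Lbeta_ge_young_gap Lm) le; rewrite lee_fin gerDl pmulr_rle0// => int0.
have [_ m0] := Lm.
apply: filterS2 m0 (ae_eq0_of_Rintegral mO ig (fun x _ => gap_ge0 m x) int0).
move=> x m0 g0 Ox; have := g0 Ox => /eqP; rewrite subr_eq0 => /eqP e.
have := young_eq (sqr_ge0 (enorm (gu x))) (normr_ge0 (m x)) _ (conj_half p2 r0 pr).2 prq.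
rewrite e enorm_sqr_powR ltr_pdivlMr// mul1r => /(_ p2 (lexx _)).
rewrite ger0_norm ?m0// -{1}pr powRrM => e'.
have := congr1 (fun z => z `^ r^-1) e'; rewrite -!powRrM mulfV ?gt_eqF//.
by rewrite !mulr1 powRr1 ?m0// => <-.
Qed.

Lemma Lp_plus_star : Lp_plus Omega r (fun x => enorm (gu x) `^ (p - 2)).
Proof.
split; last by apply: aeW => x _; exact: powR_ge0.
have [me _] := W1_enorm oO p2 Wu.
apply/(LpP mO _ r0); split; first exact: (measurableT_comp (measurable_powR _)).
apply: (eq_integrable mO) (integrable_enorm oO p2 Wu) => x _ /=.
by rewrite ger0_norm ?powR_ge0// -powRrM pr.
Qed.

(** For the density |grad u|^(p-2) the equation turns int f phi into the integral of
the density times grad u . grad phi, and the latter is at most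
|grad u|^2 / 2 + |grad phi|^2 / 2. So the energy is at most A / 2. *)
Lemma Lbeta_star : (L (fun x => (enorm (gu x) `^ (p - 2))%R) <= (G gu / q)%:E)%E.
Proof.
have Ls := Lp_plus_star; have rs := pint_Lp_plus Ls.
set ms := (fun x => _) in Ls rs *.
have e : pnormX mu Omega r ms = G gu.
  apply: eq_Rintegral => x _.
  by rewrite ger0_norm ?powR_ge0// -powRrM pr.
rewrite (convex_termE Ls) e.
have en : (energy Omega p f ms <= (G gu / 2)%:E)%E.
  apply: ge_ereal_sup => _ [phi [g [W ->]]].
  rewrite (test_energyE W rs) lee_fin lerBlDr -(sol.2 _ _ W).
  have [i1 _] := flux_dotrV oO p2 q0 pq Wu W.
  have i2 := RintegrableZl mO 2^-1 (integrable_enorm oO p2 Wu).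
  have i3 := integrable_weighted W rs.
  rewrite mulrC -(RintegralZl 2^-1 mO (integrable_enorm oO p2 Wu)).
  rewrite -(RintegralD mO i2 i3).
  apply: (le_Rintegral mO i1 (RintegrableD mO i2 i3)) => x _.
  rewrite /ms -(enorm_powR_dotrV (gu x) p2) -enorm_sqr.
  have h : dotrV (gu x) (g x) <= 2^-1 * enorm (gu x) ^+ 2 + enorm (g x) ^+ 2 / 2.
    have := le_trans (ler_norm _) (dotrV_le_enorm (gu x) (g x)).
    have := sqr_ge0 (enorm (gu x) - enorm (g x)); rewrite sqrrB.
    by move: (dotrV _ _) (enorm _) (enorm _) => a b c; lra.
  have := ler_wpM2l (powR_ge0 (enorm (gu x)) (p - 2)) h.
  by rewrite mulrDr (mulrCA _ 2^-1) (mulrC _ (enorm (g x) ^+ 2 / 2)).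
apply: le_trans (leeD2r _ en) _.
rewrite -EFinM -EFinD lee_fin le_eqVlt; apply/orP; left; apply/eqP.
exact: (star_value_arith _ p0 r0 pq prq).
Qed.

Lemma flux_costE v : Lp_vec Omega q v ->
  flux_cost Omega q v = (pnormX mu Omega q (fun x => enorm (v x)) / q)%:E.
Proof.
move=> vq; have [_ [mv iv]] := (pint_enorm mO v q0).1 vq.
rewrite mulrC -(RintegralZl q^-1 mO iv) (EFin_Rintegral mO (RintegrableZl mO q^-1 iv)).
by apply: eq_integral => x _; rewrite ger0_norm ?enorm_ge0// mulrC.
Qed.

(** Test div v = f with u and apply Young's inequality to |v| |grad u|. *)
Lemma flux_cost_ge v : Lp_vec Omega q v -> div_eq Omega p f v ->
  ((G gu / q)%:E <= flux_cost Omega q v)%E.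
Proof.
move=> vq dv; rewrite (flux_costE vq) lee_fin ler_pM2r ?invr_gt0//.
have [mv ev] := (pint_enorm mO v q0).1 vq.
have eu := W1_enorm oO p2 Wu.
have i1 := integrable_conj_mul mO q0 p0 (etrans (addrC _ _) pq) ev eu.
have idot : mu.-integrable Omega (EFin \o (fun x => dotrV (v x) (gu x))).
  apply: (integrable_le mO _ i1) => [|x _]; last exact: dotrV_le_enorm.
  apply: measurable_sum => i; apply: measurable_funM; first exact: mv.
  exact: (W1_pint_coord oO p0 i Wu).1.
have i2 := RintegrableD mO (RintegrableZl mO q^-1 ev.2)
  (RintegrableZl mO p^-1 (integrable_enorm oO p2 Wu)).
have h : S u <= q^-1 * pnormX mu Omega q (fun x => enorm (v x)) + p^-1 * G gu.
  rewrite -(dv _ _ Wu) -mulN1r -(RintegralZl (-1) mO idot).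
  rewrite -(RintegralZl q^-1 mO ev.2).
  rewrite -(RintegralZl p^-1 mO (integrable_enorm oO p2 Wu)).
  rewrite -(RintegralD mO (RintegrableZl mO q^-1 ev.2)
    (RintegrableZl mO p^-1 (integrable_enorm oO p2 Wu))).
  apply: (le_Rintegral mO (RintegrableZl mO (-1) idot) i2) => x _.
  rewrite mulN1r (ger0_norm (enorm_ge0 _)).
  apply: le_trans (ler_norm _) _; rewrite normrN.
  apply: le_trans (dotrV_le_enorm _ _) _.
  rewrite (mulrC q^-1) (mulrC p^-1).
  by apply: conjugate_powR; rewrite ?enorm_ge0// addrC.
by move: h; rewrite sourceE; exact: flux_value_arith.
Qed.

(** The optimal flux is - |grad u|^(p-2) grad u; the sign is that of the constraint. *)
Lemma flux_star : exists v, [/\ Lp_vec Omega q v, div_eq Omega p f v &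
  flux_cost Omega q v = (G gu / q)%:E].
Proof.
exists (fun x => - (enorm (gu x) `^ (p - 2) *: gu x)).
have Lv : Lp_vec Omega q (fun x => - (enorm (gu x) `^ (p - 2) *: gu x)).
  move=> i; apply/(LpP mO _ q0).
  rewrite (_ : (fun x => _) = fun x => -1 * (enorm (gu x) `^ (p - 2) * gu x ord0 i)).
    by apply: (pintZ mO); exact: (pint_flux oO p2 q0 pq i Wu).
  by apply/funext => x; rewrite !mxE mulN1r.
split => //.
  move=> phi g W; rewrite -(sol.2 _ _ W).
  have [i1 _] := flux_dotrV oO p2 q0 pq Wu W.
  have e : \int[mu]_(x in Omega) dotrV (- (enorm (gu x) `^ (p - 2) *: gu x)) (g x) =
      -1 * \int[mu]_(x in Omega) (enorm (gu x) `^ (p - 2) * dotrV (gu x) (g x)).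
    rewrite -(RintegralZl (-1) mO i1); apply: eq_Rintegral => x _.
    by rewrite dotrVNl dotrVZl mulN1r.
  by rewrite (congr1 -%R e) mulN1r opprK.
have e : pnormX mu Omega q (fun x => enorm (- (enorm (gu x) `^ (p - 2) *: gu x))) = G gu.
  apply: eq_Rintegral => x _.
  rewrite (ger0_norm (enorm_ge0 _)) enormN enormZ (ger0_norm (powR_ge0 _ _)).
  exact: flux_norm_powR (enorm_ge0 _) p2 q0 pq.
by rewrite (flux_costE Lv) e.
Qed.

End solution.

End duality.

(** * Equality of the infima and the unique minimiser *)

Theorem proposition2 (R : realType) (d : nat) (d_gt0 : (0 < d)%N)
    (Omega : set 'rV[R]_d) (Omega_dom : smooth_convex_domain Omega)
    (beta : R) (beta_gt0 : 0 < beta) (beta_lt1 : beta < 1)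
    (fp fm : 'rV[R]_d -> R)
    (fp_L2 : Lp_plus Omega 2 fp) (fm_L2 : Lp_plus Omega 2 fm)
    (fp_fm : \int[lebesgue_rV]_(x in Omega) fp x =
             \int[lebesgue_rV]_(x in Omega) fm x) :
  let r := (2 - beta) / beta in
  let q := 2 - beta in
  let p := (2 - beta) / (1 - beta) in
  let f := fun x => fp x - fm x in
  ereal_inf [set Lbeta Omega beta f mu | mu in Lp_plus Omega r] =
  ereal_inf [set flux_cost Omega q v | v in
               [set v | Lp_vec Omega q v /\ div_eq Omega p f v]] /\
  exists mustar : 'rV[R]_d -> R,
    [/\ minimizer_on (Lbeta Omega beta f) (Lp_plus Omega r) mustar,
        (forall mu, minimizer_on (Lbeta Omega beta f) (Lp_plus Omega r) mu ->
          {ae lebesgue_rV, forall x, Omega x -> mu x = mustar x}),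
        (exists u gu, p_poisson Omega p f u gu) &
        (forall u gu, p_poisson Omega p f u gu ->
          {ae lebesgue_rV, forall x, Omega x ->
             mustar x = enorm (gu x) `^ (p - 2)})].
Proof.
move=> r q p f; have [[ne oO _] [bO cO _]] := Omega_dom.
have mO := open_measurable_rV oO; have fO := bounded_lebesgue_lty oO bO.
have b1 : 0 < 1 - beta by rewrite subr_gt0.
have q_gt1 : 1 < q by rewrite /q; lra.
have q0 : 0 < q by apply: lt_trans q_gt1.
have p2 : 2 < p by rewrite /p ltr_pdivlMr//; lra.
have r0 : 0 < r by rewrite divr_gt0.
have pq : p^-1 + q^-1 = 1.
  by rewrite /p /q; field; rewrite !gt_eqF.
have pr : (p - 2) * r = p.
  by rewrite /p /r; field; rewrite !gt_eqF.
have L2 g : Lp_plus Omega 2 g -> pint lebesgue_rV Omega q g.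
  move=> [/(LpP mO _ (ltr0n _ 2)) g2 _].
  by apply: (pint_sub mO fO (ltW q0) _ g2); rewrite /q; lra.
have fpq := L2 _ fp_L2; have fmq := L2 _ fm_L2.
have fq : pint lebesgue_rV Omega q f := pintB mO (ltW q0) fpq fmq.
have f0 : \int[lebesgue_rV]_(x in Omega) f x = 0.
  rewrite (RintegralB mO (pint_integrable mO fO (ltW q_gt1) fpq)
    (pint_integrable mO fO (ltW q_gt1) fmq)).
  by rewrite fp_fm subrr.
have [u [gu sol]] := p_poisson_exists oO cO bO ne p2 q0 pq fq f0.
have Ls := Lp_plus_star oO p2 r0 pr sol.
have Lstar := Lbeta_star oO p2 q0 pq r0 pr fq sol.
have Lge m (Lm : Lp_plus Omega r m) := Lbeta_ge oO p2 q0 pq r0 pr fq sol Lm.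
have [v [vq dv cv]] := flux_star oO p2 q0 pq sol.
split.
  transitivity (flux_cost Omega q v).
    rewrite cv; apply/le_anti/andP; split.
      apply: le_trans Lstar; apply: ereal_inf_lbound.
      by exists (fun x => enorm (gu x) `^ (p - 2)).
    by apply: le_ereal_inf_tmp => _ [m Lm <-]; exact: Lge.
  apply/le_anti/andP; split; last first.
    by apply: ereal_inf_lbound; exists v.
  rewrite cv; apply: le_ereal_inf_tmp => _ [w [wq dw] <-].
  exact: (flux_cost_ge oO p2 q0 pq sol wq dw).
exists (fun x => enorm (gu x) `^ (p - 2)); split.
- by split=> [|m Lm]; [exact: Ls|exact: le_trans Lstar (Lge m Lm)].
- move=> m [Lm min_m].
  apply: (Lbeta_le_ae oO p2 q0 pq r0 pr fq sol Lm).
  exact: le_trans (min_m _ Ls) Lstar.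
- by exists u, gu.
move=> u' gu' sol'.
apply: (Lbeta_le_ae oO p2 q0 pq r0 pr fq sol' Ls).
apply: le_trans Lstar _.
apply: le_trans (Lge _ (Lp_plus_star oO p2 r0 pr sol')) _.
exact: (Lbeta_star oO p2 q0 pq r0 pr fq sol').
Qed.
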